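(* Let $n\geq 1$, $0<T<\infty$, $\mathbb{R}^{n+1}_T=\mathbb{R}^n\times(0,T)$. Let $A=((a_{jk}))$ be a real symmetric positive definite $n\times n$ matrix, $b=(b_1,\dots,b_n)\in\mathbb{R}^n$, $c\in\mathbb{R}$, $\alpha\in(0,1)$, and $p\in(n+2,\infty]$ with $1/p+1/p'=1$. For $f\in L^p(\mathbb{R}^{n+1}_T)\cap C^\alpha(\overline{\mathbb{R}^{n+1}_T})$ let $u$ be the solution of the Cauchy problem $$\frac{\partial u}{\partial t}=\sum_{j,k=1}^n a_{jk}\frac{\partial^2 u}{\partial x_j\partial x_k}+\sum_{j=1}^n b_j\frac{\partial u}{\partial x_j}+cu+f(x,t) \ \text{ in } \mathbb{R}^{n+1}_T,\qquad u\big|_{t=0}=0,$$ given by $u(x,t)=\int_0^t\int_{\mathbb{R}^n}G(x-y,t-\tau)f(y,\tau)\,dy\,d\tau$ with $G(x,t)=\frac{e^{ct}}{(2\sqrt{\pi t})^n\det A^{1/2}}e^{-\frac{1}{4t}|A^{-1/2}(x+tb)|^2}$. Let $(x,t)\in\mathbb{R}^{n+1}_T$ and let $\ell\in\mathbb{R}^n$ be a unit vector. Then the sharp (smallest possible) coefficient $\mathcal{C}_{p,\ell}(t)$ in the inequality $$\left|\frac{\partial u}{\partial\ell}(x,t)\right|\leq\mathcal{C}_{p,\ell}(t)\,\|f\|_{p,t}$$ (for all such $f$) is $$\mathcal{C}_{p,\ell}(t)=\frac{|A^{-1/2}\ell|}{\left\{2^n\pi^{(n+p-1)/2}\det A^{1/2}\right\}^{1/p}}\left\{\frac{\Gamma\left(\frac{p'+1}{2}\right)}{p'^{(n+p')/2}}\int_0^t\frac{e^{p'c\tau}}{\tau^{(n(p'-1)+p')/2}}\,d\tau\right\}^{1/p'}.$$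 Consequently, the sharp coefficient $\mathcal{C}_p(t)$ in the inequality $|\nabla_x u(x,t)|\leq\mathcal{C}_p(t)\|f\|_{p,t}$ is $\mathcal{C}_p(t)=\max_{|\ell|=1}\mathcal{C}_{p,\ell}(t)$, namely $$\mathcal{C}_p(t)=\frac{\|A^{-1/2}\|}{\left\{2^n\pi^{(n+p-1)/2}\det A^{1/2}\right\}^{1/p}}\left\{\frac{\Gamma\left(\frac{p'+1}{2}\right)}{p'^{(n+p')/2}}\int_0^t\frac{e^{p'c\tau}}{\tau^{(n(p'-1)+p')/2}}\,d\tau\right\}^{1/p'},$$ and in particular $\mathcal{C}_\infty(t)=\frac{\|A^{-1/2}\|}{\sqrt{\pi}}\int_0^t\frac{e^{c\tau}}{\sqrt{\tau}}\,d\tau$.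
   Context: $A^{1/2}$, $A^{-1/2}$ are the positive definite square roots of $A$ and $A^{-1}$. $|\cdot|$ is the Euclidean norm on $\mathbb{R}^n$; $\|B\|=\max_{|\ell|=1}|B\ell|$ is the spectral norm of a real matrix $B$. $C^\alpha(\overline{\mathbb{R}^{n+1}_T})$ denotes the space of functions $f(x,t)$ that are continuous and bounded on $\overline{\mathbb{R}^{n+1}_T}$ and locally Hölder continuous with exponent $\alpha$ in $x\in\mathbb{R}^n$, uniformly with respect to $t\in[0,T]$. For $0<t\leq T$, $\|f\|_{p,t}=\left(\int_0^t\int_{\mathbb{R}^n}|f(x,\tau)|^p\,dx\,d\tau\right)^{1/p}$ for $p<\infty$, and $\|f\|_{\infty,t}$ is the essential supremum of $|f|$ over $\mathbb{R}^n\times(0,t)$. $\partial u/\partial\ell=(\nabla_x u,\ell)$. For $p=\infty$, $p'=1$ and the factor $\{\cdots\}^{1/p}$ equals $1$.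
   Formalization: For p=∞ the factor {2^n π^{(n+p-1)/2} det A^{1/2}}^{1/p} is taken as its limit √π rather than 1; the value 1 would contradict the stated formula for C_∞(t). *)

(* Defs.v *)
From mathcomp Require Import all_boot all_algebra.
From mathcomp Require Import all_classical all_reals all_analysis.
Import GRing.Theory Num.Theory numFieldNormedType.Exports.
Set Implicit Arguments.
Unset Strict Implicit.
Unset Printing Implicit Defensive.
Local Open Scope ring_scope.
Local Open Scope classical_set_scope.

(* ---------- R^k as a measurable space with k-dimensional Lebesgue measure ----------
   RnT R k = ((unit * R) * R) * ... * R  (k factors R), carrying the product
   sigma-algebra; lebn R k is the k-fold product of Lebesgue measure
   (lebn R 0 = Dirac mass on the single point of R^0). *)
Fixpoint Rn (R : realType) (k : nat) : {d : measure_display & measurableType d} :=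
  match k with
  | 0 => existT _ _ (unit : measurableType _)
  | k.+1 => existT _ _ (((projT2 (Rn R k)) * (measurableTypeR R))%type
                          : measurableType _)
  end.

Definition RnT (R : realType) (k : nat) : measurableType (projT1 (Rn R k)) :=
  projT2 (Rn R k).

Fixpoint lebn (R : realType) (k : nat) : {measure set (RnT R k) -> \bar R} :=
  match k with
  | 0 => @dirac _ unit tt R
  | k.+1 => ((lebn R k) \x (@lebesgue_measure R))%E
  end.

(* i-th coordinate of a point of R^k (0 if i >= k). *)
Fixpoint coordn (R : realType) (k : nat) : RnT R k -> nat -> R :=
  match k return RnT R k -> nat -> R with
  | 0 => fun _ _ => 0
  | k'.+1 => fun z i => if i == k' then z.2 else coordn z.1 i
  end.

Definition vecn (R : realType) (k : nat) (z : RnT R k) : 'cV[R]_k :=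
  \col_(i < k) coordn z i.

Definition lebnt (R : realType) (n : nat) := ((lebn R n) \x (@lebesgue_measure R))%E.
Arguments lebnt : clear implicits.

Definition eucl (R : realType) (n : nat) (v : 'cV[R]_n) : R :=
  Num.sqrt (\sum_(i < n) v i 0 ^+ 2).

Definition spec_norm (R : realType) (n : nat) (B : 'M[R]_n) : R :=
  sup [set eucl (B *m l) | l in [set l : 'cV[R]_n | eucl l = 1]].

Definition sym_posdef (R : realType) (n : nat) (A : 'M[R]_n) : Prop :=
  A^T = A /\ forall v : 'cV[R]_n, v != 0 -> 0 < (v^T *m A *m v) 0 0.

Definition unitvec (R : realType) (n : nat) (i : 'I_n) : 'cV[R]_n := delta_mx i 0.

Definition grad (R : realType) (n : nat) (g : 'cV[R]_n -> R) (x : 'cV[R]_n) : 'cV[R]_n :=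
  \col_(i < n) ('D_(unitvec R i) g x).

Definition dirder (R : realType) (n : nat) (g : 'cV[R]_n -> R) (x l : 'cV[R]_n) : R :=
  \sum_(i < n) (grad g x) i 0 * l i 0.

(* ---------- the kernel and the solution ----------
   S is the positive definite square root A^{1/2} of A, so A^{-1/2} = invmx S. *)
Definition Gker (R : realType) (n : nat) (S : 'M[R]_n) (b : 'cV[R]_n) (c : R)
    (x : 'cV[R]_n) (t : R) : R :=
  expR (c * t) / ((2 * Num.sqrt (pi * t)) ^+ n * \det S)
  * expR (- (eucl (invmx S *m (x + t *: b)) ^+ 2) / (4 * t)).

Definition usol (R : realType) (n : nat) (S : 'M[R]_n) (b : 'cV[R]_n) (c : R)
    (f : 'cV[R]_n -> R -> R) (x : 'cV[R]_n) (t : R) : R :=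
  Rintegral (lebnt R n) [set z | 0 < z.2 < t]
    (fun z => Gker S b c (x - vecn z.1) (t - z.2) * f (vecn z.1) z.2).

Definition normpt (R : realType) (n : nat) (p : \bar R) (f : 'cV[R]_n -> R -> R) (t : R)
    : \bar R :=
  Lnorm (lebnt R n) p
    (fun z => (if (0 < z.2 < t) then f (vecn z.1) z.2 else 0)%:E).

Definition fclass (R : realType) (n : nat) (T alpha : R) (p : \bar R)
    (f : 'cV[R]_n -> R -> R) : Prop :=
  [/\ measurable_fun [set z : RnT R n * R | 0 < z.2 < T]
        (fun z => f (vecn z.1) z.2),
      (normpt p f T < +oo)%E,
      {within [set z : 'cV[R]_n * R | 0 <= z.2 <= T], continuous (fun z => f z.1 z.2)},
      (exists M : R, forall x t, 0 <= t <= T -> `|f x t| <= M) &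
      (forall r : R, 0 < r -> exists L : R, forall x y t,
          eucl x <= r -> eucl y <= r -> 0 <= t <= T ->
          `|f x t - f y t| <= L * eucl (x - y) `^ alpha)].

Definition sharp_const (F : Type) (R : realType) (P : F -> Prop) (Phi : F -> R)
    (N : F -> \bar R) (C : R) : Prop :=
  (forall f, P f -> ((Phi f)%:E <= C%:E * N f)%E) /\
  (forall C' : R, (forall f, P f -> ((Phi f)%:E <= C'%:E * N f)%E) -> C <= C').

Definition Gamma (R : realType) (s : R) : R :=
  fine (\int[@lebesgue_measure R]_(y in `]0%R, +oo[) (y `^ (s - 1) * expR (- y))%:E)%E.

Definition pconj (R : realType) (p : \bar R) : R :=
  match p with r%:E => r / (r - 1) | _ => 1 end.

(* {2^n pi^{(n+p-1)/2} det A^{1/2}}^{1/p}; for p = +oo its limit sqrt pi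
   (the value consistent with the stated C_infty). *)
Definition denom (R : realType) (n : nat) (S : 'M[R]_n) (p : \bar R) : R :=
  match p with
  | r%:E => (2 ^+ n * pi `^ ((n%:R + r - 1) / 2) * \det S) `^ (r^-1)
  | _ => Num.sqrt pi
  end.

Definition bracket (R : realType) (n : nat) (c : R) (p : \bar R) (t : R) : R :=
  let q := pconj p in
  (Gamma ((q + 1) / 2) / q `^ ((n%:R + q) / 2)
   * Rintegral (@lebesgue_measure R) `]0, t[
       (fun tau => expR (q * c * tau) / tau `^ ((n%:R * (q - 1) + q) / 2)))
  `^ (q^-1).

Definition C_pl (R : realType) (n : nat) (S : 'M[R]_n) (c : R) (p : \bar R) (t : R)
    (l : 'cV[R]_n) : R :=
  eucl (invmx S *m l) / denom S p * bracket n c p t.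

Definition C_p (R : realType) (n : nat) (S : 'M[R]_n) (c : R) (p : \bar R) (t : R) : R :=
  spec_norm (invmx S) / denom S p * bracket n c p t.

(* Main.v *)
(* Differentiating under the integral, du/dl (x,t) is the pairing of f with the
   kernel K(y,s) = (dG/dl)(x - y, t - s) on R^n x (0,t), so the sharp constant is
   at most the L^{p'} norm of K by Hoelder's inequality.  It is attained in the
   limit by the bounded, Hoelder continuous regularizations
   f_e = phi_e(s) K (K^2 + e)^{-(2-p')/2} / (1 + e K^2) of |K|^{p'-1} sgn K, where
   phi_e vanishes for t - s <= e.  To compute the norm, y is replaced by
   z = A^{-1/2}(x - y + (t - s) b): the kernel depends on z only through |z| and
   (z, A^{-1/2} l), and rotating two coordinates at a time reduces the integral
   to a one-dimensional absolute moment of the Gaussian, a value of Gamma. *)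

From HB Require Import structures.
Require Import Defs.
From mathcomp Require Import all_boot all_order all_algebra.
From mathcomp Require Import all_classical all_reals all_analysis.
From mathcomp Require Import measurable_realfun ess_sup_inf.
From mathcomp Require Import ring lra.
Import Order.TTheory GRing.Theory Num.Theory numFieldNormedType.Exports.
Set Implicit Arguments.
Unset Strict Implicit.
Unset Printing Implicit Defensive.
Local Open Scope ring_scope.
Local Open Scope classical_set_scope.

(** Write q = p' and let s be the time lag. The spatial integral of |K|^q is a constant times exp(q
    c s) s^(-(n(q-1)+q)/2), and this power is integrable at 0 exactly when p > n + 2. The same
    condition gives 1 <= q <= 2, which explains the shape of f_e: in |K|^(q-1) sgn K = K
    (K^2)^(-(2-q)/2) the outer power is nonpositive, so adding e to K^2 and dividing by 1 + e K^2
    can only shrink the function. Hence |f_e| <= |K|^(q-1), and since (q-1)p = q this bounds the L^p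
    norm by N^(1/p), where N is the integral of |K|^q. The norm of f_e is never computed: dominated
    convergence sends the pairing to N, and N / N^(1/p) = N^(1/q). Adding e removes the singularity
    at the zeros of K, the factor 1 + e K^2 gives boundedness, and the cutoff avoids the singular
    time. Only one-dimensional substitution and Tonelli are used for changes of variables. The
    Jacobian det A^{1/2} therefore appears as a product of one-dimensional factors, and a plane
    rotation is a substitution in one variable followed by an exchange of integrals. *)

(** * Affine substitution on the line *)

Lemma ge0_integral_affine (R : realType) (a b : R) (g : R -> \bar R) :
  a != 0 -> measurable_fun [set: R] g -> (forall x, 0 <= g x)%E ->
  (\int[lebesgue_measure]_x g (a * x + b)%R = (`|a|^-1)%:E * \int[lebesgue_measure]_x g x)%E.
Proof.
move=> a0 mg g0.
have na0 : 0 < `|a| by rewrite normr_gt0.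
pose phi : measurableTypeR R -> measurableTypeR R := fun x : R => a * x + b.
have mphi : measurable_fun setT phi.
  by apply: measurable_funD => //; exact: measurable_funM.
pose na : {nonneg R} := NngNum (ltW na0).
pose nu0 : {measure set (measurableTypeR R) -> \bar R} :=
  mscale na (pushforward lebesgue_measure phi).
pose nu := nu0 mphi.
(* Lebesgue measure is determined by its values on half-open intervals. The rescaled image measure
   has the same ones; for a < 0 the preimage is closed on the other side, with the same length. *)
have E A : measurable A -> lebesgue_measure A = nu A.
  apply: lebesgue_measure_unique => //= _ [[x y]] _ <-.
  rewrite /mscale /= /pushforward.
  have -> : phi @^-1` `]x, y] = if 0 < a then `](x - b) / a, (y - b) / a] else `[(y - b) / a, (x - b) / a[.
    apply/seteqP; split=> z /=; rewrite /phi; case: ifPn => ha /=; rewrite !in_itv /=.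
    - by rewrite ltr_pdivrMr// ler_pdivlMr// (mulrC z a) ltrBlDr lerBrDr.
    - have ha' : a < 0 by rewrite lt_neqAle a0 leNgt.
      by rewrite ltr_ndivlMr// ler_ndivrMr// (mulrC z a) ltrBlDr lerBrDr andbC.
    - by rewrite ltr_pdivrMr// ler_pdivlMr// (mulrC z a) ltrBlDr lerBrDr.
    - have ha' : a < 0 by rewrite lt_neqAle a0 leNgt.
      by rewrite ltr_ndivlMr// ler_ndivrMr// (mulrC z a) ltrBlDr lerBrDr andbC.
  case: ifPn => ha.
    rewrite !lebesgue_measure_itv/= !lte_fin ltr_pM2r ?invr_gt0// ltrD2r.
    case: ifP => xy; last by rewrite mule0.
    rewrite -!EFinD -EFinM; congr (_%:E).
    rewrite gtr0_norm//; field; exact: a0.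
  have ha' : a < 0 by rewrite lt_neqAle a0 leNgt.
  rewrite !lebesgue_measure_itv/= !lte_fin ltr_nM2r ?invr_lt0// ltrD2r.
  case: ifP => xy; last by rewrite mule0.
  rewrite -!EFinD -EFinM; congr (_%:E).
  rewrite ltr0_norm//; field; exact: a0.
have -> : (\int[lebesgue_measure]_x g x = \int[nu]_x g x)%E.
  by apply: eq_measure_integral => A mA _; rewrite -E.
rewrite ge0_integral_mscale// ge0_integral_pushforward//.
rewrite muleA -EFinM mulVf ?mul1e ?preimage_setT//.
by rewrite gt_eqF.
Qed.

(* [lebn R k] carries no sigma-finite structure, which Fubini's theorem requires. *)
Section sigma_finite_pack.
Context d (T : measurableType d) (R : realType) (m : {measure set T -> \bar R}).
Hypothesis sm : sigma_finite setT m.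

Definition sigma_finite_pack of sigma_finite setT m : set T -> \bar R := m.

HB.instance Definition _ := Measure.on (sigma_finite_pack sm).
HB.instance Definition _ :=
  Measure_isSigmaFinite.Build _ _ _ (sigma_finite_pack sm) sm.

End sigma_finite_pack.

(** * Tonelli and coordinates on R^k *)

Section lebn_theory.
Context (R : realType).

Lemma sigma_finite_lebn k : sigma_finite [set: RnT R k] (lebn R k).
Proof.
elim: k => [|k IH].
  exists (fun _ => setT); first by rewrite bigcup_const.
  by move=> i; split=> //; rewrite /= diracT ltry.
have /sigma_finiteP[F [TF ndF Foo]] := IH.
exists (fun n => F n `*` `[- n%:R, n%:R]).
  apply/seteqP; split=> // -[z r] _.
  have [i _ Fi] : (\bigcup_n F n) z by rewrite -TF.
  exists (maxn i (Num.truncn `|r|).+1) => //; split=> /=.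
    by move/subsetPset: (ndF _ _ (leq_maxl i (Num.truncn `|r|).+1)); exact.
  rewrite in_itv /= -ler_norml (le_trans (ltW (truncnS_gt _)))//.
  by rewrite ler_nat leq_maxr.
move=> n; have [mF Fn] := Foo n; split; first exact: measurableX.
have I_lty : (@lebesgue_measure R `[(- n%:R)%R, n%:R%R]%classic < +oo)%E.
  by rewrite lebesgue_measure_itv; case: ifP; rewrite ?ltry// -EFinD ltry.
by rewrite /= product_measure1E// lte_mul_pinfty// ge0_fin_numE.
Qed.

Definition slebn k : {sigma_finite_measure set (RnT R k) -> \bar R} :=
  sigma_finite_pack (sigma_finite_lebn k).

(** The last coordinate is outermost here and innermost in [integral_lebnS']: changing an earlier
    coordinate by induction on k calls for the first order, changing the last one for the second. *)
Lemma integral_lebnS k (g : RnT R k.+1 -> \bar R) :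
  measurable_fun setT g -> (forall z, 0 <= g z)%E ->
  (\int[lebn R k.+1]_z g z =
   \int[lebesgue_measure]_r \int[lebn R k]_z g (z, r))%E.
Proof.
move=> mg g0.
exact: (@fubini_tonelli2 _ _ _ _ _ (slebn k) lebesgue_measure g mg g0).
Qed.

Lemma integral_lebnS' k (g : RnT R k.+1 -> \bar R) :
  measurable_fun setT g -> (forall z, 0 <= g z)%E ->
  (\int[lebn R k.+1]_z g z =
   \int[lebn R k]_z \int[lebesgue_measure]_r g (z, r))%E.
Proof.
move=> mg g0.
exact: (@fubini_tonelli1 _ _ _ _ _ (slebn k) lebesgue_measure g mg g0).
Qed.

Lemma measurable_coordn k i : measurable_fun setT (fun z : RnT R k => coordn z i).
Proof.
elim: k => [|k IH] /=; first exact: measurable_cst.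
case: (i == k); first exact: measurable_snd.
by apply: (measurableT_comp IH); exact: measurable_fst.
Qed.

(** Coordinates are given by a total function on [nat], so inductions on k need no casts between
    ordinals. *)
Fixpoint pt k (a : nat -> R) : RnT R k :=
  match k with 0 => tt | k'.+1 => (pt k' a, a k') end.

Lemma coordn_pt k a i : (i < k)%N -> coordn (pt k a) i = a i.
Proof.
elim: k => [//|k IH] /=; rewrite ltnS leq_eqVlt.
by case: eqP => [->//|_ /= /IH].
Qed.

Lemma pt_coordn k (z : RnT R k) : pt k (coordn z) = z.
Proof.
suff H m a (w : RnT R m) : (forall i, (i < m)%N -> a i = coordn w i) -> pt m a = w.
  exact: H.
elim: m w => [|m IH] /=; first by case.
case=> w r H; congr pair; last by rewrite H //= eqxx.
apply: IH => i im; rewrite H ?(ltnW im) /= ?ltnS 1?ltnW//.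
by rewrite ltn_eqF.
Qed.

Lemma measurable_pt d (T : measurableType d) k (a : T -> nat -> R) :
  (forall i, (i < k)%N -> measurable_fun setT (a ^~ i)) ->
  measurable_fun setT (fun x => pt k (a x)).
Proof.
elim: k => [|k IH] H /=; first exact: measurable_cst.
apply/measurable_fun_pairP; split; last exact: H.
by apply: IH => i ik; apply: H; rewrite ltnW.
Qed.

End lebn_theory.
Arguments measurable_coordn {R k} i.

(** * Changing a single coordinate *)

Section change_of_variables.
Context (R : realType).
Implicit Types k : nat.

Lemma eq_pt k (a b : nat -> R) :
  (forall i, (i < k)%N -> a i = b i) -> pt k a = pt k b.
Proof.
elim: k => //= k IH H; congr pair; last exact: H.
by apply: IH => i ik; apply: H; rewrite ltnW.
Qed.

Definition upd k (z : RnT R k) (j : nat) (r : R) : RnT R k :=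
  pt k (fun i => if i == j then r else coordn z i).

Lemma coordn_upd k (z : RnT R k) j r i : (i < k)%N ->
  coordn (upd z j r) i = if i == j then r else coordn z i.
Proof. by move=> ik; rewrite coordn_pt. Qed.

Lemma updS_last k (z : RnT R k) s r : upd ((z, s) : RnT R k.+1) k r = (z, r).
Proof.
rewrite /upd /= eqxx; congr pair.
rewrite -[RHS]pt_coordn; apply: eq_pt => i ik.
by rewrite ltn_eqF.
Qed.

Lemma updS k (z : RnT R k) j s r : (j < k)%N ->
  upd ((z, s) : RnT R k.+1) j r = (upd z j r, s).
Proof.
move=> jk; rewrite /upd /= eqxx (gtn_eqF jk); congr pair.
by apply: eq_pt => i ik; rewrite (ltn_eqF ik).
Qed.

Lemma measurable_upd d (T : measurableType d) k j (z : T -> RnT R k) (r : T -> R) :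
  measurable_fun setT z -> measurable_fun setT r ->
  measurable_fun setT (fun x => upd (z x) j (r x)).
Proof.
move=> mz mr; apply: measurable_pt => i ik.
by case: (i == j) => //; exact: (measurableT_comp (measurable_coordn i) mz).
Qed.

(** Since [h] does not depend on coordinate [j], the map is affine in that coordinate once the
    others are fixed, and Tonelli reduces the claim to the line. If [j] is not the last coordinate,
    the last one is kept outside and the induction hypothesis applies to its slices. *)
Lemma ge0_integral_upd k j (lam : R) (h : RnT R k -> R) (g : RnT R k -> \bar R) :
  (j < k)%N -> lam != 0 -> measurable_fun setT h ->
  (forall z r, h (upd z j r) = h z) ->
  measurable_fun setT g -> (forall z, 0 <= g z)%E ->
  (\int[lebn R k]_z g (upd z j (lam * coordn z j + h z)%R) =
   (`|lam|^-1)%:E * \int[lebn R k]_z g z)%E.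
Proof.
move=> jk lam0; elim: k jk h g => [//|k IH] jk h g mh hj mg g0.
have mphi : measurable_fun setT
    (fun z : RnT R k.+1 => upd z j (lam * coordn z j + h z)%R).
  apply: measurable_upd => //; apply: measurable_funD => //.
  by apply: measurable_funM => //; exact: (measurable_coordn j).
have mgp : measurable_fun setT (fun z => g (upd z j (lam * coordn z j + h z)%R)).
  exact: measurableT_comp mg mphi.
have [ltjk|] := ltnP j k; last first.
  move=> kj; have jE : j = k by apply/eqP; rewrite eqn_leq kj -ltnS jk.
  subst j.
  rewrite (integral_lebnS' mgp)// (integral_lebnS' mg)//.
  rewrite -ge0_integralZl//; first last.
  - by move=> z _; apply: integral_ge0.
  - exact: (@measurable_fun_fubini_tonelli_F _ _ _ _ _ lebesgue_measure g mg g0).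
  apply: eq_integral => z _.
  have mgz : measurable_fun [set: R] (fun r : R => g (z, r)).
    by apply: (measurableT_comp mg); exact: measurable_pair1.
  (* [h] ignores the last coordinate, so its value at 0 serves as the constant of the affine map. *)
  rewrite -(ge0_integral_affine (h (z, 0)) lam0 mgz)//.
  apply: eq_integral => r _.
  rewrite updS_last /= eqxx; congr (g (_, _ + _)).
  by rewrite -(hj (z, r) 0) updS_last.
rewrite (integral_lebnS mgp)// (integral_lebnS mg)//.
rewrite -ge0_integralZl//; first last.
- by move=> z _; apply: integral_ge0.
- exact: (@measurable_fun_fubini_tonelli_G _ _ _ _ _ (slebn R k) g mg g0).
apply: eq_integral => r _.
rewrite -(IH ltjk (fun z => h (z, r)) (fun z => g (z, r)))//.
- by apply: eq_integral => z _; rewrite updS// /= (ltn_eqF ltjk).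
- by apply: (measurableT_comp mh); exact: measurable_pair2.
- by move=> z s; rewrite -(hj (z, r) s) updS.
- by apply: (measurableT_comp mg); exact: measurable_pair2.
Qed.

End change_of_variables.

(** * Reflections and definite matrices as changes of variables *)

Section linear_change_of_variables.
Context (R : realType).

(** The default 0 is never read, because [pt k] evaluates only indices below k. *)
Definition ptv k (v : 'cV[R]_k) : RnT R k :=
  pt k (fun i => oapp (fun j : 'I_k => v j 0) 0 (insub i)).

Lemma coordn_ptv k (v : 'cV[R]_k) (i : 'I_k) : coordn (ptv v) i = v i 0.
Proof. by rewrite /ptv coordn_pt ?ltn_ord// (valK i). Qed.

Lemma ptvK k : cancel (@ptv k) (@vecn R k).
Proof. by move=> v; apply/colP => i; rewrite mxE coordn_ptv. Qed.

Lemma vecnK k : cancel (@vecn R k) (@ptv k).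
Proof.
move=> z; rewrite -[RHS]pt_coordn /ptv; apply: eq_pt => i ik.
by rewrite insubT /= mxE.
Qed.

Lemma measurable_ptv d (T : measurableType d) k (v : T -> 'cV[R]_k) :
  (forall i, measurable_fun setT (fun x => v x i 0)) ->
  measurable_fun setT (fun x => ptv (v x)).
Proof.
move=> H; apply: measurable_pt => i ik.
by rewrite insubT /=; exact: H.
Qed.

Lemma measurable_mulmx d (T : measurableType d) k m (B : 'M[R]_(m, k)) (v : T -> 'cV[R]_k) :
  (forall i, measurable_fun setT (fun x => v x i 0)) ->
  forall i, measurable_fun setT (fun x => (B *m v x) i 0).
Proof.
move=> H i; under eq_fun do rewrite mxE.
apply: measurable_sum => j; apply: measurable_funM => //.
Qed.

Lemma measurable_vecn k i : measurable_fun setT (fun z : RnT R k => vecn z i 0).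
Proof.
have -> : (fun z : RnT R k => vecn z i 0) = (fun z => coordn z i).
  by apply/funext => z; rewrite mxE.
exact: measurable_coordn.
Qed.

(** Each coordinate undergoes r -> a_j - r, of slope -1, hence of factor 1; [Tr j] has reflected the
    first j coordinates. *)
Lemma ge0_integral_reflect k (d : 'cV[R]_k) (g : RnT R k -> \bar R) :
  measurable_fun setT g -> (forall z, 0 <= g z)%E ->
  (\int[lebn R k]_z g (ptv (d - vecn z)) = \int[lebn R k]_z g z)%E.
Proof.
move=> mg g0.
pose a i := oapp (fun j : 'I_k => d j 0) 0 (insub i : option 'I_k).
pose Tr j (z : RnT R k) := pt k (fun i => if (i < j)%N then a i - coordn z i else coordn z i).
have H j : (j <= k)%N -> forall g' : RnT R k -> \bar R,
    measurable_fun setT g' -> (forall z, 0 <= g' z)%E ->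
    (\int[lebn R k]_z g' (Tr j z) = \int[lebn R k]_z g' z)%E.
  elim: j => [_ g' _ _|j IH jk g' mg' g'0].
    by apply: eq_integral => z _; rewrite /Tr pt_coordn.
  have m1 : measurable_fun setT
     (fun z : RnT R k => upd z j (-1 * coordn z j + a j)).
    apply: measurable_upd => //; apply: measurable_funD => //.
    by apply: measurable_funM => //; exact: measurable_coordn.
  transitivity (\int[lebn R k]_z (g' (upd z j (-1 * coordn z j + a j)%R)))%E; last first.
    rewrite (@ge0_integral_upd R k j (-1) (fun=> a j) g')//.
    by rewrite normrN1 invr1 mul1e.
  rewrite -(IH (ltnW jk) (fun z => g' (upd z j (-1 * coordn z j + a j))))//.
    apply: eq_integral => z _; congr g'; apply: eq_pt => i ik.
    rewrite ltnS leq_eqVlt /Tr !coordn_pt//.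
    by case: (eqVneq i j) => [->|] //=; rewrite ltnn addrC mulN1r.
  exact: measurableT_comp mg' m1.
rewrite -(H k (leqnn k) g)//.
apply: eq_integral => z _; congr g; apply: eq_pt => i ik.
by rewrite /a insubT /= ik !mxE.
Qed.

(** The cofactors along row [j] do not see that row, so they are those of the identity, which are
    read off from the adjugate of [1%:M]. *)
Lemma det_except_row k (E : 'M[R]_k) (j : 'I_k) :
  (forall i c, i != j -> E i c = (i == c)%:R) -> \det E = E j j.
Proof.
move=> HE; rewrite (expand_det_row E j) (bigD1 j)//= big1 ?addr0.
  suff -> : cofactor E j j = 1 by rewrite mulr1.
  have : (1%:M *m \adj (1%:M : 'M[R]_k)) j j = 1 by rewrite mul_mx_adj det1 mxE eqxx.
  rewrite mul1mx mxE => <-; rewrite /cofactor; congr (_ * \det _).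
  by apply/matrixP => r c; rewrite !mxE HE// eq_sym neq_lift.
move=> c cj; suff -> : cofactor E j c = 0 by rewrite mulr0.
have : (1%:M *m \adj (1%:M : 'M[R]_k)) c j = 0.
  by rewrite mul_mx_adj det1 mxE (negbTE cj).
rewrite mul1mx mxE => <-; rewrite /cofactor; congr (_ * \det _).
by apply/matrixP => r c'; rewrite !mxE HE// eq_sym neq_lift.
Qed.

Lemma unitmx_inj_col k (M : 'M[R]_k) :
  (forall v : 'cV[R]_k, M *m v = 0 -> v = 0) -> M \in unitmx.
Proof.
move=> H; rewrite -unitmx_tr -row_free_unit -kermx_eq0; apply/rowV0P => v /sub_kermxP vM.
by apply: trmx_inj; rewrite trmx0; apply: H; apply: trmx_inj; rewrite trmx_mul trmxK trmx0.
Qed.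

(* The coordinates are replaced one at a time, through the matrices whose first j
   rows are those of B and the others those of the identity; they are invertible
   because B is definite. *)
Definition hybrid k (B : 'M[R]_k) j : 'M[R]_k :=
  \matrix_(r, c) if (r < j)%N then B r c else (r == c)%:R.

Lemma hybrid0 k (B : 'M[R]_k) : hybrid B 0 = 1%:M.
Proof. by apply/matrixP => r c; rewrite !mxE. Qed.

Lemma hybrid_full k (B : 'M[R]_k) : hybrid B k = B.
Proof. by apply/matrixP => r c; rewrite mxE ltn_ord. Qed.

Section definite.
Context (k : nat) (B : 'M[R]_k).
Hypothesis Bpos : forall v : 'cV[R]_k, v != 0 -> 0 < (v^T *m B *m v) 0 0.

(** If the hybrid kills v, then v_i = 0 for i >= j and (B v)_i = 0 for i < j, so every term of v^T B
    v = sum v_i (B v)_i vanishes and definiteness forces v = 0. *)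
Lemma hybrid_unitmx j : hybrid B j \in unitmx.
Proof.
apply: unitmx_inj_col => v Mv.
apply/eqP/negPn/negP => v0; have := Bpos v0.
rewrite -mulmxA mxE big1 ?ltxx// => i _.
have /colP/(_ i) := Mv; rewrite !mxE.
have [ij|ij] := ltnP i j.
  move=> H; suff -> : \sum_j0 B i j0 * v j0 0 = 0 by rewrite mulr0.
  by rewrite -[RHS]H; apply: eq_bigr => c _; rewrite mxE ij.
rewrite (bigD1 i)//= big1 ?addr0.
  by rewrite mxE ltnNge ij /= eqxx mul1r => ->; rewrite mul0r.
by move=> c ci; rewrite mxE ltnNge ij /= eq_sym (negbTE ci) mul0r.
Qed.

(** The passage from one hybrid to the next. The two agree off row [jo], so this matrix is the
    identity there and acts as a change of the single coordinate [jo]. *)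
Let E (jo : 'I_k) := hybrid B jo.+1 *m invmx (hybrid B jo).

Let EM jo : E jo *m hybrid B jo = hybrid B jo.+1.
Proof. by rewrite /E mulmxKV// hybrid_unitmx. Qed.

Let HE (jo i c : 'I_k) : i != jo -> E jo i c = (i == c)%:R.
Proof.
move=> ij; have -> : E jo i c = (hybrid B jo *m invmx (hybrid B jo)) i c.
  rewrite !mxE; apply: eq_bigr => s _; congr (_ * _); rewrite !mxE ltnS leq_eqVlt.
  by have -> : (i == jo :> nat) = false by apply: contraNF ij => /eqP ij; apply/eqP/val_inj.
by rewrite mulmxV ?hybrid_unitmx// mxE.
Qed.

Let detE (jo : 'I_k) : \det (hybrid B jo.+1) = E jo jo jo * \det (hybrid B jo).
Proof. by rewrite -EM det_mulmx (det_except_row (@HE jo)). Qed.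

(** Let v solve [hybrid B jo *m v = delta_mx jo 0]. Then v is 1 at jo and 0 beyond, while B v
    vanishes before jo, so v^T B v collapses to (B v)_jo, which is the diagonal entry in
    question. *)
Let E_gt0 (jo : 'I_k) : 0 < E jo jo jo.
Proof.
have [v Mv] : exists v : 'cV[R]_k, hybrid B jo *m v = delta_mx jo 0.
  by exists (invmx (hybrid B jo) *m delta_mx jo 0); rewrite mulKVmx// hybrid_unitmx.
have v0 : v != 0.
  apply/eqP => v0; move: Mv; rewrite v0 mulmx0 => /colP/(_ jo).
  by rewrite !mxE !eqxx => /eqP; rewrite eq_sym oner_eq0.
have Mvi i : \sum_c hybrid B jo i c * v c 0 = (i == jo)%:R.
  by have /colP/(_ i) := Mv; rewrite !mxE eqxx andbT.
have vge (i : 'I_k) : (jo <= i)%N -> v i 0 = (i == jo)%:R.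
  move=> ij; rewrite -(Mvi i) (bigD1 i)//= big1 ?addr0.
    by rewrite mxE ltnNge ij /= eqxx mul1r.
  by move=> c ci; rewrite mxE ltnNge ij /= eq_sym (negbTE ci) mul0r.
have -> : E jo jo jo = (B *m v) jo 0.
  have -> : E jo jo jo = (E jo *m (hybrid B jo *m v)) jo 0.
    by rewrite Mv -colE [RHS]mxE.
  by rewrite mulmxA EM !mxE; apply: eq_bigr => c _; rewrite mxE ltnSn.
have := Bpos v0; rewrite -mulmxA mxE (bigD1 jo)//= big1 ?addr0.
  by rewrite mxE vge// eqxx mul1r.
move=> i ij; have [ltij|leij] := ltnP i jo; last by rewrite mxE vge// (negbTE ij) mul0r.
suff -> : (B *m v) i 0 = 0 by rewrite mulr0.
have H : \sum_c hybrid B jo i c * v c 0 = 0 by rewrite Mvi (negbTE ij).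
by rewrite mxE -[RHS]H; apply: eq_bigr => c _; rewrite mxE ltij.
Qed.

Lemma det_hybrid_gt0 j : (j <= k)%N -> 0 < \det (hybrid B j).
Proof.
elim: j => [|j IH] jk; first by rewrite hybrid0 det1.
by have := detE (Ordinal jk); rewrite /= => ->; rewrite mulr_gt0// IH// ltnW.
Qed.

Lemma posdef_unitmx : B \in unitmx.
Proof. by rewrite -(hybrid_full B) hybrid_unitmx. Qed.

Lemma posdef_det_gt0 : 0 < \det B.
Proof. by rewrite -[X in \det X](hybrid_full B) det_hybrid_gt0. Qed.

Lemma ge0_integral_mulmx (g : RnT R k -> \bar R) :
  measurable_fun setT g -> (forall z, 0 <= g z)%E ->
  (\int[lebn R k]_z g (ptv (B *m vecn z)) =
   ((\det B)^-1)%:E * \int[lebn R k]_z g z)%E.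
Proof.
suff H j : (j <= k)%N -> forall g' : RnT R k -> \bar R,
    measurable_fun setT g' -> (forall z, 0 <= g' z)%E ->
    (\int[lebn R k]_z g' (ptv (hybrid B j *m vecn z)) =
     ((\det (hybrid B j))^-1)%:E * \int[lebn R k]_z g' z)%E.
  by move=> mg g0; rewrite -[in LHS](hybrid_full B) -[in RHS](hybrid_full B); exact: H.
elim: j => [_ g' _ _|j IH jk g' mg' g'0].
  rewrite hybrid0 det1 invr1 mul1e.
  by apply: eq_integral => z _; rewrite mul1mx vecnK.
pose jo := Ordinal jk.
(* The off-diagonal part of row [jo]; the factor [(c != jo)%:R] makes its independence of coordinate
   [jo] visible. *)
pose h (z : RnT R k) := \sum_c (E jo jo c * (c != jo)%:R) * vecn z c 0.
have mh : measurable_fun setT h.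
  apply: measurable_sum => c.
  by apply: measurable_funM => //; exact: measurable_vecn.
have hj z r : h (upd z j r) = h z.
  apply: eq_bigr => c _; case: (eqVneq c jo) => [|cj]; first by rewrite mulr0 !mul0r.
  rewrite !mxE coordn_upd//; have -> // : (c == j :> nat) = false.
  by apply: contraNF cj => /eqP cj; apply/eqP/val_inj.
have m1 : measurable_fun setT
     (fun z : RnT R k => upd z j (E jo jo jo * coordn z j + h z)).
  apply: measurable_upd => //; apply: measurable_funD => //.
  by apply: measurable_funM => //; exact: measurable_coordn.
transitivity ((\det (hybrid B j))^-1%:E *
   \int[lebn R k]_z (g' (upd z j (E jo jo jo * coordn z j + h z)%R)))%E; last first.
  rewrite (@ge0_integral_upd R k j (E jo jo jo) h g')//; last by rewrite gt_eqF// E_gt0.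
  rewrite muleA; congr (_ * _)%E; rewrite -EFinM (gtr0_norm (E_gt0 jo)).
  by rewrite [in RHS](detE jo) invfM mulrC.
rewrite -(IH (ltnW jk) (fun z => g' (upd z j (E jo jo jo * coordn z j + h z))))//; last first.
  exact: measurableT_comp mg' m1.
apply: eq_integral => z _; congr g'; rewrite -(EM jo) -mulmxA.
set u := hybrid B j *m vecn z; apply: eq_pt => i ik.
rewrite insubT /= -[Sub i ik]/(Ordinal ik); case: (eqVneq i j) => [ij|ij].
  have -> : Ordinal ik = jo by apply: val_inj.
  rewrite mxE (bigD1 jo)//= (coordn_ptv u jo); congr (_ + _).
  rewrite /h [RHS](bigD1 jo)//= eqxx mulr0 mul0r add0r.
  by apply: eq_bigr => c ->; rewrite mulr1 ptvK.
rewrite mxE (bigD1 (Ordinal ik))//= big1 ?addr0.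
  by rewrite HE ?eqxx ?mul1r ?(coordn_ptv u (Ordinal ik)).
move=> c ci; rewrite HE; last by apply: contraNneq ij => /(congr1 val) /= ->.
by rewrite eq_sym (negbTE ci) mul0r.
Qed.

End definite.

End linear_change_of_variables.

(** * Gaussian integrals and rotation invariance *)

Section gaussian.
Context (R : realType).
Local Notation mu := (@lebesgue_measure R).

Lemma integral_expR_sq (k b : R) : 0 < k ->
  (\int[mu]_x (expR (- (k * (x - b) ^+ 2)))%:E = (Num.sqrt (pi / k))%:E)%E.
Proof.
move=> k0.
have sk : Num.sqrt k != 0 by rewrite gt_eqF// sqrtr_gt0.
have := @ge0_integral_affine R (Num.sqrt k) (- (Num.sqrt k * b)) (EFin \o gauss_fun) sk.
have -> : (fun x => (EFin \o gauss_fun) (Num.sqrt k * x - Num.sqrt k * b)) =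
   fun x => (expR (- (k * (x - b) ^+ 2)))%:E.
  by apply/funext => x /=; rewrite /gauss_fun -mulrBr exprMn sqr_sqrtr// ltW.
move=> -> //.
- rewrite integralT_gauss -EFinM; congr EFin.
  by rewrite ger0_norm ?sqrtr_ge0// sqrtrM ?pi_ge0// sqrtrV 1?ltW// mulrC.
- by apply/measurable_EFinP; exact: measurable_gauss_fun.
- by move=> x; rewrite lee_fin gauss_fun_ge0.
Qed.

Lemma ge0_integralZl_real d (T : measurableType d) (nu : {measure set T -> \bar R})
    (D : set T) (f : T -> R) (k : R) :
  measurable D -> measurable_fun D f -> (forall x, 0 <= f x) -> 0 <= k ->
  (\int[nu]_(x in D) (k * f x)%:E = k%:E * \int[nu]_(x in D) (f x)%:E)%E.
Proof.
move=> mD mf f0 k0; under eq_integral do rewrite EFinM.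
apply: ge0_integralZl_EFin => //; last exact/measurable_EFinP.
by move=> x _; rewrite lee_fin.
Qed.

Lemma measurable_expR_sq (k : R) : measurable_fun [set: R] (fun x : R => expR (- (k * x ^+ 2))).
Proof.
apply: measurableT_comp => //; apply: measurableT_comp => //; apply: measurable_funM => //.
Qed.

(** Rotation invariance of the plane Gaussian, without a planar Jacobian: for fixed r put s = (rho u
    - be r) / al with rho^2 = al^2 + be^2, complete the square in r, exchange the integrals, and
    integrate out the Gaussian in r centred at be u / rho. The substitution divides by al, so al = 0
    is separate. *)
Lemma integral_gauss2 (k al be : R) (phi : R -> R) : 0 < k ->
  measurable_fun [set: R] phi -> (forall x, 0 <= phi x) ->
  (\int[mu]_r \int[mu]_s (phi (al * s + be * r) * expR (- (k * s ^+ 2)) * expR (- (k * r ^+ 2)))%:E =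
   (Num.sqrt (pi / k))%:E * \int[mu]_u (phi (Num.sqrt (al ^+ 2 + be ^+ 2) * u) * expR (- (k * u ^+ 2)))%:E)%E.
Proof.
move=> k0 mphi phi0.
have mlin (c : R) : measurable_fun [set: R] (fun x : R => phi (c * x)).
  by apply: (measurableT_comp mphi); exact: measurable_funM.
have mg c : measurable_fun [set: R] (fun x : R => phi (c * x) * expR (- (k * x ^+ 2))).
  by apply: measurable_funM => //; exact: measurable_expR_sq.
have g0 c x : (0 <= phi (c * x) * expR (- (k * x ^+ 2))) by rewrite mulr_ge0 ?expR_ge0.
have [->|al0] := eqVneq al 0.
  under eq_integral.
    move=> r _.
    under eq_integral do rewrite mul0r add0r mulrAC.
    rewrite ge0_integralZl_real; [|by []|exact: measurable_expR_sq|by move=> x; exact: expR_ge0|exact: g0].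
    under eq_integral do rewrite -[X in k * X ^+ 2]subr0.
    rewrite integral_expR_sq// -EFinM mulrC.
    over.
  rewrite ge0_integralZl_real; [|by []|exact: mg|exact: g0|exact: sqrtr_ge0].
  congr (_ * _)%E; rewrite expr0n /= add0r sqrtr_sqr.
  (* Here rho is |be|; a negative be is absorbed by the reflection u -> -u. *)
  have [b0|b0] := ger0P be; first by [].
  have N1 : -1 != 0 :> R by rewrite oppr_eq0 oner_eq0.
  have := @ge0_integral_affine R (-1) 0 (fun x => (phi (be * x) * expR (- (k * x ^+ 2)))%:E) N1
    (measurableT_comp (@EFin_measurable R _) (mg be)) (fun x => g0 be x).
  rewrite normrN1 invr1 mul1e => <-.
  by apply: eq_integral => x _; rewrite addr0 mulN1r sqrrN mulrN mulNr.
set rho := Num.sqrt (al ^+ 2 + be ^+ 2).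
have rho2 : rho ^+ 2 = al ^+ 2 + be ^+ 2 by rewrite sqr_sqrtr // addr_ge0 // sqr_ge0.
have rho_gt0 : 0 < rho by rewrite sqrtr_gt0 ltr_pwDl ?sqr_ge0// exprn_even_gt0.
have ra0 : rho / al != 0 by rewrite mulf_neq0 ?invr_eq0// gt_eqF.
pose F u r : R := phi (rho * u) * expR (- (k * u ^+ 2)) *
   expR (- (k * (rho / al) ^+ 2 * (r - be * u / rho) ^+ 2)).
have F0 u r : 0 <= F u r by rewrite /F mulr_ge0 ?expR_ge0.
have F0' (z : R * R) : (0 <= (F z.2 z.1)%:E)%E by rewrite lee_fin.
have mF : measurable_fun [set: R * R] (fun z : R * R => (F z.2 z.1)%:E).
  apply/measurable_EFinP; apply: measurable_funM.
    exact: (measurableT_comp (mg rho) measurable_snd).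
  apply: measurableT_comp => //; apply: measurableT_comp => //; apply: measurable_funM => //.
  apply: measurable_funX; apply: measurable_funB => //.
  apply: measurable_funM => //; apply: measurable_funM => //.
transitivity (`|rho / al|%:E * \int[mu]_r \int[mu]_u (F u r)%:E)%E.
  rewrite -ge0_integralZl//; last 2 first.
  - exact: (@measurable_fun_fubini_tonelli_F _ _ _ _ _ mu _ mF F0').
  - by move=> r _; apply: integral_ge0 => u _; rewrite lee_fin.
  apply: eq_integral => r _.
  have := @ge0_integral_affine R (rho / al) (- (be * r / al))
    (fun s => (phi (al * s + be * r) * expR (- (k * s ^+ 2)) * expR (- (k * r ^+ 2)))%:E) ra0.
  set I1 := (X in (_ -> _ -> X = _)%E); set I2 := (X in (_ -> _ -> _ = _ * X)%E).
  have -> : I1 = (\int[mu]_u (F u r)%:E)%E.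
    apply: eq_integral => u _; congr EFin; rewrite /F -!mulrA -!expRD.
    have r0 : rho != 0 by rewrite gt_eqF.
    congr (phi _ * expR _); first by field.
    apply/eqP; rewrite -subr_eq0; apply/eqP.
    (* The two exponents agree only modulo the relation defining rho, so their difference is
       exhibited as a multiple of rho^2 - (al^2 + be^2). *)
    transitivity (k * (r ^+ 2 - u ^+ 2) * (rho ^+ 2 - (al ^+ 2 + be ^+ 2)) / al ^+ 2).
      by field; rewrite al0 r0.
    by rewrite rho2 subrr mulr0 mul0r.
  move=> ->; last 2 first.
  - apply/measurable_EFinP; apply: measurable_funM => //; apply: measurable_funM.
      by apply: (measurableT_comp mphi); apply: measurable_funD => //; exact: measurable_funM.
    exact: measurable_expR_sq.
  - by move=> s; rewrite lee_fin !mulr_ge0 ?expR_ge0.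
  by rewrite muleA -EFinM divff ?mul1e// normr_eq0.
have kk0 : 0 < k * (rho / al) ^+ 2 by rewrite mulr_gt0// exprn_even_gt0.
rewrite (@fubini_tonelli _ _ _ _ _ mu mu _ mF F0').
under eq_integral.
  move=> u _.
  under eq_integral do rewrite /= /F.
  rewrite ge0_integralZl_real; [|by []| |by move=> x; exact: expR_ge0|exact: g0]; last first.
    apply: measurableT_comp => //; apply: measurableT_comp => //.
    by apply: measurable_funM => //; apply: measurable_funX; exact: measurable_funB.
  rewrite (integral_expR_sq _ kk0) -EFinM mulrC.
  over.
rewrite ge0_integralZl_real; [|by []|exact: mg|exact: g0|exact: sqrtr_ge0].
rewrite muleA -EFinM; congr (_%:E * _)%E.
rewrite invfM mulrA sqrtrM ?mulr_ge0 ?pi_ge0 ?invr_ge0 1?ltW//.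
by rewrite sqrtrV ?sqr_ge0// sqrtr_sqr mulrC mulfVK// normr_eq0.
Qed.

(** The factor sqrt(pi/k) on the left stands for the exponent n - 1 on the right, so that the
    induction can start at n = 0. The step applies the hypothesis to the translate phi(. + a_n r),
    which leaves a plane integral of phi(rho s + a_n r) for [integral_gauss2]. *)
Lemma integral_lebn_gauss n (k : R) (a : nat -> R) (phi : R -> R) : 0 < k ->
  measurable_fun [set: R] phi -> (forall x, 0 <= phi x) ->
  ((Num.sqrt (pi / k))%:E * \int[lebn R n]_z
     (phi (\sum_(i < n) a i * coordn z i) * expR (- (k * \sum_(i < n) coordn z i ^+ 2)))%:E =
   (Num.sqrt (pi / k) ^+ n)%:E * \int[mu]_u
     (phi (Num.sqrt (\sum_(i < n) a i ^+ 2) * u) * expR (- (k * u ^+ 2)))%:E)%E.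
Proof.
move=> k0; elim: n phi => [|n IH] phi mphi phi0.
  rewrite /= integral_dirac// diracT mul1e expr0 mul1e !big_ord0 mulr0 oppr0 expR0 mulr1.
  under eq_integral do rewrite sqrtr0 mul0r.
  rewrite ge0_integralZl_real; [|by []|exact: measurable_expR_sq|by move=> x; exact: expR_ge0|exact: phi0].
  under eq_integral do rewrite -[X in k * X ^+ 2]subr0.
  by rewrite integral_expR_sq// muleC.
have msum m : measurable_fun setT (fun z : RnT R m => \sum_(i < m) a i * coordn z i).
  by apply: measurable_sum => i; apply: measurable_funM => //; exact: measurable_coordn.
have msq m : measurable_fun setT (fun z : RnT R m => \sum_(i < m) coordn z i ^+ 2).
  by apply: measurable_sum => i; apply: measurable_funX; exact: measurable_coordn.
have mG m (ph : R -> R) : measurable_fun [set: R] ph -> measurable_fun setT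
    (fun z : RnT R m => (ph (\sum_(i < m) a i * coordn z i) * expR (- (k * \sum_(i < m) coordn z i ^+ 2)))%:E).
  move=> mph; apply/measurable_EFinP; apply: measurable_funM.
    exact: measurableT_comp mph (msum m).
  apply: measurableT_comp => //; apply: measurableT_comp => //.
  exact: measurable_funM.
rewrite (integral_lebnS (mG _ _ mphi)); last by move=> z; rewrite lee_fin mulr_ge0 ?expR_ge0.
set c := Num.sqrt (pi / k).
have c0 : 0 <= c by rewrite sqrtr_ge0.
rewrite -ge0_integralZl//; last 2 first.
- apply: (@measurable_fun_fubini_tonelli_G _ _ _ _ _ (slebn R n) _ (mG n.+1 _ mphi)).
  by move=> z; rewrite lee_fin mulr_ge0 ?expR_ge0.
- by move=> r _; apply: integral_ge0 => z _; rewrite lee_fin mulr_ge0 ?expR_ge0.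
set rho := Num.sqrt (\sum_(i < n) a i ^+ 2).
pose H r s := (phi (rho * s + a n * r) * expR (- (k * s ^+ 2)) * expR (- (k * r ^+ 2))).
have H0 r s : 0 <= H r s by rewrite /H !mulr_ge0 ?expR_ge0.
have H0' (z : R * R) : (0 <= (H z.1 z.2)%:E)%E by rewrite lee_fin.
have mH : measurable_fun [set: R * R] (fun z : R * R => (H z.1 z.2)%:E).
  apply/measurable_EFinP; apply: measurable_funM; last first.
    exact: (measurableT_comp (measurable_expR_sq k) measurable_fst).
  apply: measurable_funM; last first.
    exact: (measurableT_comp (measurable_expR_sq k) measurable_snd).
  apply: (measurableT_comp mphi); apply: measurable_funD; exact: measurable_funM.
transitivity (\int[mu]_r ((c ^+ n)%:E * \int[mu]_s (H r s)%:E))%E.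
  apply: eq_integral => r _.
  have mphir : measurable_fun [set: R] (fun x => phi (x + a n * r)).
    by apply: (measurableT_comp mphi); exact: measurable_funD.
  have -> : (\int[mu]_s (H r s)%:E = (expR (- (k * r ^+ 2)))%:E *
      \int[mu]_s (phi (rho * s + a n * r) * expR (- (k * s ^+ 2)))%:E)%E.
    rewrite -ge0_integralZl_real; [|by []| |by move=> x; rewrite mulr_ge0 ?expR_ge0|exact: expR_ge0]; last first.
      apply: measurable_funM; last exact: measurable_expR_sq.
      by apply: (measurableT_comp mphir); exact: measurable_funM.
    by apply: eq_integral => s _; rewrite mulrC.
  rewrite muleCA -(IH (fun x => phi (x + a n * r)))// muleCA; congr (_ * _)%E.
  rewrite -ge0_integralZl ?lee_fin ?expR_ge0//; last 2 first.
  - exact: (mG n (fun x => phi (x + a n * r)) mphir).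
  - by move=> z _; rewrite lee_fin mulr_ge0 ?expR_ge0.
  apply: eq_integral => z _; rewrite -EFinM; congr EFin.
  have Es (g : nat -> R -> R) : \sum_(i < n.+1) g i (coordn ((z, r) : RnT R n.+1) i) = \sum_(i < n) g i (coordn z i) + g n r.
    rewrite big_ord_recr /= eqxx; congr (_ + _).
    by apply: eq_bigr => i _; rewrite ltn_eqF.
  rewrite (Es (fun i x => a i * x)) (Es (fun i x => x ^+ 2)).
  by rewrite mulrDr opprD expRD; ring.
rewrite ge0_integralZl//; last 3 first.
- exact: (@measurable_fun_fubini_tonelli_F _ _ _ _ _ mu _ mH H0').
- by move=> r _; apply: integral_ge0 => u _; rewrite lee_fin.
- by rewrite lee_fin exprn_ge0.
rewrite integral_gauss2// muleA -EFinM -exprSr; congr (_ * _)%E.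
apply: eq_integral => u _; rewrite sqr_sqrtr ?sumr_ge0//.
  by rewrite big_ord_recr.
by move=> i _; exact: sqr_ge0.
Qed.

End gaussian.

(** * Gamma integrals and powers near zero *)

Section power_integrals.
Context (R : realType).
Local Notation mu := (@lebesgue_measure R).

Lemma powRD_gt0 (x r s : R) : 0 < x -> x `^ (r + s) = x `^ r * x `^ s.
Proof. by move=> x0; rewrite powRD// (gt_eqF x0) implybT. Qed.

Lemma continuous_powR_norm (a : R) : 0 <= a -> continuous (fun x : R => `|x| `^ a).
Proof.
rewrite le_eqVlt => /predU1P[<- x|a0 x].
  have -> : (fun x : R => `|x| `^ 0) = cst 1 by apply/funext => y; rewrite powRr0.
  exact: cvg_cst.
have [->|x0] := eqVneq x 0; last first.
  have nx : 0 < `|x| by rewrite normr_gt0.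
  apply: (@continuous_comp _ _ _ (fun x : R => `|x|) (fun y => y `^ a)).
    exact: norm_continuous.
  apply: differentiable_continuous; apply/derivable1_diffP.
  by apply: derivable_powR; rewrite in_itv /= nx.
apply/cvgrPdist_lt => e e0; near=> y.
rewrite normr0 powR0 ?gt_eqF// sub0r normrN ger0_norm ?powR_ge0//.
have -> : e = (e `^ a^-1) `^ a by rewrite -powRrM mulVf ?gt_eqF// powRr1// ltW.
rewrite gt0_ltr_powR// ?nnegrE ?powR_ge0//.
near: y; apply/nbhs_ballP; exists (e `^ a^-1) => /=; first exact: powR_gt0.
by move=> y; rewrite /ball /= sub0r normrN.
Unshelve. all: by end_near. Qed.

Lemma bigcup_itv0n (u : nat -> R) : (forall n, n%:R <= u n) ->
  \bigcup_n `[0, u n] = [set x : R | 0 <= x].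
Proof.
move=> nu; apply/seteqP; split => [x [n _] /=|x /= x0].
  by rewrite in_itv /= => /andP[].
exists (Num.truncn x).+1 => //=; rewrite in_itv /= x0 /=.
by rewrite (le_trans _ (nu _))// ltW// truncnS_gt.
Qed.

(** The substitution y = s^2 is made on [0, n], whose image is [0, n * n], and both sides pass to
    the limit by monotone convergence. The absolute values keep the powers continuous on the whole
    line. *)
Lemma integral_sqr_substitution (a : R) : 0 <= a ->
  (\int[mu]_(s in [set s : R | (0 <= s)%R]) (2 * (`|s| `^ (2 * a + 1) * expR (- s ^+ 2)))%:E
   = \int[mu]_(y in [set y : R | (0 <= y)%R]) (`|y| `^ a * expR (- y))%:E)%E.
Proof.
move=> a0.
pose G (y : R) := `|y| `^ a * expR (- y).
pose H (s : R) := 2 * (`|s| `^ (2 * a + 1) * expR (- s ^+ 2)).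
have cG : continuous G.
  move=> y; apply: cvgM; first exact: continuous_powR_norm.
  by apply: (@continuous_comp _ _ _ (@GRing.opp R) expR); [exact: opp_continuous|exact: continuous_expR].
have mG : measurable_fun [set: R] G by exact: continuous_measurable_fun.
have mH : measurable_fun [set: R] H.
  apply: measurable_funM => //; apply: measurable_funM.
    exact: (measurableT_comp (measurable_powR _) (@normr_measurable R setT)).
  by apply: measurableT_comp => //; apply: measurableT_comp.
have G0 y : 0 <= G y by rewrite mulr_ge0 ?expR_ge0 ?powR_ge0.
have H0 y : 0 <= H y by rewrite !mulr_ge0 ?expR_ge0 ?powR_ge0.
pose F (s : R) := s ^+ 2.
have F' : F^`() = (fun s => 2 * s).
  apply/funext => s; rewrite /F derive1E.
  have H2 : is_derive s 1 (fun s0 : R => s0 ^+ 2) (2 * s).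
    by apply: is_derive_eq; rewrite /GRing.scale /=; ring.
  by rewrite derive_val.
have cF : continuous F by move=> s; exact: exprn_continuous.
have cF' : continuous (F^`()).
  by rewrite F' => s; apply: cvgM; [exact: cvg_cst|exact: cvg_id].
have E n : (\int[mu]_(y in `[0%R, (n%:R * n%:R)%R]) (G y)%:E = \int[mu]_(s in `[0%R, n%:R]) (H s)%:E)%E.
  have -> : `[0, n%:R * n%:R] = `[F 0, F n%:R] by rewrite /F expr0n expr2.
  rewrite (@integration_by_substitution_increasing R F G 0 n%:R (ler0n _ _)) //.
  - apply: eq_integral => s; rewrite inE /= in_itv /= => /andP[s0 _]; congr EFin.
    rewrite F' /G /H /F /= !fctE /= ger0_norm ?sqr_ge0// ger0_norm//.
    rewrite -powR_mulrn// -powRrM.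
    have [->|sn0] := eqVneq s 0.
      by rewrite !mulr0 powR0 ?mul0r ?mulr0// gt_eqF// ltr_wpDl// mulr_ge0.
    rewrite (@powRD _ s (2 * a) 1) ?sn0 ?implybT// powRr1//; ring.
  - move=> x y; rewrite !in_itv /= => /andP[x0 _] /andP[y0 _] xy.
    by rewrite ltr_pXn2r// ?nnegrE.
  - by apply: cvgP; apply: cvg_at_right_filter; exact: cF'.
  - by apply: cvgP; apply: cvg_at_left_filter; exact: cF'.
  - split => //.
    + by apply: cvg_at_right_filter; exact: cF.
    + by apply: cvg_at_left_filter; exact: cF.
  - exact: continuous_subspaceT.
have ndI (u : nat -> R) : {homo u : m n / (m <= n)%N >-> m <= n} ->
    nondecreasing_seq (fun n => `[0, u n]%classic : set R).
  move=> hu m n mn; apply/subsetPset => x /=; rewrite !in_itv /= => /andP[-> xm] /=.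
  exact: le_trans xm (hu _ _ mn).
have cvgG : (\int[mu]_(y in `[0%R, (n%:R * n%:R)%R]) (G y)%:E)%E @[n --> \oo]
   --> (\int[mu]_(y in [set y : R | (0 <= y)%R]) (G y)%:E)%E.
  rewrite -(@bigcup_itv0n (fun n => n%:R * n%:R)); last first.
    by move=> n; rewrite -natrM ler_nat; case: n => // n; rewrite leq_pmulr.
  apply: (@ge0_nondecreasing_set_cvg_integral _ (measurableTypeR R) R (fun n => `[0 : R, n%:R * n%:R]%classic) (EFin \o G) mu) => //.
  - by apply: ndI => m n mn; rewrite -!natrM ler_nat leq_mul.
  - by move=> n; apply/measurable_EFinP; exact: measurable_funTS.
  - by move=> *; rewrite lee_fin.
have cvgH : (\int[mu]_(y in `[0%R, n%:R]) (H y)%:E)%E @[n --> \oo]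
   --> (\int[mu]_(y in [set y : R | (0 <= y)%R]) (H y)%:E)%E.
  rewrite -(@bigcup_itv0n (fun n => n%:R))//.
  apply: (@ge0_nondecreasing_set_cvg_integral _ (measurableTypeR R) R (fun n => `[0 : R, n%:R]%classic) (EFin \o H) mu) => //.
  - by apply: ndI => m n mn; rewrite ler_nat.
  - by move=> n; apply/measurable_EFinP; exact: measurable_funTS.
  - by move=> *; rewrite lee_fin.
move: cvgG; rewrite (_ : (fun n => _) = (fun n => (\int[mu]_(s in `[0%R, n%:R]) (H s)%:E)%E)).
  by move=> cvgG; apply: cvg_unique cvgH cvgG.
by apply/funext => n; exact: E.
Qed.

(** [Gamma] before its finite part is taken, so that identities can be proved ahead of
    finiteness. *)
Definition gammae (s : R) : \bar R :=
  (\int[mu]_(y in `]0%R, +oo[) (y `^ (s - 1) * expR (- y))%:E)%E.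

(** By evenness the case k = 1 is twice an integral over s >= 0, which y = s^2 turns into the Gamma
    integral with exponent (q-1)/2; scaling s by sqrt k supplies the power of k. *)
Lemma integral_norm_powR_gauss (q k : R) : 1 <= q -> 0 < k ->
  (\int[mu]_s (`|s| `^ q * expR (- (k * s ^+ 2)))%:E =
   (k `^ (- ((q + 1) / 2)))%:E * gammae ((q + 1) / 2))%E.
Proof.
move=> q1 k0.
have q0 : 0 <= q by rewrite (le_trans _ q1).
have a0 : 0 <= (q - 1) / 2 by rewrite divr_ge0// subr_ge0.
have sk : 0 < Num.sqrt k by rewrite sqrtr_gt0.
pose f (s : R) := `|s| `^ q * expR (- s ^+ 2).
have f0 s : 0 <= f s by rewrite mulr_ge0 ?powR_ge0 ?expR_ge0.
have cf : continuous f.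
  move=> y; apply: cvgM; first exact: continuous_powR_norm.
  apply: (@continuous_comp _ _ _ (fun s : R => - s ^+ 2) expR); last exact: continuous_expR.
  by apply: continuousN; exact: exprn_continuous.
have mf : measurable_fun [set: R] f by exact: continuous_measurable_fun.
have Ef : (\int[mu]_s (f s)%:E = gammae ((q + 1) / 2))%E.
  rewrite ge0_symfun_integralT//; last by move=> s; rewrite /f /= normrN sqrrN.
  rewrite -ge0_integralZl_real//; last 2 first.
  - rewrite [X in measurable X](_ : _ = `[0, +oo[%classic)//.
    by apply/seteqP; split=> x /=; rewrite in_itv /= andbT.
  - exact: measurable_funTS.
  have := integral_sqr_substitution a0.
  have -> : 2 * ((q - 1) / 2) + 1 = q by field.
  move=> ->; rewrite /gammae integral_itv_obnd_cbnd; last first.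
    apply/measurable_EFinP/measurable_funTS; apply: measurable_funM.
      exact: measurable_powR.
    by apply: measurableT_comp.
  have -> : [set y : R | 0 <= y] = `[0, +oo[%classic.
    by apply/seteqP; split=> x /=; rewrite in_itv /= andbT.
  apply: eq_integral => y; rewrite inE /= in_itv /= andbT => y0.
  by rewrite ger0_norm//; congr (_ `^ _ * _)%:E; field.
have := @ge0_integral_affine R (Num.sqrt k) 0 (EFin \o f) (lt0r_neq0 sk)
   (measurableT_comp (@EFin_measurable R _) mf) f0.
rewrite Ef.
have -> : (\int[mu]_x (EFin \o f) (Num.sqrt k * x + 0)%R = (k `^ (q / 2))%:E *
    \int[mu]_s (`|s| `^ q * expR (- (k * s ^+ 2)))%:E)%E.
  rewrite -ge0_integralZl_real; [|by []| | |exact: powR_ge0]; last 2 first.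
  - apply: measurable_funM; last exact: measurable_expR_sq.
    exact: (measurableT_comp (measurable_powR _) (@normr_measurable R setT)).
  - by move=> s; rewrite mulr_ge0 ?powR_ge0 ?expR_ge0.
  apply: eq_integral => s _ /=; congr EFin.
  rewrite /f addr0 normrM exprMn (sqr_sqrtr (ltW k0)) (powRM _ (normr_ge0 _) (normr_ge0 _)) mulrA; congr (_ * _ * _).
  by rewrite (ger0_norm (sqrtr_ge0 _)) -(powR12_sqrt (ltW k0)) -powRrM mulrC.
move=> H.
(* Both sides are multiplied by k^(-q/2), as one cannot simply cancel a factor in an identity of
   extended reals. *)
have := congr1 (fun x => (k `^ (- (q / 2)))%:E * x)%E H.
rewrite /= muleA -EFinM -(powRD_gt0 _ _ k0) addNr powRr0 mul1e => ->.
rewrite muleA -EFinM; congr (_%:E * _)%E.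
rewrite (ger0_norm (sqrtr_ge0 _)) -(powR12_sqrt (ltW k0)) -powRN -(powRD_gt0 _ _ k0).
by congr (_ `^ _); field.
Qed.

(** The value is the absolute Gaussian moment with k = 1, and for q <= 2 one has |s|^q <= 1 + s^2 <=
    2 exp(s^2/2), which leaves half of the Gaussian. *)
Lemma gammae_fin (q : R) : 1 <= q <= 2 -> (gammae ((q + 1) / 2) < +oo)%E.
Proof.
move=> /andP[q1 q2]; have := @integral_norm_powR_gauss q 1 q1 ltr01.
rewrite powR1 mul1e => <-.
have half : 0 < (2^-1 : R) by rewrite invr_gt0.
apply: (@le_lt_trans _ _ (\int[mu]_s (2 * expR (- (2^-1 * s ^+ 2)))%:E)%E).
  apply: ge0_le_integral => //.
  - apply/measurable_EFinP; apply: measurable_funM; last exact: measurable_expR_sq.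
    exact: (measurableT_comp (measurable_powR _) (@normr_measurable R setT)).
  - by apply/measurable_EFinP; apply: measurable_funM => //; exact: measurable_expR_sq.
  - move=> s _; rewrite lee_fin mul1r.
    have -> : expR (- (s ^+ 2)) = expR (- (2^-1 * s ^+ 2)) * expR (- (2^-1 * s ^+ 2)).
      by rewrite -expRD; congr expR; field.
    rewrite mulrA ler_pM2r ?expR_gt0// expRN ler_pdivrMr ?expR_gt0//.
    apply: (@le_trans _ _ (1 + s ^+ 2)).
      have [s1|s1] := leP `|s| 1.
        apply: (@le_trans _ _ (1 `^ q)); last by rewrite powR1 lerDl sqr_ge0.
        by apply: ge0_ler_powR => //; rewrite ?nnegrE// (le_trans _ q1).
      apply: (@le_trans _ _ (`|s| `^ 2)); first by apply: ler_powR => //; exact: ltW.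
      by rewrite powR_mulrn// real_normK ?num_real// lerDr.
    have := expR_ge1Dx (2^-1 * s ^+ 2); lra.
rewrite ge0_integralZl_real//; last exact: measurable_expR_sq.
under eq_integral do rewrite -[X in _ * X ^+ 2]subr0.
by rewrite integral_expR_sq// -EFinM ltry.
Qed.

Lemma integral_powRN_lty (be t : R) : be < 1 -> 0 < t ->
  (\int[mu]_(x in `]0%R, t[) (x `^ (- be))%:E < +oo)%E.
Proof.
move=> be1 t0.
have b0 : 0 < 1 - be by rewrite subr_gt0.
have mp : measurable_fun [set: R] (fun x : R => (x `^ (- be))%:E).
  by apply/measurable_EFinP; exact: measurable_powR.
(* With [n.+2] the left endpoint is strictly below t already at n = 0, as the fundamental theorem of
   calculus on [[a n, t]] requires. *)
pose a n : R := t / n.+2%:R.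
have a0 n : 0 < a n by rewrite divr_gt0.
have at_ n : a n < t by rewrite ltr_pdivrMr// ltr_pMr// ltr1n.
pose F (x : R) := (1 - be)^-1 * x `^ (1 - be).
have dF (x : R) : 0 < x -> is_derive x 1 F (x `^ (- be)).
  move=> x0; have xin : x \in `]0, +oo[%R by rewrite in_itv /= x0.
  have dp : is_derive x 1 (fun y => y `^ (1 - be)) ((1 - be) * x `^ (1 - be - 1)).
    apply: DeriveDef; first exact: derivable_powR.
    by rewrite -derive1E powR_derive1.
  have := is_deriveZ (1 - be)^-1 dp.
  rewrite /GRing.scale /= mulrA mulVf ?gt_eqF// mul1r.
  by have -> : 1 - be - 1 = - be by ring.
have cF (x : R) : 0 < x -> {for x, continuous F}.
  move=> x0; apply: differentiable_continuous; apply/derivable1_diffP.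
  by have [] := dF x x0.
have cp (x : R) : 0 < x -> {for x, continuous (fun x : R => x `^ (- be))}.
  move=> x0; apply: differentiable_continuous; apply/derivable1_diffP.
  by apply: derivable_powR; rewrite in_itv /= x0.
have E n : (\int[mu]_(x in `[a n, t]) (x `^ (- be))%:E = (F t)%:E - (F (a n))%:E)%E.
  apply: (@continuous_FTC2 R (fun x => x `^ (- be)) F (a n) t (at_ n)).
  - apply: continuous_in_subspaceT => x; rewrite inE /= in_itv /= => /andP[x0 _].
    by apply: cp; exact: lt_le_trans (a0 n) x0.
  - split.
    + move=> x; rewrite in_itv /= => /andP[x0 _].
      by have [] := dF x (lt_trans (a0 n) x0).
    + by apply: cvg_at_right_filter; exact: cF.
    + by apply: cvg_at_left_filter; exact: cF.
  - move=> x; rewrite in_itv /= => /andP[x0 _].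
    by rewrite derive1E; have [_ ->] := dF x (lt_trans (a0 n) x0).
have U : `]0, t]%classic = \bigcup_n `[a n, t]%classic.
  apply/seteqP; split => x /=; last first.
    by move=> [n _] /=; rewrite !in_itv /= => /andP[x0 ->]; rewrite (lt_le_trans (a0 n) x0).
  rewrite in_itv /= => /andP[x0 xt].
  exists (Num.truncn (t / x)) => //=; rewrite in_itv /= xt andbT /a.
  rewrite ler_pdivrMr// mulrC -ler_pdivrMr// ltW// (lt_le_trans (truncnS_gt _))//.
  by rewrite ler_nat.
rewrite (@le_lt_trans _ _ (\int[mu]_(x in `]0%R, t]) (x `^ (- be))%:E)%E)//.
  apply: ge0_subset_integral => //.
  - exact: measurable_funTS.
  - by move=> x _; rewrite lee_fin powR_ge0.
  - by move=> x /=; rewrite !in_itv /= => /andP[-> /ltW].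
rewrite U.
have cv : (\int[mu]_(x in `[a n, t]) (x `^ (- be))%:E)%E @[n --> \oo] -->
    (\int[mu]_(x in \bigcup_n `[a n, t]) (x `^ (- be))%:E)%E.
  apply: (@ge0_nondecreasing_set_cvg_integral _ (measurableTypeR R) R
    (fun n => `[a n, t]%classic) (fun x : R => (x `^ (- be))%:E) mu) => //.
  - move=> m n mn; apply/subsetPset => x /=; rewrite !in_itv /= => /andP[mx ->].
    by rewrite andbT (le_trans _ mx)// /a ler_pM2l// lef_pV2 ?posrE// ler_nat ltnS.
  - by move=> n; exact: measurable_funTS.
  - by move=> *; rewrite lee_fin powR_ge0.
(* The antiderivative is nonnegative, so F(t) bounds all the truncated integrals. *)
apply: (@le_lt_trans _ _ (F t)%:E); last by rewrite ltry.
rewrite -(cvg_lim _ cv)//; apply: lime_le; first by apply: cvgP cv.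
apply: nearW => n; rewrite E -EFinB lee_fin gerBl /F.
by apply: mulr_ge0; [rewrite invr_ge0 ltW|exact: powR_ge0].
Qed.

End power_integrals.

(** * The differentiated kernel and its spatial L^q norm *)

Section kernel.
Context (R : realType).
Local Notation mu := (@lebesgue_measure R).

Definition dotp n (u v : 'cV[R]_n) : R := \sum_(i < n) u i 0 * v i 0.

Lemma eucl_sq n (v : 'cV[R]_n) : eucl v ^+ 2 = \sum_(i < n) v i 0 ^+ 2.
Proof. by rewrite sqr_sqrtr// sumr_ge0// => i _; exact: sqr_ge0. Qed.

(** The derivative of [Gker] in x along [e], as [is_derive_Gker] shows. *)
Definition Kker n (S : 'M[R]_n) (b : 'cV[R]_n) (c : R) (e x : 'cV[R]_n) (t : R) : R :=
  - dotp (invmx S *m (x + t *: b)) (invmx S *m e) / (2 * t) * Gker S b c x t.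

(** The inverse equals f times the power -1 of f^2, and real powers are measurable; at a zero of f
    both expressions are 0. *)
Lemma measurable_funV d (T : measurableType d) (f : T -> R) :
  measurable_fun setT f -> measurable_fun setT (fun x => (f x)^-1).
Proof.
move=> mf; rewrite (_ : (fun x => _) = (fun x => f x * (f x ^+ 2) `^ (-1))).
  apply: measurable_funM => //.
  exact: (measurableT_comp (measurable_powR _) (measurable_funX 2 mf)).
apply/funext => x; rewrite powR_inv1 ?sqr_ge0//.
have [->|fx0] := eqVneq (f x) 0; first by rewrite invr0 mul0r.
by rewrite expr2 invfM mulrA divff// mul1r.
Qed.

Lemma measurable_sqrtr d (T : measurableType d) (f : T -> R) :
  measurable_fun setT f -> measurable_fun setT (fun x => Num.sqrt (f x)).
Proof.
move=> mf; apply: (measurableT_comp _ mf).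
by apply: continuous_measurable_fun; exact: sqrt_continuous.
Qed.

Section measurability.
Context d (T : measurableType d) (n : nat) (S : 'M[R]_n) (b e : 'cV[R]_n) (c : R).
Context (X : T -> 'cV[R]_n) (s : T -> R).
Hypothesis mX : forall i, measurable_fun setT (fun z => X z i 0).
Hypothesis ms : measurable_fun setT s.

Let mW i : measurable_fun setT (fun z => (invmx S *m (X z + s z *: b)) i 0).
Proof.
apply: measurable_mulmx => j.
rewrite (_ : (fun z => _) = (fun z => X z j 0 + s z * b j 0)).
  by apply: measurable_funD => //; exact: measurable_funM.
by apply/funext => z; rewrite !mxE.
Qed.

Lemma measurable_Gker : measurable_fun setT (fun z => Gker S b c (X z) (s z)).
Proof.
apply: measurable_funM.
  apply: measurable_funM.
    by apply: measurableT_comp => //; exact: measurable_funM.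
  apply: measurable_funV; apply: measurable_funM => //.
  apply: measurable_funX; apply: measurable_funM => //.
  by apply: measurable_sqrtr; exact: measurable_funM.
apply: measurableT_comp => //; apply: measurable_funM; last first.
  by apply: measurable_funV; exact: measurable_funM.
apply: measurableT_comp => //.
under eq_fun do rewrite eucl_sq.
by apply: measurable_sum => i; exact: measurable_funX.
Qed.

Lemma measurable_Kker : measurable_fun setT (fun z => Kker S b c e (X z) (s z)).
Proof.
apply: measurable_funM; last exact: measurable_Gker.
apply: measurable_funM; last by apply: measurable_funV; exact: measurable_funM.
apply: measurableT_comp => //; apply: measurable_sum => i.
by apply: measurable_funM.
Qed.

End measurability.

(** Every positive factor is written as an exponential of its logarithm, so that both sides become a
    single [expR] and only an identity between exponents, linear in the logarithms, remains. [D]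
    stands for det S. *)
Lemma kernel_constant (n : nat) (q c s D : R) : 0 < q -> 0 < s -> 0 < D ->
  D * (expR (c * s) / ((2 * Num.sqrt (pi * s)) ^+ n * D) / (2 * s)) `^ q *
    (Num.sqrt (pi / (q / (4 * s))) ^+ n / Num.sqrt (pi / (q / (4 * s)))) *
    (q / (4 * s)) `^ (- ((q + 1) / 2)) =
  (2 `^ (n%:R * (q - 1)) * pi `^ ((n%:R * (q - 1) + 1) / 2) * D `^ (q - 1))^-1
   * (q `^ ((n%:R + q) / 2))^-1 * (expR (q * c * s) / s `^ ((n%:R * (q - 1) + q) / 2)).
Proof.
move=> q0 s0 D0.
have [L2 E2] : exists L, 2 = expR L :> R by exists (ln 2); rewrite lnK// posrE.
have [Lp Ep] : exists L, pi = expR L :> R by exists (ln pi); rewrite lnK// posrE pi_gt0.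
have [Lq Eq] : exists L, q = expR L by exists (ln q); rewrite lnK// posrE.
have [Ls Es] : exists L, s = expR L by exists (ln s); rewrite lnK// posrE.
have [LD ED] : exists L, D = expR L by exists (ln D); rewrite lnK// posrE.
have E4 : 4 = expR (2 * L2) :> R by rewrite -[2]/(2%:R) expRM_natl -E2; ring.
have sq x : Num.sqrt (expR x) = expR (x / 2) by rewrite expRM powR12_sqrt ?expR_ge0.
have F1 : expR (c * s) / ((2 * Num.sqrt (pi * s)) ^+ n * D) / (2 * s) =
    expR (c * s - (n%:R * (L2 + (Lp + Ls) / 2) + LD) - (L2 + Ls)).
  have -> : Num.sqrt (pi * s) = expR ((Lp + Ls) / 2) by rewrite -sq expRD -Ep -Es.
  by rewrite !expRB !expRD expRM_natl expRD -E2 -ED -Es.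
have F2 : q / (4 * s) = expR (Lq - (2 * L2 + Ls)).
  by rewrite expRD expRN expRD -Eq -E4 -Es.
have F3 : Num.sqrt (pi / (q / (4 * s))) = expR ((Lp - (Lq - (2 * L2 + Ls))) / 2).
  by rewrite -sq expRD expRN -F2 -Ep.
rewrite F1 F3 F2 -[expR ((Lp - _) / 2) ^+ n]expRM_natl.
have -> : D `^ (q - 1) = expR (LD * (q - 1)) by rewrite expRM -ED.
have -> : s `^ ((n%:R * (q - 1) + q) / 2) = expR (Ls * ((n%:R * (q - 1) + q) / 2)) by rewrite expRM -Es.
have -> : q `^ ((n%:R + q) / 2) = expR (Lq * ((n%:R + q) / 2)) by rewrite expRM -Eq.
have -> : pi `^ ((n%:R * (q - 1) + 1) / 2) = expR (Lp * ((n%:R * (q - 1) + 1) / 2)) by rewrite expRM -Ep.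
have -> : 2 `^ (n%:R * (q - 1)) = expR (L2 * (n%:R * (q - 1))) by rewrite expRM -E2.
rewrite [in LHS]ED -!expRM -!expRN -!expRD -!expRN -!expRD.
by congr expR; field.
Qed.

Context (n : nat) (S : 'M[R]_n) (b : 'cV[R]_n) (c : R).
Hypothesis Spos : forall v : 'cV[R]_n, v != 0 -> 0 < (v^T *m S *m v) 0 0.

(** With v = S u the form becomes (S u)^T u, the transpose of the 1 x 1 matrix u^T S u. *)
Lemma invmx_pos (v : 'cV[R]_n) : v != 0 -> 0 < (v^T *m invmx S *m v) 0 0.
Proof.
move=> v0; have US := posdef_unitmx Spos.
have [u uE vE] : exists2 u, u = invmx S *m v & v = S *m u.
  by exists (invmx S *m v) => //; rewrite mulKVmx.
have u0 : u != 0 by apply: contraNneq v0 => u0; rewrite vE u0 mulmx0.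
have -> : v^T *m invmx S *m v = (S *m u)^T *m u by rewrite -vE -mulmxA -uE.
have -> : (S *m u)^T *m u = (u^T *m S *m u)^T.
  by rewrite !trmx_mul trmxK mulmxA.
by rewrite mxE; exact: Spos.
Qed.

Lemma ge0_integral_affine_vecn (x : 'cV[R]_n) (s : R) (g : RnT R n -> R) :
  measurable_fun setT g -> (forall z, 0 <= g z) ->
  (\int[lebn R n]_y (g (ptv (invmx S *m (x - vecn y + s *: b))))%:E =
   (\det S)%:E * \int[lebn R n]_z (g z)%:E)%E.
Proof.
move=> mg g0.
have mgS : measurable_fun setT (fun z : RnT R n => (g (ptv (invmx S *m vecn z)))%:E).
  apply/measurable_EFinP; apply: (measurableT_comp mg); apply: measurable_ptv.
  by apply: measurable_mulmx; exact: measurable_vecn.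
have gS0 (z : RnT R n) : (0 <= (g (ptv (invmx S *m vecn z)))%:E)%E by rewrite lee_fin.
have mgE : measurable_fun setT (EFin \o g) by exact/measurable_EFinP.
have gE0 (z : RnT R n) : (0 <= (EFin \o g) z)%E by rewrite lee_fin.
have := ge0_integral_mulmx invmx_pos mgE gE0.
rewrite det_inv invrK => <-.
apply: etrans (ge0_integral_reflect (x + s *: b) mgS gS0).
by apply: eq_integral => y _; rewrite ptvK addrAC.
Qed.

(** The first factor is [denom S p] to the power -q when q = [pconj p], by [denom_powR]; written in
    q alone it covers p = +oo as well. *)
Definition kcst (q : R) : R :=
  (2 `^ (n%:R * (q - 1)) * pi `^ ((n%:R * (q - 1) + 1) / 2) * \det S `^ (q - 1))^-1
   * (q `^ ((n%:R + q) / 2))^-1.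

Lemma integral_Kker_powR (e x : 'cV[R]_n) (q s : R) : 1 <= q -> 0 < s ->
  (\int[lebn R n]_y (`|Kker S b c e (x - vecn y) s| `^ q)%:E =
   (eucl (invmx S *m e) `^ q * kcst q
     * (expR (q * c * s) / s `^ ((n%:R * (q - 1) + q) / 2)))%:E * gammae ((q + 1) / 2))%E.
Proof.
move=> q1 s0.
have q0 : 0 < q by rewrite (lt_le_trans _ q1).
have D0 := posdef_det_gt0 Spos.
set m := invmx S *m e.
pose C0 := expR (c * s) / ((2 * Num.sqrt (pi * s)) ^+ n * \det S).
have C00 : 0 <= C0.
  apply: mulr_ge0; first exact: expR_ge0.
  rewrite invr_ge0; apply: mulr_ge0; last exact: ltW.
  by apply: exprn_ge0; apply: mulr_ge0 => //; exact: sqrtr_ge0.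
pose a i := oapp (fun j : 'I_n => m j 0) 0 (insub i : option 'I_n).
have aE (i : 'I_n) : a i = m i 0 by rewrite /a valK.
(* Raising the kernel to the power q multiplies the Gaussian rate 1/(4s) by q. *)
pose k := q / (4 * s).
have k0 : 0 < k by rewrite divr_gt0// mulr_gt0.
pose g1 (z : RnT R n) : R := (`|\sum_(i < n) a i * coordn z i| `^ q * expR (- (k * \sum_(i < n) coordn z i ^+ 2))).
pose g (z : RnT R n) : R := (C0 / (2 * s)) `^ q * g1 z.
have g10 z : 0 <= g1 z by rewrite mulr_ge0 ?powR_ge0 ?expR_ge0.
have g0 z : 0 <= g z by rewrite mulr_ge0 ?powR_ge0.
have mph : measurable_fun [set: R] (fun u : R => `|u| `^ q).
  exact: (measurableT_comp (measurable_powR _) (@normr_measurable R setT)).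
have mg1 : measurable_fun setT g1.
  apply: measurable_funM.
    apply: (measurableT_comp mph); apply: measurable_sum => i.
    by apply: measurable_funM => //; exact: measurable_coordn.
  apply: measurableT_comp => //; apply: measurableT_comp => //; apply: measurable_funM => //.
  by apply: measurable_sum => i; apply: measurable_funX; exact: measurable_coordn.
have mg : measurable_fun setT g by exact: measurable_funM.
have KE v : `|Kker S b c e v s| `^ q = g (ptv (invmx S *m (v + s *: b))).
  rewrite /Kker /Gker -/C0 -/m.
  set w := invmx S *m (v + s *: b).
  have d1 : \sum_(i < n) a i * coordn (ptv w) i = dotp w m.
    by apply: eq_bigr => i _; rewrite aE coordn_ptv mulrC.
  have d2 : \sum_(i < n) coordn (ptv w) i ^+ 2 = eucl w ^+ 2.
    by rewrite eucl_sq; apply: eq_bigr => i _; rewrite coordn_ptv.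
  rewrite /g /g1 d1 d2.
  have -> : - (k * eucl w ^+ 2) = (- eucl w ^+ 2 / (4 * s)) * q.
    by rewrite /k; field; rewrite gt_eqF.
  have h1 : 0 <= C0 / (2 * s).
    by apply: mulr_ge0 => //; rewrite invr_ge0; apply: mulr_ge0 => //; exact: ltW.
  rewrite [in RHS]expRM [RHS]mulrA -(powRM _ h1 (normr_ge0 _)).
  rewrite -(powRM _ (mulr_ge0 h1 (normr_ge0 _)) (expR_ge0 _)).
  congr (_ `^ q).
  set E := expR _.
  have -> : - dotp w m / (2 * s) * (C0 * E) = (C0 / (2 * s) * E) * - dotp w m by ring.
  have E0 : 0 <= E by exact: expR_ge0.
  by rewrite normrM normrN (ger0_norm (mulr_ge0 h1 E0)) mulrAC.
under eq_integral do rewrite KE.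
rewrite (ge0_integral_affine_vecn x s mg g0) /g ge0_integralZl_real//; last exact: powR_ge0.
have cc0 : 0 < Num.sqrt (pi / k) by rewrite sqrtr_gt0 divr_gt0// pi_gt0.
have := @integral_lebn_gauss R n k a (fun u => `|u| `^ q) k0 mph (fun _ => powR_ge0 _ _).
set I1 := (\int[lebn R n]_z _)%E.
have -> : Num.sqrt (\sum_(i < n) a i ^+ 2) = eucl m.
  by congr Num.sqrt; apply: eq_bigr => i _; rewrite aE.
under eq_integral.
  move=> u _; rewrite normrM (ger0_norm (sqrtr_ge0 _)) powRM ?sqrtr_ge0// -mulrA; over.
rewrite ge0_integralZl_real; [|by []| | |exact: powR_ge0]; last 2 first.
- by apply: measurable_funM => //; exact: measurable_expR_sq.
- by move=> u; rewrite mulr_ge0 ?powR_ge0 ?expR_ge0.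
rewrite integral_norm_powR_gauss// => H.
have -> : I1 = ((Num.sqrt (pi / k))^-1%:E * ((Num.sqrt (pi / k) ^+ n)%:E *
    ((eucl m `^ q)%:E * ((k `^ (- ((q + 1) / 2)))%:E * gammae ((q + 1) / 2)))))%E.
  by rewrite -H muleA -EFinM mulVf ?mul1e// gt_eqF.
rewrite !muleA -!EFinM; congr (_%:E * _)%E.
have := kernel_constant n c q0 s0 D0; rewrite -/C0 -/k => KC.
rewrite /kcst -[in RHS]mulrA -KC; field.
by rewrite gt_eqF.
Qed.

End kernel.

(** * The space-time norm of the kernel and the explicit constant *)

Section kernel_norm.
Context (R : realType) (n : nat) (S : 'M[R]_n) (b : 'cV[R]_n) (c t : R).
Local Notation mu := (@lebesgue_measure R).
Hypothesis Spos : forall v : 'cV[R]_n, v != 0 -> 0 < (v^T *m S *m v) 0 0.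
Hypothesis t0 : 0 < t.

(** Extension by zero outside the strip turns every pairing into an integral over the whole space,
    where Tonelli and Hoelder apply directly. *)
Definition KT (e x : 'cV[R]_n) (z : RnT R n * R) : R :=
  if 0 < z.2 < t then Kker S b c e (x - vecn z.1) (t - z.2) else 0.

Lemma measurable_strip (T : R) : measurable [set z : RnT R n * R | 0 < z.2 < T].
Proof.
have -> : [set z : RnT R n * R | 0 < z.2 < T] = setT `*` `]0, T[%classic.
  by apply/seteqP; split => z /=; rewrite in_itv //= => -[].
by apply: measurableX.
Qed.

Lemma measurable_strip_bool (T : R) :
  measurable_fun setT (fun z : RnT R n * R => 0 < z.2 < T).
Proof.
apply: measurable_and; first exact: measurable_fun_ltr.
exact: measurable_fun_ltr.
Qed.

Lemma measurable_sub_vecn (x : 'cV[R]_n) i :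
  measurable_fun setT (fun z : RnT R n * R => (x - vecn z.1) i 0).
Proof.
rewrite (_ : (fun z => _) = (fun z => x i 0 - coordn z.1 i)).
  apply: measurable_funB => //.
  exact: (measurableT_comp (measurable_coordn i) measurable_fst).
by apply/funext => z; rewrite !mxE.
Qed.

Lemma measurable_KT e x : measurable_fun setT (KT e x).
Proof.
apply: measurable_fun_ifT => //; first exact: measurable_strip_bool.
apply: measurable_Kker; first exact: measurable_sub_vecn.
exact: measurable_funB.
Qed.

Definition wt (q s : R) : R := expR (q * c * s) / s `^ ((n%:R * (q - 1) + q) / 2).

Lemma wt_ge0 q s : 0 <= wt q s.
Proof. by apply: mulr_ge0; [exact: expR_ge0|rewrite invr_ge0 powR_ge0]. Qed.

Lemma measurable_wt q : measurable_fun [set: R] (wt q).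
Proof.
apply: measurable_funM.
  by apply: measurableT_comp => //; exact: measurable_funM.
by apply: measurable_funV; exact: measurable_powR.
Qed.

Lemma integral_wt_lty q : 1 <= q -> (n%:R * (q - 1) + q) / 2 < 1 ->
  (\int[mu]_(s in `]0%R, t[) (wt q s)%:E < +oo)%E.
Proof.
move=> q1 be1.
have mwt := measurable_wt q.
(* The exponential is bounded on (0, t) whatever the sign of c, so only the power of s matters. *)
apply: (@le_lt_trans _ _ (\int[mu]_(s in `]0%R, t[)
   (expR (`|q * c| * t) * s `^ (- ((n%:R * (q - 1) + q) / 2)))%:E)%E).
  apply: ge0_le_integral => //.
  - by move=> s _; rewrite lee_fin wt_ge0.
  - by apply/measurable_EFinP; exact: measurable_funTS.
  - by apply/measurable_EFinP/measurable_funTS; apply: measurable_funM => //; exact: measurable_powR.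
  - move=> s /=; rewrite in_itv /= => /andP[s0 st]; rewrite lee_fin /wt powRN.
    apply: ler_wpM2r; first by rewrite invr_ge0 powR_ge0.
    rewrite ler_expR (le_trans (ler_norm _))// normrM (gtr0_norm s0).
    by apply: ler_wpM2l => //; exact: ltW.
rewrite ge0_integralZl_real; [|by []|by apply: measurable_funTS; exact: measurable_powR
  |by move=> s; exact: powR_ge0|exact: expR_ge0].
apply: lte_mul_pinfty => //; exact: integral_powRN_lty.
Qed.

Definition It (q : R) : R := Rintegral mu `]0, t[ (wt q).

Lemma ItE q : 1 <= q -> (n%:R * (q - 1) + q) / 2 < 1 ->
  (\int[mu]_(s in `]0%R, t[) (wt q s)%:E = (It q)%:E)%E.
Proof.
move=> q1 be1; rewrite /It /Rintegral fineK//.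
rewrite ge0_fin_numE; first exact: integral_wt_lty.
by apply: integral_ge0 => s _; rewrite lee_fin wt_ge0.
Qed.

Lemma It_gt0 q : 1 <= q -> (n%:R * (q - 1) + q) / 2 < 1 -> 0 < It q.
Proof.
move=> q1 be1; rewrite -lte_fin -ItE//.
set be := (n%:R * (q - 1) + q) / 2.
have be0 : 0 <= be.
  by apply: divr_ge0 => //; rewrite addr_ge0 ?mulr_ge0 ?subr_ge0// (le_trans _ q1).
pose k := expR (- (`|q * c| * t)) / t `^ be.
have k0 : 0 < k by rewrite /k divr_gt0 ?expR_gt0 ?powR_gt0.
apply: (@lt_le_trans _ _ (\int[mu]_(s in `]0%R, t[) k%:E)%E).
  by rewrite integral_cst//= lebesgue_measure_itv /= lte_fin t0 sube0 -EFinM lte_fin mulr_gt0.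
apply: ge0_le_integral => //.
- by move=> s _; rewrite lee_fin ltW.
- by apply/measurable_EFinP/measurable_funTS; exact: measurable_wt.
- move=> s /=; rewrite in_itv /= => /andP[s0 st]; rewrite lee_fin /wt /k -/be.
  apply: ler_pM; rewrite ?expR_ge0 ?invr_ge0 ?powR_ge0//.
    rewrite ler_expR lerNl -mulNr (le_trans (ler_norm _))// normrM normrN (gtr0_norm s0).
    by apply: ler_wpM2l => //; exact: ltW.
  rewrite lef_pV2 ?posrE ?powR_gt0//.
  by apply: ge0_ler_powR => //; rewrite ?nnegrE ltW.
Qed.

Lemma gammae_gt0 (s : R) : (0 < gammae s)%E.
Proof.
have mg : measurable_fun [set: R] (fun y : R => y `^ (s - 1) * expR (- y)).
  apply: measurable_funM; first exact: measurable_powR.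
  by apply: measurableT_comp.
(* On [1, 2] the power y^(s-1) is at least 1 or at least 2^(s-1), according to the sign of s - 1. *)
pose k : R := Num.min 1 (2 `^ (s - 1)) * expR (- 2).
have k0 : 0 < k by rewrite mulr_gt0 ?expR_gt0// lt_min ltr01 powR_gt0.
apply: (@lt_le_trans _ _ (\int[mu]_(y in `[1%R, 2%R]) (k)%:E)%E).
  rewrite integral_cst//= lebesgue_measure_itv /= lte_fin ltr1n -EFinB -EFinM lte_fin.
  by rewrite mulr_gt0// subr_gt0 ltr1n.
apply: (@le_trans _ _ (\int[mu]_(y in `[1%R, 2%R]) (y `^ (s - 1) * expR (- y))%:E)%E).
  apply: ge0_le_integral => //.
  - by move=> y _; rewrite lee_fin ltW.
  - by apply/measurable_EFinP; exact: measurable_funTS.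
  - move=> y /=; rewrite in_itv /= => /andP[y1 y2]; rewrite lee_fin.
    have y0 : 0 < y by rewrite (lt_le_trans ltr01).
    apply: ler_pM; rewrite ?expR_ge0 ?le_min ?ler01 ?powR_ge0//; last by rewrite ler_expR lerN2.
    rewrite ge_min; have [s1|s1] := leP 0 (s - 1).
      apply/orP; left; apply: (@le_trans _ _ (1 `^ (s - 1))); first by rewrite powR1.
      by apply: ge0_ler_powR => //; rewrite ?nnegrE ltW.
    have -> : s - 1 = - (1 - s) by ring.
    apply/orP; right; rewrite !powRN lef_pV2 ?posrE ?powR_gt0//.
    by apply: ge0_ler_powR => //; rewrite ?nnegrE ?ltW//; lra.
apply: ge0_subset_integral => //.
- by apply/measurable_EFinP; exact: measurable_funTS.
- by move=> y _; rewrite lee_fin mulr_ge0 ?powR_ge0 ?expR_ge0.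
- by move=> y /=; rewrite !in_itv /= andbT => /andP[y1 _]; exact: lt_le_trans y1.
Qed.

Lemma gammaeE (q : R) : 1 <= q <= 2 -> gammae ((q + 1) / 2) = (Gamma ((q + 1) / 2))%:E.
Proof.
move=> q12; rewrite /Gamma fineK// ge0_fin_numE; first exact: gammae_fin.
by rewrite ltW// gammae_gt0.
Qed.

Lemma Gamma_gt0 (q : R) : 1 <= q <= 2 -> 0 < Gamma ((q + 1) / 2) :> R.
Proof. by move=> q12; rewrite -lte_fin -gammaeE// gammae_gt0. Qed.

(** The q-th power of the L^q norm of [KT e x]; it does not depend on x. *)
Definition Nq (e : 'cV[R]_n) (q : R) : R :=
  eucl (invmx S *m e) `^ q * kcst S q * It q * Gamma ((q + 1) / 2).

Lemma kcst_gt0 q : 0 < q -> 0 < kcst S q.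
Proof.
move=> q0; rewrite /kcst mulr_gt0 ?invr_gt0 ?powR_gt0//.
by rewrite !mulr_gt0 ?powR_gt0 ?pi_gt0 ?posdef_det_gt0.
Qed.

Lemma integral_KT_powR e x q : 1 <= q <= 2 -> (n%:R * (q - 1) + q) / 2 < 1 ->
  (\int[lebnt R n]_z (`|KT e x z| `^ q)%:E = (Nq e q)%:E)%E.
Proof.
move=> q12 be1; have /andP[q1 q2] := q12.
have q0 : 0 < q by rewrite (lt_le_trans _ q1).
have mK : measurable_fun setT (fun z => (`|KT e x z| `^ q)%:E).
  apply/measurable_EFinP.
  apply: (measurableT_comp (measurable_powR _)).
  by apply: (measurableT_comp _ (measurable_KT e x)).
have K0 z : (0 <= (`|KT e x z| `^ q)%:E)%E by rewrite lee_fin powR_ge0.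
rewrite (@fubini_tonelli2 _ _ _ _ _ (slebn R n) mu _ mK K0) /fubini_G.
pose A := eucl (invmx S *m e) `^ q * kcst S q * Gamma ((q + 1) / 2).
have A0 : 0 <= A.
  apply: mulr_ge0; last exact/ltW/Gamma_gt0.
  by apply: mulr_ge0; [exact: powR_ge0|exact/ltW/kcst_gt0].
pose J (s : R) : \bar R := (if 0 < s < t then A * wt q s else 0)%:E.
have J0 s : (0 <= J s)%E.
  by rewrite /J; case: ifP => // _; rewrite lee_fin; apply: mulr_ge0 => //; exact: wt_ge0.
have mJ : measurable_fun [set: R] J.
  apply/measurable_EFinP; apply: measurable_fun_ifT => //.
    by apply: measurable_and; exact: measurable_fun_ltr.
  by apply: measurable_funM => //; exact: measurable_wt.
have N1 : -1 != 0 :> R by rewrite oppr_eq0 oner_eq0.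
(* The kernel depends on r through the lag t - r; reversing time puts the singularity at 0. *)
transitivity (\int[mu]_r J (-1 * r + t)%R)%E.
  apply: eq_integral => r _.
  rewrite /J mulN1r addrC subr_gt0 gtrBl.
  have -> : (r < t) && (0 < r) = (0 < r < t) by rewrite andbC.
  rewrite /KT /=; case: ifPn => [/andP[r0 rt]|_].
    rewrite integral_Kker_powR ?subr_gt0// gammaeE// -EFinM; congr EFin.
    by rewrite /A /wt; ring.
  by rewrite normr0 powR0 ?gt_eqF// integral0.
rewrite (ge0_integral_affine t N1 mJ J0) normrN1 invr1 mul1e.
transitivity (\int[mu]_(s in `]0%R, t[) (A * wt q s)%:E)%E.
  rewrite [RHS]integral_mkcond; apply: eq_integral => s _.
  by rewrite /J patchE mem_setE in_itv /=; case: ifP.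
rewrite ge0_integralZl_real//; last 2 first.
- by apply: measurable_funTS; exact: measurable_wt.
- exact: wt_ge0.
by rewrite ItE// -EFinM; congr EFin; rewrite /A /Nq; ring.
Qed.

Variable p : \bar R.
Hypothesis hp : ((n + 2)%:R%:E < p)%E.

(** For finite p = r one has q - 1 = 1/(r-1), and the second bound reads (n+1)/(r-1) < 1, that is r
    > n + 2. For p = +oo, q = 1 and the exponent is 1/2. *)
Lemma pconj_bounds : let q := pconj p in
  [/\ 1 <= q <= 2 & (n%:R * (q - 1) + q) / 2 < 1].
Proof.
have n0 : 0 <= n%:R :> R by [].
case: p hp => [r||//] /= hr; last first.
  by split; [rewrite lexx /= ler1n|rewrite subrr mulr0 add0r ltr_pdivrMr// mul1r ltr1n].
move: hr; rewrite lte_fin natrD => hr.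
have r1 : 0 < r - 1 by lra.
have -> : r / (r - 1) = 1 + (r - 1)^-1 by field; rewrite gt_eqF.
have i0 : 0 < (r - 1)^-1 by rewrite invr_gt0.
have i1 : (n%:R + 1) * (r - 1)^-1 < 1 by rewrite ltr_pdivrMr//; lra.
split; last by nra.
by apply/andP; split; nra.
Qed.

(** For finite p both q/p and q - 1 equal 1/(p-1), which converts the exponents. For p = +oo only
    the factor pi^(1/2) survives, in agreement with the value sqrt pi of [denom]. *)
Lemma denom_powR : denom S p `^ (pconj p) =
  2 `^ (n%:R * (pconj p - 1)) * pi `^ ((n%:R * (pconj p - 1) + 1) / 2) * \det S `^ (pconj p - 1).
Proof.
case: p hp => [r||//] /= hr; last first.
  by rewrite subrr mulr0 add0r !powRr0 powRr1 ?sqrtr_ge0// mulr1 mul1r mul1r powR12_sqrt ?pi_ge0.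
move: hr; rewrite lte_fin natrD => hr.
have n0 : 0 <= n%:R :> R by [].
have r1 : 0 < r - 1 by lra.
have r0 : 0 < r by lra.
have D0 : 0 <= \det S by rewrite ltW// posdef_det_gt0.
rewrite -powRrM.
have -> : r^-1 * (r / (r - 1)) = (r - 1)^-1 by field; rewrite !gt_eqF.
have -> : r / (r - 1) - 1 = (r - 1)^-1 by field; rewrite gt_eqF.
have h1 : 0 <= 2 ^+ n :> R by rewrite exprn_ge0.
have h2 : 0 <= pi `^ ((n%:R + r - 1) / 2) :> R by exact: powR_ge0.
rewrite (powRM _ (mulr_ge0 h1 h2) D0) (powRM _ h1 h2); congr (_ * _ * _).
  by rewrite -powR_mulrn// -powRrM.
by rewrite -powRrM; congr (_ `^ _); field; rewrite gt_eqF.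
Qed.

Lemma denom_gt0 : 0 < denom S p.
Proof.
case: p hp => [r||//] /= hr; last by rewrite sqrtr_gt0 pi_gt0.
by rewrite powR_gt0// !mulr_gt0 ?exprn_gt0 ?powR_gt0 ?pi_gt0 ?posdef_det_gt0.
Qed.

Lemma Nq_C_pl e : Nq e (pconj p) `^ (pconj p)^-1 = C_pl S c p t e.
Proof.
have [q12 be1] := pconj_bounds; have /andP[q1 q2] := q12.
set q := pconj p in q12 be1 q1 q2 *.
have q0 : 0 < q by rewrite (lt_le_trans _ q1).
have qE x : 0 <= x -> (x `^ q) `^ q^-1 = x.
  by move=> x0; rewrite -powRrM divff ?gt_eqF// powRr1.
have I0 := ltW (It_gt0 q1 be1).
have G0 : 0 <= Gamma ((q + 1) / 2) :> R by exact/ltW/Gamma_gt0.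
have eu0 : 0 <= eucl (invmx S *m e) by exact: sqrtr_ge0.
have d0 := ltW denom_gt0.
rewrite /C_pl /bracket -/q -[Rintegral _ _ _]/(It q).
have -> : Nq e q = ((eucl (invmx S *m e) / denom S p) `^ q) *
   (Gamma ((q + 1) / 2) / q `^ ((n%:R + q) / 2) * It q).
  rewrite powRM ?invr_ge0// -(powR_inv1 d0) -powRrM mulN1r powRN denom_powR -/q.
  by rewrite /Nq /kcst; ring.
have h1 : 0 <= eucl (invmx S *m e) / denom S p by rewrite divr_ge0.
have h2 : 0 <= Gamma ((q + 1) / 2) / q `^ ((n%:R + q) / 2) * It q.
  by rewrite !mulr_ge0// invr_ge0 powR_ge0.
by rewrite (powRM _ (powR_ge0 _ _) h2) qE.
Qed.

Lemma Nq_gt0 e q : 1 <= q <= 2 -> (n%:R * (q - 1) + q) / 2 < 1 ->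
  0 < eucl (invmx S *m e) -> 0 < Nq e q.
Proof.
move=> q12 be1 e0; have /andP[q1 q2] := q12.
have q0 : 0 < q by rewrite (lt_le_trans _ q1).
apply: mulr_gt0; last exact: Gamma_gt0.
apply: mulr_gt0; last exact: It_gt0.
by apply: mulr_gt0; [exact: powR_gt0|exact: kcst_gt0].
Qed.

End kernel_norm.

(** * Hoelder's inequality and its sharpness *)

Section hoelder.
Context d (T : measurableType d) (R : realType) (mu : {measure set T -> \bar R}).

(** Finite p is the usual inequality. For p = +oo the bound of |f| by its essential supremum is
    integrated almost everywhere; [Lnorm] is that supremum when the whole space has positive
    measure. *)
Lemma hoelder_pconj (p : \bar R) (f g : T -> R) (N : R) :
  (1 < p)%E -> (0 < mu setT)%E ->
  measurable_fun setT f -> measurable_fun setT g ->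
  (\int[mu]_x (`|g x| `^ (pconj p))%:E = N%:E)%E ->
  (Lnorm mu p (EFin \o f) < +oo)%E ->
  (\int[mu]_x `|(g x * f x)%:E| <= (N `^ (pconj p)^-1)%:E * Lnorm mu p (EFin \o f))%E.
Proof.
move=> p1 muT mf mg; case: p p1 => [r||//]; last first.
  move=> _ /=; rewrite invr1 => HN Mlt.
  have N0 : 0 <= N by rewrite -lee_fin -HN; apply: integral_ge0 => x _; rewrite lee_fin powR_ge0.
  have M0 := Lnorm_ge0 mu +oo%E (EFin \o f).
  have ME : Lnorm mu +oo%E (EFin \o f) = ess_sup mu (abse \o (EFin \o f)).
    by rewrite unlock muT.
  rewrite powRr1//.
  have MF : (Lnorm mu +oo%E (EFin \o f)) = (fine (Lnorm mu +oo%E (EFin \o f)))%:E.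
    by rewrite fineK// ge0_fin_numE.
  set M := fine _ in MF.
  have M00 : 0 <= M by rewrite /M fine_ge0.
  rewrite MF -EFinM mulrC EFinM -HN -ge0_integralZl_real//; last first.
    apply: (measurableT_comp (measurable_powR _)).
    by apply: measurableT_comp.
  apply: ae_ge0_le_integral => //.
  - apply/measurable_EFinP; apply: measurableT_comp => //.
    exact: measurable_funM.
  - by move=> x _; rewrite lee_fin mulr_ge0 ?powR_ge0.
  - apply/measurable_EFinP; apply: measurable_funM => //.
    apply: (measurableT_comp (measurable_powR _)).
    by apply: measurableT_comp.
  - have := ess_sup_ge mu (abse \o (EFin \o f)); rewrite -ME MF.
    apply: filterS => x /= H _; move: H; rewrite !lee_fin => H.
    by rewrite powRr1// normrM mulrC; apply: ler_wpM2r.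
rewrite lte_fin => r1 HN _.
have r0 : 0 < r by rewrite (lt_trans ltr01).
have r10 : 0 < r - 1 by rewrite subr_gt0.
have q0 : 0 < r / (r - 1) by rewrite divr_gt0.
have := @hoelder _ _ _ mu g f (r / (r - 1)) r mg mf q0 r0.
rewrite Lnorm1 => H; apply: (le_trans (H _)).
  by field; rewrite !gt_eqF.
apply: lee_wpmul2r; first exact: Lnorm_ge0.
rewrite {1}unlock /=.
rewrite (_ : (\int[mu]_x (`|(g x)%:E| `^ (r / (r - 1)))%E)%E = N%:E).
  by rewrite poweR_EFin.
by rewrite -HN; apply: eq_integral => x _.
Qed.

(** For finite p, (q-1)p = q gives |h|^p <= |g|^q pointwise; for p = +oo, q - 1 = 0 and the
    hypothesis says |h| <= 1. *)
Lemma Lnorm_le_dual (p : \bar R) (h g : T -> R) (N : R) :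
  (1 < p)%E -> (0 < mu setT)%E -> 0 < N ->
  measurable_fun setT g -> measurable_fun setT h ->
  (\int[mu]_x (`|g x| `^ (pconj p))%:E = N%:E)%E ->
  (forall x, `|h x| <= `|g x| `^ (pconj p - 1)) ->
  (Lnorm mu p (EFin \o h) <= (if p is r%:E then N `^ r^-1 else 1)%:E)%E.
Proof.
move=> p1 muT N0 mg mh HN hle.
set q := pconj p in HN hle *.
have mgq : measurable_fun setT (fun x => `|g x| `^ q).
  by apply: (measurableT_comp (measurable_powR _)); exact: measurableT_comp.
have : (exists r, p = r%:E) \/ p = +oo%E.
  by case: (p) p1 => [s||//] _; [left; exists s|right].
case=> [[r pE]|pE]; last first.
  rewrite pE unlock muT; apply/ess_supP; apply: nearW => x /=.
  by have := hle x; rewrite /q pE /= subrr powRr0 lee_fin.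
move: (p1); rewrite pE lte_fin => r1; have r0 : 0 < r by rewrite (lt_trans ltr01).
have qE : q = r / (r - 1) by rewrite /q pE.
have r11 : 0 < r - 1 by rewrite subr_gt0.
rewrite unlock.
rewrite -poweR_EFin; apply: gt0_ler_poweR.
- by rewrite invr_ge0 ltW.
- by rewrite in_itv /= leey andbT; apply: integral_ge0 => x _; rewrite /= lee_fin powR_ge0.
- by rewrite in_itv /= leey andbT lee_fin ltW.
have -> : (fun x => (`|(EFin \o h) x| `^ r)%E) = EFin \o (fun x => `|h x| `^ r) by [].
rewrite -HN; apply: ge0_le_integral; [by []| | | |].
- by move=> x _; rewrite /= lee_fin powR_ge0.
- apply/measurable_EFinP; apply: (measurableT_comp (measurable_powR _)).
  by apply: measurableT_comp.
- exact/measurable_EFinP.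
- move=> x _; rewrite /= lee_fin.
  apply: (le_trans (ge0_ler_powR (ltW r0) _ _ (hle x))); rewrite ?nnegrE ?powR_ge0//.
  rewrite -powRrM; suff -> : (q - 1) * r = q by [].
  by rewrite qE; field; rewrite gt_eqF.
Qed.

(* [h k] approximates the extremal function of the duality pairing with [g]. *)
Lemma duality_limit (p : \bar R) (h : nat -> T -> R) (g : T -> R) (N C : R) :
  (1 < p)%E -> (0 < mu setT)%E -> 0 < N ->
  measurable_fun setT g -> (forall k, measurable_fun setT (h k)) ->
  (\int[mu]_x (`|g x| `^ (pconj p))%:E = N%:E)%E ->
  (forall k x, `|h k x| <= `|g x| `^ (pconj p - 1)) ->
  (forall x, g x * h k x @[k --> \oo] --> `|g x| `^ (pconj p)) ->
  (forall k, (`|Rintegral mu setT (fun x => g x * h k x)|%:E <= C%:E * Lnorm mu p (EFin \o h k))%E) ->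
  N `^ (pconj p)^-1 <= C.
Proof.
move=> p1 muT N0 mg mh HN hle hcvg HC.
set q := pconj p in HN hle hcvg *.
have q1 : 1 <= q.
  rewrite /q; case: p p1 {HC q HN hle hcvg} => [r||//] //=; rewrite lte_fin => r1.
  by rewrite ler_pdivlMr ?subr_gt0// mul1r lerBlDr lerDl.
have q0 : 0 < q by rewrite (lt_le_trans ltr01).
have mgq : measurable_fun setT (fun x => `|g x| `^ q).
  by apply: (measurableT_comp (measurable_powR _)); exact: measurableT_comp.
have intg : mu.-integrable setT (fun x => (`|g x| `^ q)%:E).
  apply/integrableP; split; first exact/measurable_EFinP.
  under eq_integral do rewrite gee0_abs ?lee_fin ?powR_ge0//.
  by rewrite HN ltry.
have dom k x : `|g x * h k x| <= `|g x| `^ q.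
  rewrite normrM -(mulr_powRB1 (normr_ge0 (g x)) q0).
  by apply: ler_wpM2l.
have mgh k : measurable_fun setT (fun x => (g x * h k x)%:E).
  by apply/measurable_EFinP; exact: measurable_funM.
have intgh k : mu.-integrable setT (fun x => (g x * h k x)%:E).
  apply: (le_integrable measurableT (mgh k) _ intg) => x _ /=.
  by rewrite lee_fin (ger0_norm (powR_ge0 _ _)).
have cvgI : (\int[mu]_x (g x * h k x)%:E)%E @[k --> \oo] --> N%:E.
  rewrite -HN; apply: (@dominated_cvg _ _ _ mu setT measurableT _ _ (fun x => (`|g x| `^ q)%:E)) => //.
  - by move=> x _; apply: cvg_EFin; [exact: nearW|exact: hcvg].
  - by move=> k x _ /=; rewrite lee_fin.
(* A common bound for the norms of the [h k]. Dividing the limit N of the pairings by it leaves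
   N^(1/q), since 1 - 1/p = 1/q. *)
pose B : R := if p is r%:E then N `^ r^-1 else 1.
have B0 : 0 < B by rewrite /B; case: (p) => // r; exact: powR_gt0.
have Bq : N / B = N `^ q^-1.
  rewrite /B /q; case: p p1 {HC q HN hle hcvg q1 q0 mgq intg dom B B0 cvgI} => [r||//] /=; last by rewrite divr1 invr1 powRr1// ltW.
  rewrite lte_fin => r1; have r0 : 0 < r by rewrite (lt_trans ltr01).
  rewrite -{1}(powRr1 (ltW N0)) -powRN -powRD_gt0//; congr (_ `^ _).
  have r11 : 0 < r - 1 by rewrite subr_gt0.
  by field; rewrite !gt_eqF.
have LB k : (Lnorm mu p (EFin \o h k) <= B%:E)%E by exact: (Lnorm_le_dual p1 muT N0 mg (mh k) HN (hle k)).
(* The bound by B may be multiplied by C only if C >= 0. A negative C would make all pairings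
   vanish, although they tend to N > 0. *)
have C0 : 0 <= C.
  rewrite leNgt; apply/negP => Cn.
  have Ik k : \int[mu]_x (g x * h k x) = 0.
    apply/eqP; rewrite -normr_le0 -lee_fin; apply: (le_trans (HC k)).
    by apply: mule_le0_ge0; [rewrite lee_fin ltW|exact: Lnorm_ge0].
  have E0 k : (\int[mu]_x (g x * h k x)%:E)%E = 0%:E.
    by rewrite -(Ik k) /Rintegral fineK//; exact: integrable_fin_num.
  have c0 : (\int[mu]_x (g x * h k x)%:E)%E @[k --> \oo] --> 0%:E.
    by under eq_fun do rewrite E0; exact: cvg_cst.
  have : N%:E = 0%:E by apply: cvg_unique cvgI c0.
  by move=> [NE]; rewrite NE ltxx in N0.
rewrite -Bq ler_pdivrMr//.
rewrite -lee_fin -(cvg_lim _ cvgI)//; apply: lime_le; first by apply: cvgP cvgI.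
apply: nearW => k.
have -> : (\int[mu]_x (g x * h k x)%:E)%E = (\int[mu]_x (g x * h k x))%:E.
  by rewrite /Rintegral fineK//; exact: integrable_fin_num.
apply: (@le_trans _ _ `|\int[mu]_x (g x * h k x)|%:E); first by rewrite lee_fin ler_norm.
apply: (le_trans (HC k)); rewrite EFinM.
by apply: lee_wpmul2l.
Qed.

End hoelder.

Lemma lebn_setT_gt0 (R : realType) n : (0 < lebn R n setT)%E.
Proof.
elim: n => [|n IH]; first by rewrite /= diracT lte01.
rewrite /= -setXTT product_measure1E//; apply: mule_gt0 => //.
apply: (@lt_le_trans _ _ (lebesgue_measure (`[0, 1]%classic : set R))).
  by rewrite lebesgue_measure_itv /= lte_fin ltr01 sube0 lte_fin ltr01.
by apply: le_measure; rewrite ?inE.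
Qed.

Lemma lebnt_setT_gt0 (R : realType) n : (0 < lebnt R n setT)%E.
Proof. exact: (lebn_setT_gt0 R n.+1). Qed.

(** * Functions locally Lipschitz in space, uniformly in time *)

Section nice.
Context (R : realType) (n : nat) (T : R).
Hypothesis T0 : 0 < T.
Implicit Types g : 'cV[R]_n -> R -> R.

(* Jointly continuous functions which, on bounded sets of x and uniformly in
   0 <= s <= T, are bounded and Lipschitz in x. *)
Definition nice g := continuous (fun z : 'cV[R]_n * R => g z.1 z.2) /\
  forall r, 0 < r -> exists2 L, 0 <= L & forall x y s, eucl x <= r -> eucl y <= r ->
    0 <= s <= T -> `|g x s| <= L /\ `|g x s - g y s| <= L * eucl (x - y).

Lemma eucl_ge0 m (v : 'cV[R]_m) : 0 <= eucl v. Proof. exact: sqrtr_ge0. Qed.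

Lemma normr_le_eucl m (v : 'cV[R]_m) i : `|v i 0| <= eucl v.
Proof.
rewrite -sqrtr_sqr ler_sqrt; last by rewrite sumr_ge0// => j _; exact: sqr_ge0.
by rewrite (bigD1 i)//= lerDl sumr_ge0// => j _; exact: sqr_ge0.
Qed.

Lemma nice_time (h : R -> R) : continuous h -> nice (fun _ s => h s).
Proof.
move=> ch; split=> [z|r r0].
  by apply: continuous_comp; [exact: cvg_snd|exact: ch].
have cN : {within `[0, T], continuous (fun s => `|h s|)}.
  apply: continuous_subspaceT => s; apply: continuous_comp; [exact: ch|exact: norm_continuous].
have [m _ mP] := EVT_max (ltW T0) cN.
exists `|h m|; first exact: normr_ge0.
move=> x y s _ _ s0T; split; first by apply: mP; rewrite in_itv.
by rewrite subrr normr0 mulr_ge0// eucl_ge0.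
Qed.

Lemma nice_cst (k : R) : nice (fun _ _ => k).
Proof. by apply: (nice_time (h := fun=> k)) => ?; exact: cvg_cst. Qed.

Lemma nice_coord i : nice (fun x _ => x i 0).
Proof.
split=> [z|r r0].
  apply: (continuous_comp (g := fun x : 'cV[R]_n => x i 0)); [exact: cvg_fst|exact: coord_continuous].
exists (Num.max 1 r); first by rewrite le_max ler01.
move=> x y s xr yr _; split.
  by rewrite (le_trans (normr_le_eucl _ _))// (le_trans xr)// le_max lexx orbT.
have := normr_le_eucl (x - y) i; rewrite !mxE => /le_trans; apply.
by rewrite ler_peMl ?eucl_ge0// le_max lexx.
Qed.

Lemma niceD g h : nice g -> nice h -> nice (fun x s => g x s + h x s).
Proof.
move=> [cg Lg] [ch Lh]; split=> [z|r r0]; first by apply: cvgD; [exact: cg|exact: ch].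
have [L1 L10 H1] := Lg r r0; have [L2 L20 H2] := Lh r r0.
exists (L1 + L2); first exact: addr_ge0.
move=> x y s xr yr sT; have [b1 l1] := H1 x y s xr yr sT; have [b2 l2] := H2 x y s xr yr sT.
split; first by rewrite (le_trans (ler_normD _ _))// lerD.
have -> : g x s + h x s - (g y s + h y s) = (g x s - g y s) + (h x s - h y s) by ring.
by rewrite (le_trans (ler_normD _ _))// mulrDl lerD.
Qed.

Lemma niceM g h : nice g -> nice h -> nice (fun x s => g x s * h x s).
Proof.
move=> [cg Lg] [ch Lh]; split=> [z|r r0]; first by apply: cvgM; [exact: cg|exact: ch].
have [L1 L10 H1] := Lg r r0; have [L2 L20 H2] := Lh r r0.
exists (2 * (L1 * L2)); first by rewrite !mulr_ge0.
move=> x y s xr yr sT; have [b1 l1] := H1 x y s xr yr sT; have [b2 l2] := H2 x y s xr yr sT.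
have [b1' _] := H1 y y s yr yr sT.
have e0 := eucl_ge0 (x - y).
split.
  by rewrite normrM (le_trans (ler_pM _ _ b1 b2))// mulr2n mulrDl mul1r lerDl mulr_ge0.
have -> : g x s * h x s - g y s * h y s = (g x s - g y s) * h x s + g y s * (h x s - h y s) by ring.
rewrite (le_trans (ler_normD _ _))// !normrM.
have -> : 2 * (L1 * L2) * eucl (x - y) = (L1 * eucl (x - y)) * L2 + L1 * (L2 * eucl (x - y)) by ring.
by apply: lerD; apply: ler_pM.
Qed.

(** On a bounded set g takes values in some [-M, M], where psi is Lipschitz; comparison with psi 0
    bounds the composition. *)
Lemma nice_comp (psi : R -> R) g : nice g -> continuous psi ->
  (forall M, 0 <= M -> exists2 L, 0 <= L &
    forall u v, `|u| <= M -> `|v| <= M -> `|psi u - psi v| <= L * `|u - v|) ->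
  nice (fun x s => psi (g x s)).
Proof.
move=> [cg Lg] cpsi Lpsi; split=> [z|r r0].
  by apply: continuous_comp; [exact: cg|exact: cpsi].
have [L1 L10 H1] := Lg r r0; have [L2 L20 H2] := Lpsi L1 L10.
exists (`|psi 0| + L2 * L1); first by rewrite addr_ge0 ?mulr_ge0.
move=> x y s xr yr sT; have [b1 l1] := H1 x y s xr yr sT.
have [b1' _] := H1 y y s yr yr sT.
split.
  rewrite -[psi (g x s)](subrK (psi 0)) addrC (le_trans (ler_normD _ _))//.
  rewrite lerD2l (le_trans (H2 _ _ b1 _)) ?normr0// subr0.
  by apply: ler_wpM2l.
rewrite (le_trans (H2 _ _ b1 b1'))// mulrDl ler_wpDl ?mulr_ge0 ?eucl_ge0//.
by rewrite -mulrA; apply: ler_wpM2l.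
Qed.

Lemma nice_sum m (g : 'I_m -> 'cV[R]_n -> R -> R) : (forall i, nice (g i)) ->
  nice (fun x s => \sum_i g i x s).
Proof.
move=> H; elim: m g H => [|m IH] g H.
  by under eq_fun => x do under eq_fun do rewrite big_ord0; exact: nice_cst.
under eq_fun => x do under eq_fun do rewrite big_ord_recr /=.
by apply: niceD => //; apply: IH.
Qed.

Lemma nice_expR g : nice g -> nice (fun x s => expR (g x s)).
Proof.
move=> H; apply: (nice_comp H); first exact: continuous_expR.
move=> M M0; exists (expR M); first exact: expR_ge0.
move=> u v uM vM; wlog uv : u v uM vM / v <= u.
  move=> W; have [vu|uv] := leP v u; first exact: W.
  by rewrite distrC (distrC u); apply: W => //; exact: ltW.
rewrite !ger0_norm ?subr_ge0 ?ler_expR//.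
have -> : expR u - expR v = expR u * (1 - expR (v - u)).
  by rewrite mulrBr mulr1 -expRD; congr (_ - expR _); ring.
apply: ler_pM; rewrite ?expR_ge0 ?subr_ge0//.
- by rewrite -(@expR0 R) ler_expR subr_le0.
- by rewrite ler_expR (le_trans (ler_norm _)).
- have := expR_ge1Dx (v - u); lra.
Qed.

(** The shift by [ep] keeps the argument of the logarithm at least [ep], whence the Lipschitz
    constant 1/ep, from ln(1 + y) <= y. *)
Lemma nice_ln_norm (ep : R) g : 0 < ep -> nice g -> nice (fun x s => ln (`|g x s| + ep)).
Proof.
move=> ep0 H.
have p0 (u : R) : 0 < `|u| + ep by rewrite ltr_wpDl.
apply: (nice_comp (psi := fun u => ln (`|u| + ep)) H).
  move=> u; apply: (@continuous_comp _ _ _ (fun u : R => `|u| + ep) (@ln R)).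
    by apply: cvgD; [exact: norm_continuous|exact: cvg_cst].
  exact: continuous_ln.
move=> M M0; exists ep^-1; first by rewrite invr_ge0 ltW.
move=> u v _ _; wlog uv : u v / `|v| <= `|u|.
  move=> W; have [vu|uv] := leP `|v| `|u|; first exact: W.
  by rewrite distrC (distrC u); apply: W => //; exact: ltW.
rewrite ger0_norm; last by rewrite subr_ge0 ler_ln ?posrE// lerD2r.
rewrite -ln_div ?posrE//.
have -> : (`|u| + ep) / (`|v| + ep) = 1 + (`|u| - `|v|) / (`|v| + ep).
  by field; rewrite gt_eqF.
set y := (`|u| - `|v|) / (`|v| + ep).
have y0 : 0 <= y by apply: divr_ge0; [rewrite subr_ge0|exact: ltW].
apply: (@le_trans _ _ y).
  by rewrite -ler_expR lnK ?posrE ?expR_ge1Dx// ltr_wpDr.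
rewrite /y mulrC; apply: ler_pM; rewrite ?invr_ge0 ?subr_ge0 ?(ltW (p0 _))//.
  by rewrite lef_pV2 ?posrE// lerDr.
by rewrite (le_trans (ler_norm _))// ler_dist_dist.
Qed.

End nice.

(** * Regularized extremal functions *)

Section extremal.
Context (R : realType) (n : nat) (S : 'M[R]_n) (b e x : 'cV[R]_n) (c t T q : R).
Hypotheses (Spos : forall v : 'cV[R]_n, v != 0 -> 0 < (v^T *m S *m v) 0 0).
Hypotheses (t0 : 0 < t) (tT : t < T) (q12 : 1 <= q <= 2).

(** The powers are written through [expR] and [ln] because [nice] is stable under these. The
    absolute values, harmless for ep >= 0, give the arguments the form required by
    [nice_ln_norm]. *)
Definition dualF (ep k : R) : R :=
  k * expR (- ((2 - q) / 2 * ln (`|k ^+ 2| + ep)) - ln (`|ep * k ^+ 2| + 1)).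

(** A ramp from 0 at [ep] to 1 at [2 * ep]. It vanishes wherever [Num.max] in [extremal] alters the
    lag, so the kernel is only replaced where it is multiplied by 0. *)
Definition cutoff (ep s : R) : R := Num.min 1 (Num.max 0 (s / ep - 1)).

(* |K|^(q-1) sgn K, regularized at the zeros of K and cut off near s = t. *)
Definition extremal (ep : R) (y : 'cV[R]_n) (s : R) : R :=
  cutoff ep (t - s) * dualF ep (Kker S b c e (x - y) (Num.max (t - s) ep)).

Let T0 : 0 < T. Proof. exact: lt_trans tT. Qed.
Let q1 : 1 <= q. Proof. by case/andP: q12. Qed.
Let q2 : q <= 2. Proof. by case/andP: q12. Qed.
Let q0 : 0 < q. Proof. exact: lt_le_trans q1. Qed.

Lemma continuous_maxr_cst (k : R) : continuous (fun s : R => Num.max s k).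
Proof.
have -> : (fun s : R => Num.max s k) = (fun s => (s + k + `|s - k|) / 2).
  by apply/funext => s; rewrite maxr_absE.
move=> s; apply: cvgM; last exact: cvg_cst.
apply: cvgD; first by apply: cvgD; [exact: cvg_id|exact: cvg_cst].
apply: (@continuous_comp _ _ _ (fun s : R => s - k) Num.norm); last exact: norm_continuous.
by apply: cvgB; [exact: cvg_id|exact: cvg_cst].
Qed.

Lemma continuous_cutoff (ep : R) : continuous (fun s => cutoff ep (t - s)).
Proof.
have -> : (fun s => cutoff ep (t - s)) =
    (fun s => - Num.max (- Num.max ((t - s) / ep - 1) 0) (- 1)).
  by apply/funext => s; rewrite /cutoff oppr_max !opprK [RHS]minC [in RHS]maxC.
move=> s; apply: cvgN.
apply: (@continuous_comp _ _ _ (fun s => - Num.max ((t - s) / ep - 1) 0) (fun s => Num.max s (-1))); last exact: continuous_maxr_cst.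
apply: cvgN.
apply: (@continuous_comp _ _ _ (fun s => (t - s) / ep - 1) (fun s => Num.max s 0)); last exact: continuous_maxr_cst.
apply: cvgB; last exact: cvg_cst.
by apply: cvgM; [apply: cvgB; [exact: cvg_cst|exact: cvg_id]|exact: cvg_cst].
Qed.

Lemma cutoff_bounds ep s : 0 <= cutoff ep s <= 1.
Proof. by rewrite /cutoff ge_min lexx /= andbT le_min ler01 le_max lexx. Qed.

Lemma cutoff0 ep s : 0 < ep -> s <= ep -> cutoff ep s = 0.
Proof.
move=> ep0 sep; have h : s / ep - 1 <= 0 by rewrite subr_le0 ler_pdivrMr// mul1r.
by rewrite /cutoff (max_idPl h) (min_idPr ler01).
Qed.

Lemma cutoff1 ep s : 0 < ep -> 2 * ep <= s -> cutoff ep s = 1.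
Proof.
move=> ep0 sep; have h : 1 <= s / ep - 1.
  by rewrite lerBrDr ler_pdivlMr//; lra.
by rewrite /cutoff (max_idPr (le_trans ler01 h)) (min_idPl h).
Qed.

(** Because q <= 2, enlarging k^2 to k^2 + ep under the power -(2-q)/2 can only decrease the value,
    and the second factor is at most 1. *)
Lemma dualF_le_powR ep k : 0 < ep -> `|dualF ep k| <= `|k| `^ (q - 1).
Proof.
move=> ep0; have [->|k0] := eqVneq k 0.
  by rewrite /dualF mul0r normr0 powR_ge0.
have nk : 0 < `|k| by rewrite normr_gt0.
have k2 : 0 < k ^+ 2 by rewrite exprn_even_gt0.
have k2E : k ^+ 2 = `|k| `^ 2 by rewrite powR_mulrn// real_normK ?num_real.
have nke : 0 <= ep * k ^+ 2 by rewrite mulr_ge0 ?ltW.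
rewrite /dualF normrM (ger0_norm (expR_ge0 _)) (ger0_norm nke) (gtr0_norm k2).
have -> : `|k| `^ (q - 1) = `|k| * expR (- ((2 - q) / 2 * ln (k ^+ 2))).
  have -> : - ((2 - q) / 2 * ln (k ^+ 2)) = ln (k ^+ 2) * ((q - 2) / 2) by field.
  rewrite expRM lnK ?posrE// k2E -powRrM.
  have -> : q - 1 = 1 + 2 * ((q - 2) / 2) by field.
  by rewrite powRD_gt0// powRr1.
apply: ler_wpM2l => //; rewrite ler_expR.
have h1 : ln (k ^+ 2) <= ln (k ^+ 2 + ep) by rewrite ler_ln ?posrE ?addr_gt0// lerDl ltW.
have h2 : 0 <= ln (ep * k ^+ 2 + 1) by apply: ln_ge0; rewrite lerDr.
have h3 : (2 - q) / 2 * ln (k ^+ 2) <= (2 - q) / 2 * ln (k ^+ 2 + ep).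
  by apply: ler_wpM2l => //; apply: divr_ge0 => //; rewrite subr_ge0.
lra.
Qed.

(** The first regularization contributes at most ep^(-(2-q)/2). The second one gives 1/ep, since ep
    |k| <= ep (1 + k^2) <= 1 + ep k^2 for ep <= 1. *)
Lemma dualF_bounded ep k : 0 < ep <= 1 ->
  `|dualF ep k| <= expR (- ((2 - q) / 2 * ln ep)) / ep.
Proof.
move=> /andP[ep0 ep1].
have k2 : 0 <= k ^+ 2 by exact: sqr_ge0.
have nke : 0 <= ep * k ^+ 2 by rewrite mulr_ge0// ltW.
have p1 : 0 < ep * k ^+ 2 + 1 by rewrite ltr_wpDl.
rewrite /dualF normrM (ger0_norm (expR_ge0 _)) (ger0_norm nke) (ger0_norm k2).
rewrite expRD mulrCA; apply: ler_pM; rewrite ?expR_ge0 ?mulr_ge0 ?expR_ge0//.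
  rewrite ler_expR lerN2; apply: ler_wpM2l; first by rewrite divr_ge0// subr_ge0.
  by rewrite ler_ln ?posrE// ?lerDr// ltr_wpDl.
rewrite expRN lnK ?posrE// ler_pdivrMr// mulrC ler_pdivlMr//.
have h : `|k| <= 1 + k ^+ 2.
  have k2E : `|k| ^+ 2 = k ^+ 2 by rewrite real_normK ?num_real.
  have := sqr_ge0 (`|k| - 1); have := normr_ge0 k; rewrite -k2E; nra.
by nra.
Qed.

(** For k != 0 the expression is continuous in ep at 0, with value |k|^q there; for k = 0 both sides
    are 0 because q > 0. *)
Lemma cvg_dualF k : k * dualF (harmonic m) k @[m --> \oo] --> `|k| `^ q.
Proof.
have [->|k0] := eqVneq k 0.
  under eq_fun do rewrite mul0r; rewrite normr0 powR0 ?gt_eqF//; exact: cvg_cst.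
have nk : 0 < `|k| by rewrite normr_gt0.
have k2 : 0 < k ^+ 2 by rewrite exprn_even_gt0.
pose G ep := k * dualF ep k.
have G0 : G 0 = `|k| `^ q.
  rewrite /G /dualF mul0r normr0 add0r ln1 subr0 addr0 mulrA -expr2 (gtr0_norm k2).
  have -> : - ((2 - q) / 2 * ln (k ^+ 2)) = ln (k ^+ 2) * ((q - 2) / 2) by field.
  have k2E : k ^+ 2 = `|k| `^ 2 by rewrite powR_mulrn// real_normK ?num_real.
  rewrite expRM lnK ?posrE// k2E -powRrM.
  by rewrite -powRD_gt0//; congr (_ `^ _); field.
have c1 : {for (0 : R), continuous (fun ep : R => ln (`|ep * k ^+ 2| + 1))}.
  apply: (@continuous_comp _ _ _ (fun ep : R => `|ep * k ^+ 2| + 1) (@ln R)).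
    apply: cvgD; last exact: cvg_cst.
    apply: (@continuous_comp _ _ _ (fun ep : R => ep * k ^+ 2) Num.norm); last exact: norm_continuous.
    by apply: cvgM; [exact: cvg_id|exact: cvg_cst].
  by apply: continuous_ln; rewrite mul0r normr0 add0r.
rewrite -G0; apply: (cvg_comp (harmonic : nat -> R) G); first exact: cvg_harmonic.
apply: cvgM; first exact: cvg_cst.
apply: cvgM; first exact: cvg_cst.
apply: (@continuous_comp _ _ _ (fun ep => - ((2 - q) / 2 * ln (`|k ^+ 2| + ep)) - ln (`|ep * k ^+ 2| + 1)) expR); last exact: continuous_expR.
apply: cvgB.
  apply: cvgN; apply: cvgM; first exact: cvg_cst.
  apply: (@continuous_comp _ _ _ (fun ep => `|k ^+ 2| + ep) (@ln R)).
    by apply: cvgD; [exact: cvg_cst|exact: cvg_id].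
  by apply: continuous_ln; rewrite addr0 normr_gt0 gt_eqF.
exact: c1.
Qed.

Lemma nice_dualF ep g : 0 < ep -> nice T g -> nice T (fun y s => dualF ep (g y s) : R) (n := n).
Proof.
move=> ep0 Hg; have Hg2 : nice T (fun y s => g y s ^+ 2).
  by under eq_fun => y do under eq_fun do rewrite expr2; exact: niceM.
apply: niceM => //; apply: nice_expR => //.
have -> : (fun y s => - ((2 - q) / 2 * ln (`|g y s ^+ 2| + ep)) - ln (`|ep * g y s ^+ 2| + 1)) =
  (fun y s => - ((2 - q) / 2) * ln (`|g y s ^+ 2| + ep) + (-1) * ln (`|ep * g y s ^+ 2| + 1)).
  by apply/funext => y; apply/funext => s; ring.
apply: niceD; apply: niceM; try exact: nice_cst.
  exact: nice_ln_norm.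
apply: (nice_ln_norm (g := fun y s => ep * g y s ^+ 2)) => //.
by apply: niceM => //; exact: nice_cst.
Qed.

(** With the lag at least [ep], the inverse powers of time are continuous, and in y the kernel is
    built from coordinates, sums, products and one exponential. *)
Lemma nice_Kker_max ep : 0 < ep ->
  nice T (fun y s => Kker S b c e (x - y) (Num.max (t - s) ep)).
Proof.
move=> ep0; pose m s := Num.max (t - s) ep.
have m0 s : 0 < m s by rewrite lt_max ep0 orbT.
have cm : continuous m.
  move=> s; apply: (@continuous_comp _ _ _ (fun s => t - s) (fun s => Num.max s ep)); last exact: continuous_maxr_cst.
  by apply: cvgB; [exact: cvg_cst|exact: cvg_id].
have cinv (h : R -> R) : continuous h -> (forall s, 0 < h s) -> continuous (fun s => (h s)^-1).
  by move=> ch h0 s; apply: cvgV; [rewrite gt_eqF|exact: ch].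
have cMl (k : R) (h : R -> R) : continuous h -> continuous (fun s => k * h s).
  by move=> ch s; apply: cvgM; [exact: cvg_cst|exact: ch].
have nm : nice T (fun (_ : 'cV[R]_n) s => m s) by exact: nice_time.
have nw i : nice T (fun y s => (invmx S *m (x - y + m s *: b)) i 0).
  have -> : (fun y s => (invmx S *m (x - y + m s *: b)) i 0) =
     (fun y s => \sum_j invmx S i j * ((x j 0 + (-1) * y j 0) + m s * b j 0)).
    apply/funext => y; apply/funext => s; rewrite mxE; apply: eq_bigr => j _.
    by rewrite !mxE mulN1r.
  apply: nice_sum => // j; apply: niceM; first exact: nice_cst.
  apply: niceD; last by apply: niceM => //; exact: nice_cst.
  apply: niceD; first exact: nice_cst.
  by apply: niceM; [exact: nice_cst|exact: nice_coord].
have -> : (fun y s => Kker S b c e (x - y) (m s)) = (fun y s =>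
  ((-1) * (\sum_i (invmx S *m (x - y + m s *: b)) i 0 * (invmx S *m e) i 0) * (2 * m s)^-1) *
  (expR (c * m s) / ((2 * Num.sqrt (pi * m s)) ^+ n * \det S) *
   expR ((-1) * (\sum_i (invmx S *m (x - y + m s *: b)) i 0 * (invmx S *m (x - y + m s *: b)) i 0) * (4 * m s)^-1))).
  apply/funext => y; apply/funext => s; rewrite /Kker /Gker /dotp eucl_sq !mulN1r.
  by congr (_ * (_ * expR (- _ / _))); apply: eq_bigr => i _; rewrite expr2.
apply: niceM.
  apply: niceM; last first.
    by apply: nice_time => //; apply: cinv; [exact: cMl|move=> s; rewrite mulr_gt0].
  apply: niceM; first exact: nice_cst.
  by apply: nice_sum => // i; apply: niceM => //; exact: nice_cst.
apply: niceM.
  apply: nice_time => // s; apply: cvgM.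
    apply: (@continuous_comp _ _ _ (fun s => c * m s) expR); last exact: continuous_expR.
    exact: cMl.
  apply: (cinv (fun s => (2 * Num.sqrt (pi * m s)) ^+ n * \det S)).
    move=> u; apply: cvgM; last exact: cvg_cst.
    apply: (@continuous_comp _ _ _ (fun s => 2 * Num.sqrt (pi * m s)) (fun v => v ^+ n)); last exact: exprn_continuous.
    apply: (cMl _) => {}u; apply: (@continuous_comp _ _ _ (fun s => pi * m s) Num.sqrt); last exact: sqrt_continuous.
    exact: cMl.
  move=> u; apply: mulr_gt0; last exact: posdef_det_gt0.
  by apply: exprn_gt0; apply: mulr_gt0 => //; rewrite sqrtr_gt0 mulr_gt0 ?pi_gt0.
apply: nice_expR => //; apply: niceM; last first.
  by apply: nice_time => //; apply: cinv; [exact: cMl|move=> s; rewrite mulr_gt0].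
apply: niceM; first exact: nice_cst.
by apply: nice_sum => // i; apply: niceM.
Qed.

Lemma nice_extremal ep : 0 < ep -> nice T (extremal ep).
Proof.
move=> ep0; apply: niceM.
  by apply: nice_time => //; exact: continuous_cutoff.
by apply: nice_dualF => //; exact: nice_Kker_max.
Qed.

Lemma measurable_extremal ep :
  measurable_fun setT (fun z : RnT R n * R => extremal ep (vecn z.1) z.2).
Proof.
have mts : measurable_fun setT (fun z : RnT R n * R => t - z.2) by exact: measurable_funB.
have mK : measurable_fun setT (fun z : RnT R n * R => Kker S b c e (x - vecn z.1) (Num.max (t - z.2) ep)).
  apply: measurable_Kker; last exact: measurable_maxr.
  move=> i; rewrite (_ : (fun z => _) = (fun z => x i 0 - coordn z.1 i)).
    apply: measurable_funB => //.
    exact: (measurableT_comp (measurable_coordn i) measurable_fst).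
  by apply/funext => z; rewrite !mxE.
apply: measurable_funM.
  have mc : measurable_fun [set: R] (fun s : R => cutoff ep (t - s)).
    by apply: continuous_measurable_fun; exact: continuous_cutoff.
  exact: (measurableT_comp mc measurable_snd).
have mln (g : RnT R n * R -> R) k : measurable_fun setT g -> measurable_fun setT (fun z => ln (`|g z| + k)).
  move=> mg; apply: (measurableT_comp (@measurable_ln R)); apply: measurable_funD => //.
  exact: measurableT_comp.
apply: measurable_funM => //; apply: measurableT_comp => //; apply: measurable_funB.
  apply: measurableT_comp => //; apply: measurable_funM => //.
  by apply: mln; exact: measurable_funX.
apply: mln; apply: measurable_funM => //; exact: measurable_funX.
Qed.

Lemma extremal_bounded ep y s : 0 < ep <= 1 ->
  `|extremal ep y s| <= expR (- ((2 - q) / 2 * ln ep)) / ep.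
Proof.
move=> ep01; have /andP[ep0 _] := ep01.
have /andP[c0 c1] := cutoff_bounds ep (t - s).
rewrite /extremal normrM (ger0_norm c0) -[leRHS]mul1r.
by apply: ler_pM => //; exact: dualF_bounded.
Qed.

(** At distance d <= 1 the Lipschitz bound suffices, as d <= d^al; beyond, d^al >= 1 and the
    difference is at most twice the local bound of the function. *)
Lemma extremal_holder ep al r : 0 < ep <= 1 -> 0 < al < 1 -> 0 < r ->
  exists L : R, forall y z s, eucl y <= r -> eucl z <= r -> 0 <= s <= T ->
    `|extremal ep y s - extremal ep z s| <= L * eucl (y - z) `^ al.
Proof.
move=> /andP[ep0 ep1] /andP[a0 a1] r0.
have [_ /(_ r r0)[L L0 HL]] := nice_extremal ep0.
exists (2 * L) => y z s yr zr sT.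
have [by_ ly] := HL y z s yr zr sT; have [bz _] := HL z z s zr zr sT.
have d0 := eucl_ge0 (y - z).
have [de|d00] := eqVneq (eucl (y - z)) 0.
  by apply: (le_trans ly); rewrite de mulr0 !mulr_ge0 ?powR_ge0.
have dp : 0 < eucl (y - z) by rewrite lt_neqAle eq_sym d00.
have [d1|d1] := leP (eucl (y - z)) 1.
  have h : eucl (y - z) <= eucl (y - z) `^ al by apply: ger1_powR; rewrite ?dp//= ltW.
  by apply: (le_trans ly); apply: ler_pM => //; rewrite mulr_natl mulr2n lerDl.
have h : 1 <= eucl (y - z) `^ al.
  rewrite -[leLHS](powRr0 (eucl (y - z))).
  by apply: ler_powR; exact: ltW.
move: (extremal ep y s) (extremal ep z s) by_ bz {ly} => u v bu bv.
apply: (le_trans (ler_normB _ _)); apply: (@le_trans _ _ (2 * L)); first by rewrite mulr_natl mulr2n lerD.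
by rewrite ler_peMr// mulr_ge0.
Qed.

End extremal.

(** * Differentiating the potential *)

Section differentiation.
Context (R : realType) (n : nat) (S : 'M[R]_n) (b : 'cV[R]_n) (c t : R).
Local Notation mu := (@lebesgue_measure R).
Hypothesis Spos : forall v : 'cV[R]_n, v != 0 -> 0 < (v^T *m S *m v) 0 0.
Hypothesis t0 : 0 < t.

Lemma eucl_sq_addZ m (u v : 'cV[R]_m) (a : R) :
  eucl (u + a *: v) ^+ 2 = eucl u ^+ 2 + 2 * a * dotp u v + a ^+ 2 * eucl v ^+ 2.
Proof.
rewrite !eucl_sq /dotp !mulr_sumr -!big_split /=; apply: eq_bigr => i _.
by rewrite !mxE; ring.
Qed.

Lemma dotp_addZ m (u v : 'cV[R]_m) (a : R) :
  dotp (u + a *: v) v = dotp u v + a * eucl v ^+ 2.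
Proof.
rewrite eucl_sq /dotp mulr_sumr -big_split /=; apply: eq_bigr => i _.
by rewrite !mxE; ring.
Qed.

Lemma normr_dotp_le m (u v : 'cV[R]_m) :
  `|dotp u v| <= (eucl u ^+ 2 + eucl v ^+ 2) / 2.
Proof.
have h1 := sqr_ge0 (eucl (u + 1 *: v)); have h2 := sqr_ge0 (eucl (u + (-1) *: v)).
rewrite !eucl_sq_addZ in h1 h2.
by rewrite ler_norml; apply/andP; split; lra.
Qed.

Let C0 (s : R) : R := expR (c * s) / ((2 * Num.sqrt (pi * s)) ^+ n * \det S).

Let C0_ge0 s : 0 <= C0 s.
Proof.
apply: mulr_ge0; first exact: expR_ge0.
rewrite invr_ge0; apply: mulr_ge0; last exact/ltW/posdef_det_gt0.
by apply: exprn_ge0; apply: mulr_ge0 => //; exact: sqrtr_ge0.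
Qed.

Let line (v e : 'cV[R]_n) (s h : R) :
  invmx S *m (v + h *: e + s *: b) = invmx S *m (v + s *: b) + h *: (invmx S *m e).
Proof. by rewrite addrAC mulmxDr -scalemxAr. Qed.

Lemma is_derive_Gker (v e : 'cV[R]_n) (s h : R) : s != 0 ->
  is_derive h 1 (fun h => Gker S b c (v + h *: e) s) (Kker S b c e (v + h *: e) s).
Proof.
move=> s0; set w := invmx S *m (v + s *: b); set m := invmx S *m e.
pose g (h : R) : R := - (eucl w ^+ 2 + 2 * h * dotp w m + h ^+ 2 * eucl m ^+ 2) / (4 * s).
have -> : (fun h => Gker S b c (v + h *: e) s) = (fun h => C0 s * expR (g h)).
  by apply/funext => h'; rewrite /Gker line eucl_sq_addZ.
have -> : Kker S b c e (v + h *: e) s =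
    C0 s * (expR (g h) * (- (2 * dotp w m + 2 * h * eucl m ^+ 2) / (4 * s))).
  rewrite /Kker /Gker line eucl_sq_addZ dotp_addZ -/w -/m -/(g h) -/(C0 s).
  by field.
have Hg : is_derive h 1 g (- (2 * dotp w m + 2 * h * eucl m ^+ 2) / (4 * s)).
  have -> : g = (fun h => (- (4 * s)^-1) * (eucl w ^+ 2) + (- (4 * s)^-1 * 2 * dotp w m) * h +
     (- (4 * s)^-1 * eucl m ^+ 2) * (h * h)).
    by apply/funext => h'; rewrite /g; ring.
  by apply: is_derive_eq; rewrite /GRing.scale /=; field.
have He := @is_derive1_comp R expR g h _ _ (is_derive_expR (g h)) Hg.
have := is_deriveZ (C0 s) He.
by [].
Qed.

Lemma integral_Gker (x : 'cV[R]_n) (s : R) : 0 < s ->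
  (\int[lebn R n]_y (Gker S b c (x - vecn y) s)%:E = (expR (c * s))%:E)%E.
Proof.
move=> s0; have D0 := posdef_det_gt0 Spos.
pose k := (4 * s)^-1; have k0 : 0 < k by rewrite invr_gt0 mulr_gt0.
pose g (z : RnT R n) : R := expR (- (k * \sum_(i < n) coordn z i ^+ 2)).
have mg : measurable_fun setT g.
  apply: measurableT_comp => //; apply: measurableT_comp => //; apply: measurable_funM => //.
  by apply: measurable_sum => i; apply: measurable_funX; exact: measurable_coordn.
have g0 z : 0 <= g z by exact: expR_ge0.
have E v : Gker S b c v s = C0 s * g (ptv (invmx S *m (v + s *: b))).
  have -> : g (ptv (invmx S *m (v + s *: b))) = expR (- (k * eucl (invmx S *m (v + s *: b)) ^+ 2)).
    by rewrite /g eucl_sq; congr (expR (- (_ * _))); apply: eq_bigr => i _; rewrite coordn_ptv.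
  by rewrite /Gker -/(C0 s) mulrC [RHS]mulrC; congr (expR _ * _); rewrite /k; ring.
under eq_integral do rewrite E.
rewrite ge0_integralZl_real; [|by []| |by move=> y; exact: g0|exact: C0_ge0]; last first.
  apply: (measurableT_comp mg); apply: measurable_ptv; apply: measurable_mulmx => i.
  rewrite (_ : (fun y => _) = (fun y => x i 0 - coordn y i + s * b i 0)).
    apply: measurable_funD => //; apply: measurable_funB => //; exact: measurable_coordn.
  by apply/funext => y; rewrite !mxE.
rewrite (ge0_integral_affine_vecn b Spos x s mg g0).
have cc0 : 0 < Num.sqrt (pi / k) by rewrite sqrtr_gt0 divr_gt0// pi_gt0.
(* The choice a = 0, phi = 1 yields the total mass of the Gaussian. *)
have := @integral_lebn_gauss R n k (fun=> 0) (fun=> 1) k0 (measurable_cst _) (fun=> ler01).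
under eq_integral do rewrite mul1r.
under [in RHS]eq_integral do rewrite mul1r -[X in k * X ^+ 2]subr0.
rewrite integral_expR_sq// => H.
have -> : (\int[lebn R n]_z (g z)%:E = (Num.sqrt (pi / k) ^+ n)%:E)%E.
  have -> : (\int[lebn R n]_z (g z)%:E = ((Num.sqrt (pi / k))^-1%:E *
      ((Num.sqrt (pi / k))%:E * \int[lebn R n]_z (g z)%:E)))%E.
    by rewrite muleA -EFinM mulVf ?mul1e// gt_eqF.
  by rewrite H -!EFinM; congr EFin; rewrite mulrCA mulVf ?mulr1// gt_eqF.
rewrite -!EFinM; congr EFin.
have -> : Num.sqrt (pi / k) = 2 * Num.sqrt (pi * s).
  rewrite /k invrK mulrCA sqrtrM// -{1}[4](_ : 2 ^+ 2 = _) ?sqrtr_sqr ?ger0_norm//; ring.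
have p0 : 0 < (2 * Num.sqrt (pi * s)) ^+ n.
  by apply: exprn_gt0; apply: mulr_gt0 => //; rewrite sqrtr_gt0 mulr_gt0 ?pi_gt0.
by rewrite /C0; field; rewrite !gt_eqF.
Qed.

Lemma Gker_ge0 v s : 0 <= Gker S b c v s.
Proof. by apply: mulr_ge0; [exact: C0_ge0|exact: expR_ge0]. Qed.

Lemma measurable_sub_vecn1 (x : 'cV[R]_n) i :
  measurable_fun setT (fun y : RnT R n => (x - vecn y) i 0).
Proof.
rewrite (_ : (fun z => _) = (fun z => x i 0 - coordn z i)).
  by apply: measurable_funB => //; exact: measurable_coordn.
by apply/funext => z; rewrite !mxE.
Qed.

Lemma integrable_mul_bounded d (T : measurableType d) (nu : {measure set T -> \bar R})
    (g f : T -> R) (M : R) :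
  nu.-integrable setT (EFin \o g) -> measurable_fun setT f -> (forall z, `|f z| <= M) ->
  nu.-integrable setT (fun z => (g z * f z)%:E).
Proof.
move=> ig mf fM.
have mg : measurable_fun setT g by apply/measurable_EFinP; exact: measurable_int ig.
have igM : nu.-integrable setT (fun z => (M%:E * (g z)%:E)%E) by exact: integrableZl.
apply: (le_integrable measurableT _ _ igM).
  by apply/measurable_EFinP; exact: measurable_funM.
move=> z _ /=; rewrite lee_fin !normrM mulrC; apply: ler_wpM2r => //.
exact: le_trans (fM z) (ler_norm _).
Qed.

Lemma integrable_Gker (x : 'cV[R]_n) (s : R) : 0 < s ->
  (lebn R n).-integrable setT (fun y => (Gker S b c (x - vecn y) s)%:E).
Proof.
move=> s0; apply/integrableP; split.
  apply/measurable_EFinP; apply: measurable_Gker => //; exact: measurable_sub_vecn1.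
under eq_integral do rewrite gee0_abs ?lee_fin ?Gker_ge0//.
by rewrite integral_Gker// ltry.
Qed.

(** A majorant independent of h for |h - h0| <= 1: a wider Gaussian centred as at h0. Half of the
    exponent absorbs the linear factor of the kernel; the other half, once moved from h to h0,
    decays at the rate 1/(16 s). *)
Lemma Kker_dominated (v e : 'cV[R]_n) (s h h0 : R) : 0 < s -> `|h - h0| <= 1 ->
  `|Kker S b c e (v + h *: e) s| <=
  (C0 s / (2 * s) * (4 * s + eucl (invmx S *m e) ^+ 2 / 2) *
    expR (eucl (invmx S *m e) ^+ 2 / (8 * s))) *
  expR (- eucl (invmx S *m (v + h0 *: e + s *: b)) ^+ 2 / (16 * s)).
Proof.
move=> s0 hh.
set m := invmx S *m e; set w := invmx S *m (v + h0 *: e + s *: b).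
pose d := h - h0.
have E : invmx S *m (v + h *: e + s *: b) = w + d *: m.
  have dE : h0 + d = h by rewrite /d; ring.
  by rewrite /w !line -addrA -scalerDl dE.
rewrite /Kker /Gker E -/m -/(C0 s).
set u := w + d *: m; set Dh := eucl u ^+ 2; set D := eucl w ^+ 2; set C := eucl m ^+ 2.
set Bh := dotp u m.
have Cge : 0 <= C by exact: sqr_ge0.
have Dge : 0 <= Dh by exact: sqr_ge0.
have d2 : d ^+ 2 <= 1 by rewrite -real_normK ?num_real// expr_le1.
(* Expanding |w + 2 d m|^2 >= 0 controls the cross term in |w + d m|^2, and d^2 <= 1. *)
have HD : D / 2 - C <= Dh.
  have := sqr_ge0 (eucl (w + (2 * d) *: m)).
  rewrite /Dh /u !eucl_sq_addZ -/D -/C; nra.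
have HB : `|Bh| <= (Dh + C) / 2 by exact: normr_dotp_le.
clearbody Bh Dh D C.
(* Half of the exponent: Dh is a multiple of X, and X <= exp X is paid for by one of the two factors
   exp(-X). *)
pose X := Dh / (8 * s).
have X0 : 0 <= X by apply: divr_ge0 => //; rewrite mulr_ge0// ltW.
have -> : - Dh / (4 * s) = - X - X by rewrite /X; field; rewrite gt_eqF.
have Xe : X <= expR X by have := expR_ge1Dx X; lra.
have DX : Dh / 2 = 4 * s * X by rewrite /X; field; rewrite gt_eqF.
have k0 : 0 <= C0 s / (2 * s) by apply: divr_ge0; [exact: C0_ge0|rewrite mulr_ge0// ltW].
rewrite normrM (normrM _ (2 * s)^-1) normrN (normrM (C0 s)).
rewrite (ger0_norm (C0_ge0 s)) (ger0_norm (expR_ge0 _)) (@ger0_norm _ (2 * s)^-1); last first.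
  by rewrite invr_ge0 mulr_ge0// ltW.
have -> : `|Bh| / (2 * s) * (C0 s * expR (- X - X)) = C0 s / (2 * s) * (`|Bh| * expR (- X - X)) by ring.
rewrite -(mulrA (C0 s / (2 * s))) -(mulrA (C0 s / (2 * s))); apply: ler_wpM2l => //.
have eX : expR (- X - X) * expR X = expR (- X) by rewrite -expRD; congr expR; ring.
have eXX : expR (- X - X) <= expR (- X) by rewrite ler_expR; lra.
apply: (@le_trans _ _ ((4 * s + C / 2) * expR (- X))).
  have P : 0 <= expR (- X - X) := expR_ge0 _.
  apply: (@le_trans _ _ ((4 * s * expR X + C / 2) * expR (- X - X))).
    apply: ler_wpM2r => //; apply: (le_trans HB); rewrite mulrDl DX lerD2r.
    by apply: ler_wpM2l => //; rewrite mulr_ge0// ltW.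
  set Y := expR (- X - X) in P eX eXX *.
  have -> : (4 * s * expR X + C / 2) * Y = 4 * s * (Y * expR X) + C / 2 * Y by ring.
  rewrite eX [leRHS]mulrDl lerD2l.
  by apply: ler_wpM2l => //; rewrite divr_ge0.
rewrite -[leRHS]mulrA; apply: ler_wpM2l; first by rewrite addr_ge0 ?divr_ge0// mulr_ge0// ltW.
rewrite -expRD ler_expR.
have -> : C / (8 * s) + - D / (16 * s) = - ((D / 2 - C) / (8 * s)) by field; rewrite gt_eqF.
by rewrite lerN2 /X ler_wpM2r// invr_ge0 mulr_ge0// ltW.
Qed.

(** As 16 s = 4 (4 s), this Gaussian is a multiple of the kernel itself at time 4 s, with the point
    translated along b to keep the same centre. *)
Lemma integrable_gauss (x : 'cV[R]_n) (s : R) : 0 < s ->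
  (lebn R n).-integrable setT
    (fun y => (expR (- eucl (invmx S *m (x - vecn y + s *: b)) ^+ 2 / (16 * s)))%:E).
Proof.
move=> s0; pose s4 := 4 * s; have s40 : 0 < s4 by rewrite mulr_gt0.
pose b' := 4^-1 *: b.
have D0 := posdef_det_gt0 Spos.
pose k := expR (c * s4) / ((2 * Num.sqrt (pi * s4)) ^+ n * \det S).
have k0 : 0 < k.
  apply: divr_gt0; first exact: expR_gt0.
  apply: mulr_gt0 => //; apply: exprn_gt0; apply: mulr_gt0 => //.
  by rewrite sqrtr_gt0 mulr_gt0 ?pi_gt0.
have E y : expR (- eucl (invmx S *m (x - vecn y + s *: b)) ^+ 2 / (16 * s)) =
    k^-1 * Gker S b c (x + (s - s4) *: b - vecn y) s4.
  rewrite /Gker -/k mulrA mulVf ?gt_eqF// mul1r; congr expR.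
  have -> : x + (s - s4) *: b - vecn y + s4 *: b = x - vecn y + s *: b.
    by apply/colP => i; rewrite !mxE; ring.
  by congr (_ / _); rewrite /s4; ring.
rewrite (_ : (fun y => _) =
    (fun y => ((k^-1)%:E * (Gker S b c (x + (s - s4) *: b - vecn y) s4)%:E)%E)); last first.
  by apply/funext => y; rewrite E.
by apply: integrableZl => //; exact: integrable_Gker.
Qed.

Lemma is_derive_integral_Gker (x e : 'cV[R]_n) (s : R) (f : RnT R n -> R) (M h0 : R) : 0 < s ->
  measurable_fun setT f -> (forall y, `|f y| <= M) ->
  let V h := Rintegral (lebn R n) setT (fun y => Gker S b c (x + h *: e - vecn y) s * f y) in
  is_derive h0 1 V
    (Rintegral (lebn R n) setT (fun y => Kker S b c e (x + h0 *: e - vecn y) s * f y)).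
Proof.
move=> s0 mf fM V.
have M0 : 0 <= M by exact: le_trans (normr_ge0 _) (fM point).
have sn0 : s != 0 by rewrite gt_eqF.
pose f1 (h : R) (y : RnT R n) := Gker S b c (x + h *: e - vecn y) s * f y.
have df (h : R) (y : RnT R n) : is_derive h 1 (f1 ^~ y) (Kker S b c e (x + h *: e - vecn y) s * f y).
  have := is_derive_Gker (x - vecn y) e h sn0.
  have -> : (fun h0 : R => Gker S b c (x - vecn y + h0 *: e) s) = (fun h => Gker S b c (x + h *: e - vecn y) s).
    by apply/funext => h'; rewrite addrAC.
  rewrite addrAC => H; have := is_deriveZ (f y) H.
  have -> : f y \*: (fun h => Gker S b c (x + h *: e - vecn y) s) = f1 ^~ y.
    by apply/funext => h' /=; rewrite /f1 mulrC.
  by rewrite /GRing.scale /= mulrC.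
have Ih0 : `]h0 - 1, h0 + 1[%classic h0 by rewrite /= in_itv /= ltrBlDr ltrDl ltr01.
pose Kd := (C0 s / (2 * s) * (4 * s + eucl (invmx S *m e) ^+ 2 / 2) *
    expR (eucl (invmx S *m e) ^+ 2 / (8 * s))).
have Kd0 : 0 <= Kd.
  apply: mulr_ge0; last exact: expR_ge0.
  apply: mulr_ge0; first by apply: divr_ge0; [exact: C0_ge0|rewrite mulr_ge0// ltW].
  by rewrite addr_ge0 ?divr_ge0 ?sqr_ge0// mulr_ge0// ltW.
pose Gd (y : RnT R n) := M * Kd * expR (- eucl (invmx S *m (x + h0 *: e - vecn y + s *: b)) ^+ 2 / (16 * s)).
have H1 h : (lebn R n).-integrable setT (EFin \o f1 h).
  by apply: (integrable_mul_bounded _ mf fM); exact: integrable_Gker.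
have H2 (h : R) y : `]h0 - 1, h0 + 1[%classic h -> setT y -> derivable (f1 ^~ y) h 1.
  by move=> _ _; have [] := df h y.
have H3 y : 0 <= Gd y by apply: mulr_ge0; [exact: mulr_ge0|exact: expR_ge0].
have H4 : (lebn R n).-integrable setT (EFin \o Gd).
  have -> : EFin \o Gd = (fun y => ((M * Kd)%:E * (expR (- eucl (invmx S *m (x + h0 *: e - vecn y + s *: b)) ^+ 2 / (16 * s)))%:E)%E) by [].
  by apply: integrableZl => //; exact: integrable_gauss.
have H5 (h : R) y : `]h0 - 1, h0 + 1[%classic h -> setT y -> `|partial1of2 f1 h y| <= Gd y.
  rewrite /= in_itv /= => /andP[hl hr] _.
  rewrite partial1of2E; have [_ ->] := df h y.
  rewrite normrM mulrC /Gd -mulrA; apply: ler_pM => //.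
  have := @Kker_dominated (x - vecn y) e s h h0 s0.
  rewrite ![x - vecn y + _ *: e]addrAC; apply.
  by rewrite ler_norml; apply/andP; split; lra.
have e1 := @derivable_under_integral R _ _ (lebn R n) f1 setT measurableT h0 _ _ Ih0
  (fun h _ => H1 h) H2 Gd H3 H4 H5.
have e2 := @differentiation_under_integral R _ _ (lebn R n) f1 setT measurableT h0 _ _ Ih0
  (fun h _ => H1 h) H2 Gd H3 H4 H5.
apply: DeriveDef; first exact: e1.
rewrite -derive1E e2; apply: eq_Rintegral => y _; rewrite partial1of2E.
by have [_ ->] := df h0 y.
Qed.

Definition GT (x : 'cV[R]_n) (z : RnT R n * R) : R :=
  if 0 < z.2 < t then Gker S b c (x - vecn z.1) (t - z.2) else 0.

Lemma measurable_GT x : measurable_fun setT (GT x).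
Proof.
apply: measurable_fun_ifT => //; first exact: measurable_strip_bool.
apply: measurable_Gker; first exact: measurable_sub_vecn.
exact: measurable_funB.
Qed.

Lemma integrable_GT x : (lebnt R n).-integrable setT (EFin \o GT x).
Proof.
have mG : measurable_fun setT (EFin \o GT x) by apply/measurable_EFinP; exact: measurable_GT.
apply/(@integrable21ltyP _ _ _ _ _ (slebn R n) mu _ mG).
apply: (@le_lt_trans _ _ (\int[mu]_(r in `]0%R, t[) (expR (`|c| * t))%:E)%E).
  rewrite [leRHS]integral_mkcond.
  have aG : measurable_fun setT (fun z => `|(GT x z)%:E|%E) by exact: measurableT_comp.
  apply: ge0_le_integral => //.
  - by move=> r _; apply: integral_ge0.
  - exact: (@measurable_fun_fubini_tonelli_G _ _ _ _ _ (slebn R n) _ aG (fun _ => abse_ge0 _)).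
  - apply/(measurable_restrictT _ _).1 => //.
  move=> r _; rewrite patchE mem_setE in_itv /= /GT /=.
  case: ifPn => [/andP[r0 rt]|_]; last by under eq_integral do rewrite normr0; rewrite integral0.
  under eq_integral do rewrite ger0_norm ?Gker_ge0//.
  rewrite integral_Gker ?subr_gt0// lee_fin ler_expR (le_trans (ler_norm _))// normrM.
  by apply: ler_wpM2l => //; rewrite ger0_norm ?subr_ge0 ?(ltW rt)// gerBl ltW.
by rewrite integral_cst//= lebesgue_measure_itv /= lte_fin t0 sube0 -EFinM ltry.
Qed.

Lemma integrable_KT e x : (lebnt R n).-integrable setT (EFin \o KT S b c t e x).
Proof.
apply/integrableP; split; first by apply/measurable_EFinP; exact: measurable_KT.
(* The norm computation at q = 1, where the time weight has exponent 1/2. *)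
have := @integral_KT_powR R n S b c t Spos t0 e x 1.
rewrite subrr mulr0 add0r ltr_pdivrMr// mul1r ltr1n lexx ler1n => /(_ isT isT).
under eq_integral do rewrite powRr1//.
by move=> /= ->; rewrite ltry.
Qed.

(** The value is independent of x, so one majorant in time serves all the points x + h e. *)
Lemma integral_normr_Kker (e x : 'cV[R]_n) (s : R) : 0 < s ->
  (\int[lebn R n]_y `|(Kker S b c e (x - vecn y) s)%:E| =
   (eucl (invmx S *m e) `^ 1 * kcst S 1 * wt n c 1 s * Gamma ((1 + 1) / 2))%:E)%E.
Proof.
move=> s0; rewrite EFinM -gammaeE ?lexx ?ler1n//.
rewrite -(@integral_Kker_powR R n S b c Spos e x 1 s (lexx _) s0).
by apply: eq_integral => y _; rewrite powRr1.
Qed.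

Section bounded_source.
Context (F : RnT R n * R -> R) (M : R) (e x : 'cV[R]_n).
Hypothesis mF : measurable_fun setT F.
Hypothesis FM : forall z, `|F z| <= M.

(* The derivatives of the Gaussian blow up like (t - s)^(-(n+1)/2) near the
   diagonal, so no integrable majorant in (y, s) is uniform in [h]; differentiating
   under the y-integral at fixed s, then under the s-integral, works because the
   L^1 norm in y of the differentiated kernel is of order (t - s)^(-1/2) only. *)
Lemma potential_derivative :
  let Phi h := Rintegral (lebnt R n) setT (fun z => GT (x + h *: e) z * F z) in
  h^-1 *: (Phi h - Phi 0) @[h --> 0^'] -->
    Rintegral (lebnt R n) setT (fun z => KT S b c t e x z * F z).
Proof.
move=> Phi.
have M0 : 0 <= M by exact: le_trans (normr_ge0 _) (FM point).
have mFr r : measurable_fun setT (fun y => F (y, r)).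
  by apply: (measurableT_comp mF); exact: measurable_pair2.
pose f2 (h r : R) : R := Rintegral (lebn R n) setT (fun y => GT (x + h *: e) (y, r) * F (y, r)).
pose K2 (h r : R) : R := Rintegral (lebn R n) setT (fun y => KT S b c t e (x + h *: e) (y, r) * F (y, r)).
have iG h := integrable_mul_bounded (integrable_GT (x + h *: e)) mF FM.
have iK := integrable_mul_bounded (integrable_KT e x) mF FM.
(* Outside the strip both integrands are 0, so this holds at every time r, as differentiation under
   the integral over the whole line requires. *)
have df2 (r h : R) : is_derive h 1 (f2 ^~ r) (K2 h r).
  rewrite /f2 /K2 /GT /KT /=; case: (boolP (0 < r < t)) => [/andP[r0 rt]|_] /=.
    have tr0 : 0 < t - r by rewrite subr_gt0.
    exact: (@is_derive_integral_Gker x e (t - r) (fun y => F (y, r)) M h tr0 (mFr r) (fun y => FM _)).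
  under eq_fun do under eq_Rintegral do rewrite mul0r.
  under [X in is_derive _ _ _ X]eq_Rintegral do rewrite mul0r.
  rewrite {2}/Rintegral integral0 /=; exact: is_derive_cst.
pose Kint (r : R) : \bar R := (\int[lebn R n]_y `|(KT S b c t e x (y, r))%:E|)%E.
(* Moving x along e does not change the spatial L^1 norm; hence [M * fine (Kint r)] majorizes the
   derivative at every h. *)
have KintE h r : (\int[lebn R n]_y `|(KT S b c t e (x + h *: e) (y, r))%:E| = Kint r)%E.
  rewrite /Kint /KT /=; case: (boolP (0 < r < t)) => [/andP[r0 rt]|_] /=; last reflexivity.
  have tr0 : 0 < t - r by rewrite subr_gt0.
  exact: etrans (integral_normr_Kker e (x + h *: e) tr0) (esym (integral_normr_Kker e x tr0)).
have mabs : measurable_fun setT (fun z => `|(KT S b c t e x z)%:E|%E).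
  by apply: measurableT_comp => //; apply/measurable_EFinP; exact: measurable_KT.
have Kint0 r : (0 <= Kint r)%E by exact: integral_ge0.
have mKint : measurable_fun [set: R] Kint.
  exact: (@measurable_fun_fubini_tonelli_G _ _ _ _ _ (slebn R n) _ mabs (fun _ => abse_ge0 _)).
have Kint_lty r : (Kint r < +oo)%E.
  rewrite /Kint /KT /=; case: (boolP (0 < r < t)) => [/andP[r0 rt]|_] /=; last by under eq_integral do rewrite normr0; rewrite integral0.
  have tr0 : 0 < t - r by rewrite subr_gt0.
  by rewrite integral_normr_Kker// ltry.
have KintF r : Kint r = (fine (Kint r))%:E by rewrite fineK// ge0_fin_numE.
have iKint : mu.-integrable setT (fun r => (M * fine (Kint r))%:E).
  under eq_fun do rewrite EFinM -KintF.
  apply: integrableZl => //; apply/integrableP; split => //.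
  under eq_integral do rewrite gee0_abs//.
  rewrite -(@fubini_tonelli2 _ _ _ _ _ (slebn R n) mu _ mabs (fun _ => abse_ge0 _)).
  by have /integrableP[] := integrable_KT e x.
have I0 : `]-1, 1[%classic (0 : R) by rewrite /= in_itv /= ltrN10 ltr01.
have iGr h r : (lebn R n).-integrable setT (fun y => (GT (x + h *: e) (y, r) * F (y, r))%:E).
  rewrite /GT /=; case: (boolP (0 < r < t)) => [/andP[r0 rt]|_] /=; last first.
    rewrite (_ : (fun y => _) = cst 0%E); first exact: integrable0.
    by apply/funext => y; rewrite mul0r.
  have tr0 : 0 < t - r by rewrite subr_gt0.
  exact: (integrable_mul_bounded (integrable_Gker _ tr0) (mFr r) (fun y => FM _)).
have f2E h : EFin \o f2 h = fubini_G (slebn R n) (fun z => (GT (x + h *: e) z * F z)%:E).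
  apply/funext => r; rewrite /fubini_G /f2 /Rintegral /= fineK//.
  by apply: integrable_fin_num => //; exact: iGr.
have H1 h : mu.-integrable setT (EFin \o f2 h).
  rewrite f2E; have mf2 := @measurable_fubini_G _ _ _ _ _ (slebn R n) mu _ (iG h).
  have mg := measurable_int _ (iG h).
  apply/integrableP; split; first exact: mf2.
  apply: le_lt_trans ((@integrable21ltyP _ _ _ _ _ (slebn R n) mu _ mg).1 (iG h)).
  apply: ge0_le_integral => //.
  - exact: measurableT_comp.
  - apply: (@measurable_fun_fubini_tonelli_G _ _ _ _ _ (slebn R n) _ (measurableT_comp (@abse_measurable R _) mg)).
    by move=> z; exact: abse_ge0.
  - by move=> r _; apply: le_abse_integral => //; exact: measurable_int (iGr h r).
have iKr h r : (lebn R n).-integrable setT (EFin \o (fun y => KT S b c t e (x + h *: e) (y, r))).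
  apply/integrableP; split.
    apply/measurable_EFinP; apply: (measurableT_comp (measurable_KT _ _ _ _ _ _)).
    exact: measurable_pair2.
  by rewrite KintE.
have iKFr h r := integrable_mul_bounded (iKr h r) (mFr r) (fun y => FM _).
have H2 (h : R) r : `]-1, 1[%classic h -> setT r -> derivable (f2 ^~ r) h 1.
  by move=> _ _; have [] := df2 r h.
have H3 (r : R) : 0 <= M * fine (Kint r) by rewrite mulr_ge0// fine_ge0.
have H5 (h : R) r : `]-1, 1[%classic h -> setT r -> `|partial1of2 f2 h r| <= M * fine (Kint r).
  move=> _ _; rewrite partial1of2E; have [_ ->] := df2 r h.
  apply: (le_trans (le_normr_Rintegral measurableT (iKFr h r))).
  rewrite -lee_fin EFinM -KintF -(KintE h r).
  have -> : (Rintegral (lebn R n) setT (fun y => `|KT S b c t e (x + h *: e) (y, r) * F (y, r)|))%:E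
     = (\int[lebn R n]_y `|KT S b c t e (x + h *: e) (y, r) * F (y, r)|%:E)%E.
    rewrite /Rintegral fineK//; apply: integrable_fin_num => //.
    exact: (integrable_abse (iKFr h r)).
  rewrite -ge0_integralZl_EFin//; last first.
    by apply: measurableT_comp => //; exact: measurable_int (iKr h r).
  apply: ge0_le_integral => //.
  - by apply: measurable_int (integrable_abse (iKFr h r)).
  - apply: measurable_funeM; apply: measurableT_comp => //; exact: measurable_int (iKr h r).
  - by move=> y _; rewrite lee_fin normrM mulrC; apply: ler_wpM2r.
have L := @cvg_differentiation_under_integral R _ _ mu f2 setT measurableT 0 _ _ I0
  (fun h _ => H1 h) H2 _ H3 iKint H5.
have PhiE h : Phi h = Rintegral mu setT (f2 h).
  rewrite /Phi /Rintegral -(@integral21_prod_meas1 _ _ _ _ _ (slebn R n) mu _ (iG h)).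
  by congr fine; apply: eq_integral => r _; rewrite -[RHS]/((EFin \o f2 h) r) f2E.
have -> : Rintegral (lebnt R n) setT (fun z => KT S b c t e x z * F z) =
    Rintegral mu setT (fun r => partial1of2 f2 0 r).
  rewrite /Rintegral -(@integral21_prod_meas1 _ _ _ _ _ (slebn R n) mu _ iK).
  congr fine; apply: eq_integral => r _; rewrite partial1of2E; have [_ ->] := df2 r 0.
  rewrite /fubini_G /K2 /Rintegral fineK; last by apply: integrable_fin_num => //; exact: iKFr.
  by rewrite scale0r addr0.
under eq_fun do rewrite !PhiE -[X in f2 X]addr0.
exact: L.
Qed.

End bounded_source.

End differentiation.

(** This is the total mass of the exponential law of rate 1. *)
Lemma Gamma1 (R : realType) : Gamma 1 = 1 :> R.
Proof.
rewrite /Gamma (_ : (\int[_]_(y in _) _ = 1)%E)//.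
rewrite integral_itv_obnd_cbnd; last first.
  apply/measurable_EFinP/measurable_funTS; apply: measurable_funM.
    exact: measurable_powR.
  exact: measurableT_comp.
rewrite -(@integral_exponential_pdf R 1 ltr01) integral_mkcond.
apply: eq_integral => y _; rewrite /exponential_pdf !patchE.
by case: ifP => // _; rewrite subrr powRr0 !mul1r mulN1r.
Qed.

(** * Unit vectors and the spectral norm *)

Section spectral_norm.
Context (R : realType) (n : nat).

Lemma has_sup_eucl_mulmx (B : 'M[R]_n) (l : 'cV[R]_n) : eucl l = 1 ->
  has_sup [set eucl (B *m l) | l in [set l : 'cV[R]_n | eucl l = 1]].
Proof.
move=> l1; split; first by exists (eucl (B *m l)); exists l.
(* The coordinates of a unit vector are at most 1 in absolute value, so row i contributes at most
   the sum of its absolute entries. *)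
exists (Num.sqrt (\sum_i (\sum_j `|B i j|) ^+ 2)) => _ [v /= v1 <-].
rewrite ler_sqrt; last by apply: sumr_ge0 => i _; exact: sqr_ge0.
apply: ler_sum => i _; rewrite -[leLHS]real_normK ?num_real//.
rewrite ler_pXn2r ?nnegrE ?sumr_ge0// mxE.
apply: (le_trans (ler_norm_sum _ _ _)); apply: ler_sum => j _.
by rewrite normrM ler_piMr// -v1 normr_le_eucl.
Qed.

Lemma sup_scale (E : set R) (k : R) : has_sup E -> 0 < k ->
  sup [set x * k | x in E] = sup E * k.
Proof.
move=> [E0 Eub] k0; have Eub' : has_sup E by [].
have h2 : has_sup [set x * k | x in E].
  split; first by case: E0 => x Ex; exists (x * k); exists x.
  exists (sup E * k) => _ [x Ex <-]; rewrite ler_pM2r//.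
  exact: ub_le_sup.
apply/eqP; rewrite eq_le; apply/andP; split.
  apply: ge_sup; first exact: h2.1.
  by move=> _ [x Ex <-]; rewrite ler_pM2r//; exact: ub_le_sup.
rewrite -ler_pdivlMr//; apply: ge_sup => // x Ex.
by rewrite ler_pdivlMr//; apply: ub_le_sup; [exact: h2.2|exists x].
Qed.

(** The vector u - (u, l) l has squared length |u|^2 - (u, l)^2, which is nonnegative. *)
Lemma normr_dotp_unit (u l : 'cV[R]_n) : eucl l = 1 -> `|dotp u l| <= eucl u.
Proof.
move=> l1; have := sqr_ge0 (eucl (u + (- dotp u l) *: l)).
rewrite eucl_sq_addZ l1 expr1n => h.
rewrite -ler_sqr ?nnegrE ?eucl_ge0// real_normK ?num_real//; nra.
Qed.

(** The direction in which the derivative attains the length of the gradient. *)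
Lemma eucl_unit_scale (u : 'cV[R]_n) : 0 < eucl u ->
  eucl ((eucl u)^-1 *: u) = 1 /\ dotp u ((eucl u)^-1 *: u) = eucl u.
Proof.
move=> u0; have un : eucl u != 0 by rewrite gt_eqF.
have d : dotp u ((eucl u)^-1 *: u) = eucl u.
  have -> : dotp u ((eucl u)^-1 *: u) = (eucl u)^-1 * eucl u ^+ 2.
    by rewrite eucl_sq mulr_sumr; apply: eq_bigr => i _; rewrite !mxE; ring.
  by rewrite expr2 mulKf.
split=> //; apply/eqP; rewrite -(@eqrXn2 _ 2%N)// ?eucl_ge0// expr1n eucl_sq.
apply/eqP; have -> : \sum_(i < n) ((eucl u)^-1 *: u) i 0 ^+ 2 = (eucl u)^-1 ^+ 2 * eucl u ^+ 2.
  by rewrite eucl_sq mulr_sumr; apply: eq_bigr => i _; rewrite !mxE; ring.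
by rewrite -exprMn mulVf ?expr1n.
Qed.

End spectral_norm.

(** * Sharp constants for the directional derivative and the gradient *)

Section main.
Context (R : realType) (n : nat) (T : R) (S : 'M[R]_n) (b : 'cV[R]_n) (c alpha : R)
  (p : \bar R) (x : 'cV[R]_n) (t : R).
Hypothesis Spos : forall v : 'cV[R]_n, v != 0 -> 0 < (v^T *m S *m v) 0 0.
Hypothesis al01 : 0 < alpha < 1.
Hypothesis hp : ((n + 2)%:R%:E < p)%E.
Hypothesis tT : 0 < t < T.

Let t0 : 0 < t. Proof. by case/andP: tT. Qed.
Let ltT : t < T. Proof. by case/andP: tT. Qed.
Let T0 : 0 < T. Proof. exact: lt_trans ltT. Qed.
Let p1 : (1 < p)%E.
Proof. by apply: le_lt_trans hp; rewrite lee_fin ler1n addn2. Qed.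
Let muT := lebnt_setT_gt0 R n.
Let q12 : 1 <= pconj p <= 2. Proof. by have [] := pconj_bounds hp. Qed.
Let be1 : (n%:R * (pconj p - 1) + pconj p) / 2 < 1. Proof. by have [] := pconj_bounds hp. Qed.

Let P := @fclass R n T alpha p.
Let U f := fun y => usol S b c f y t.

Definition cut (s : R) (f : 'cV[R]_n -> R -> R) (z : RnT R n * R) : R :=
  if 0 < z.2 < s then f (vecn z.1) z.2 else 0.

Let J f e := Rintegral (lebnt R n) setT (fun z => KT S b c t e x z * cut t f z).

Lemma measurable_cut f : P f -> measurable_fun setT (cut t f).
Proof.
move=> [mf _ _ _ _].
have mft : measurable_fun [set z : RnT R n * R | 0 < z.2 < t] (fun z => f (vecn z.1) z.2).
  apply: (measurable_funS (@measurable_strip R n T) _ mf) => z /= /andP[-> zt] /=.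
  exact: lt_trans ltT.
have := (measurable_restrictT _ (@measurable_strip R n t)).1 mft.
congr (measurable_fun _ _); apply/funext => z; rewrite patchE /cut.
case: (boolP (0 < z.2 < t)) => h; first by rewrite mem_set.
by rewrite memNset//; exact/negP.
Qed.

Lemma cut_bounded f : P f -> exists M, forall z, `|cut t f z| <= M.
Proof.
move=> [_ _ _ [M HM] _]; exists M => z; rewrite /cut; case: ifPn => [/andP[z0 zt]|_].
  by apply: HM; rewrite !ltW// (lt_trans zt).
rewrite normr0 (le_trans (normr_ge0 (f 0 0)))// HM// lexx.
exact: ltW.
Qed.

Lemma usolE f (y : 'cV[R]_n) :
  U f y = Rintegral (lebnt R n) setT (fun z => GT S b c t y z * cut t f z).
Proof.
rewrite /U /usol Rintegral_mkcond; apply: eq_Rintegral => z _.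
rewrite patchE /GT /cut; case: (boolP (0 < z.2 < t)) => h.
  by rewrite mem_set.
by rewrite memNset ?mul0r//; exact/negP.
Qed.

Lemma cvg_usol f e : P f ->
  h^-1 *: ((U f \o shift x) (h *: e) - U f x) @[h --> 0^'] --> J f e.
Proof.
move=> Pf; have [M HM] := cut_bounded Pf.
have := @potential_derivative R n S b c t Spos t0 (cut t f) M e x (measurable_cut Pf) HM.
set Phi := fun h : R => _; rewrite -/(J f e).
have PhiE h : Phi h = U f (h *: e + x) by rewrite usolE addrC.
have <- // : (fun h => h^-1 *: (Phi h - Phi 0)) =
  (fun h => h^-1 *: ((U f \o shift x) (h *: e) - U f x)).
by apply/funext => h; rewrite !PhiE scale0r add0r.
Qed.

Lemma derivable_usol f e : P f -> derivable (U f) x e.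
Proof. by move=> Pf; apply: cvgP; exact: cvg_usol. Qed.

Lemma derive_usol f e : P f -> 'D_e (U f) x = J f e.
Proof. by move=> Pf; apply: cvg_lim => //; exact: cvg_usol. Qed.

Let iKf f e : P f -> (lebnt R n).-integrable setT (fun z => (KT S b c t e x z * cut t f z)%:E).
Proof.
move=> Pf; have [M HM] := cut_bounded Pf.
exact: (integrable_mul_bounded (integrable_KT b c Spos t0 e x) (measurable_cut Pf) HM).
Qed.

Lemma KT_linear a (e e' : 'cV[R]_n) z :
  KT S b c t (a *: e + e') x z = a * KT S b c t e x z + KT S b c t e' x z.
Proof.
rewrite /KT; case: ifP => _; last by rewrite mulr0 addr0.
rewrite /Kker; set w := invmx S *m (x - vecn z.1 + _).
have -> : invmx S *m (a *: e + e') = a *: (invmx S *m e) + invmx S *m e'.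
  by rewrite mulmxDr -scalemxAr.
have -> : dotp w (a *: (invmx S *m e) + invmx S *m e') =
    a * dotp w (invmx S *m e) + dotp w (invmx S *m e').
  rewrite /dotp mulr_sumr -big_split /=; apply: eq_bigr => i _; rewrite 2!mxE [in RHS]mulrCA.
  by rewrite [X in _ * (X + _)]mxE mulrDr.
ring.
Qed.

Lemma J_linear f a e e' : P f -> J f (a *: e + e') = a * J f e + J f e'.
Proof.
move=> Pf; have i1 : (lebnt R n).-integrable setT
    (fun z => (a * (KT S b c t e x z * cut t f z))%:E).
  rewrite (_ : (fun z => _) = (fun z => a%:E * (KT S b c t e x z * cut t f z)%:E)%E)//.
  by apply: integrableZl => //; exact: iKf.
rewrite /J -RintegralZl//; last exact: iKf.
rewrite -(RintegralD measurableT i1 (iKf e' Pf)).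
by apply: eq_Rintegral => z _; rewrite KT_linear; ring.
Qed.

(** [dirder] is assembled from the partial derivatives, each a pairing [J]; since [KT] is linear in
    the direction, expanding l in the unit vectors recombines them into one pairing. *)
Lemma dirder_usol f l : P f -> dirder (U f) x l = J f l.
Proof.
move=> Pf.
have J0 : J f 0 = 0.
  have := J_linear 1 0 0 Pf; rewrite scale1r addr0 mul1r => H; lra.
have HJ (r : seq 'I_n) : J f (\sum_(i <- r) l i 0 *: unitvec R i) = \sum_(i <- r) J f (unitvec R i) * l i 0.
  elim: r => [|i r IH]; first by rewrite !big_nil.
  by rewrite !big_cons J_linear// IH mulrC.
have -> : l = \sum_i l i 0 *: unitvec R i.
  apply/colP => j; rewrite summxE (bigD1 j)//= big1 ?addr0.
    by rewrite !mxE !eqxx mulr1.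
  by move=> i ij; rewrite !mxE eq_sym (negbTE ij) mulr0.
rewrite HJ /dirder; apply: eq_bigr => i _.
rewrite mxE derive_usol//; congr (_ * _).
rewrite summxE (bigD1 i)//= big1 ?addr0.
  by rewrite !mxE !eqxx mulr1.
by move=> j ij; rewrite !mxE eq_sym (negbTE ij) mulr0.
Qed.

Lemma eucl_inv_gt0 l : eucl l = 1 -> 0 < eucl (invmx S *m l).
Proof.
move=> l1; rewrite lt_neqAle eucl_ge0 andbT eq_sym; apply/negP => /eqP e0.
have m0 : invmx S *m l = 0.
  apply/colP => i; rewrite [RHS]mxE; apply/eqP; rewrite -normr_le0 -e0.
  exact: normr_le_eucl.
have l0 : l = 0 by rewrite -(mulKVmx (posdef_unitmx Spos) l) m0 mulmx0.
move: l1; rewrite l0 /eucl big1 ?sqrtr0 => [/eqP|i _]; first by rewrite eq_sym oner_eq0.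
by rewrite mxE expr0n.
Qed.

Lemma C_pl_gt0 l : eucl l = 1 -> 0 < C_pl S c p t l.
Proof.
move=> l1; rewrite -(Nq_C_pl c Spos t0 hp) powR_gt0//.
by apply: Nq_gt0 => //; exact: eucl_inv_gt0.
Qed.

Lemma dirder_le f l : P f -> eucl l = 1 ->
  (`|dirder (U f) x l|%:E <= (C_pl S c p t l)%:E * normpt p f t)%E.
Proof.
move=> Pf l1; rewrite dirder_usol//.
(* The class bounds the norm up to T, not t. Instead of comparing the two, an infinite norm is
   handled directly: the constant is positive, so the right side is then +oo. *)
have [->|Nlt] := eqVneq (normpt p f t) +oo%E.
  by rewrite gt0_muley ?lte_fin ?C_pl_gt0// leey.
have {}Nlt : (normpt p f t < +oo)%E by rewrite lt_neqAle Nlt leey.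
have := @hoelder_pconj _ _ R (lebnt R n) p (cut t f) (KT S b c t l x) _ p1 muT
  (measurable_cut Pf) (measurable_KT S b c t l x)
  (@integral_KT_powR R n S b c t Spos t0 l x (pconj p) q12 be1) Nlt.
rewrite (Nq_C_pl c Spos t0 hp); apply: le_trans.
rewrite EFin_normr_Rintegral//; last exact: iKf.
apply: le_abse_integral => //; exact: measurable_int (iKf l Pf).
Qed.

Let q1 : 1 <= pconj p. Proof. by case/andP: q12. Qed.
Let q0 : 0 < pconj p. Proof. exact: lt_le_trans q1. Qed.

Local Notation ext l := (extremal S b l x c t (pconj p)).

(** The strip height [s] is arbitrary: [T] serves for membership in the class, [t] for the pairing.
    Beyond t - ep the cutoff makes the function 0, so the bound persists where [KT] is 0. *)
Lemma cut_extremal_le s ep l z : 0 < ep ->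
  `|cut s (ext l ep) z| <= `|KT S b c t l x z| `^ (pconj p - 1).
Proof.
move=> ep0; rewrite /cut; case: ifPn => [/andP[z0 zs]|_]; last by rewrite normr0 powR_ge0.
rewrite /extremal; have [h|h] := leP (t - z.2) ep.
  by rewrite cutoff0// mul0r normr0 powR_ge0.
have zt : z.2 < t by rewrite -subr_gt0 (lt_trans ep0).
rewrite (_ : KT S b c t l x z = Kker S b c l (x - vecn z.1) (t - z.2)); last first.
  by rewrite /KT z0 zt.
have /andP[c0 c1] := cutoff_bounds ep (t - z.2).
rewrite normrM (ger0_norm c0) -[leRHS]mul1r; apply: ler_pM => //.
exact: dualF_le_powR.
Qed.

Lemma measurable_cut_extremal s ep l : measurable_fun setT (cut s (ext l ep)).
Proof.
apply: measurable_fun_ifT => //; first exact: measurable_strip_bool.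
exact: measurable_extremal.
Qed.

Lemma fclass_extremal ep l : eucl l = 1 -> 0 < ep <= 1 -> P (ext l ep).
Proof.
move=> l1 ep01; have /andP[ep0 ep1] := ep01; split.
- by apply: measurable_funTS; exact: measurable_extremal.
- have N0 : 0 < Nq S c t l (pconj p) by apply: Nq_gt0 => //; exact: eucl_inv_gt0.
  have := @Lnorm_le_dual _ _ R (lebnt R n) p (cut T (ext l ep)) (KT S b c t l x) _ p1 muT N0
    (measurable_KT S b c t l x) (measurable_cut_extremal T ep l)
    (@integral_KT_powR R n S b c t Spos t0 l x (pconj p) q12 be1)
    (fun z => cut_extremal_le T l z ep0).
  by move=> /le_lt_trans; apply; rewrite ltry.
- apply: continuous_subspaceT.
  by have [] := nice_extremal b l x c (pconj p) Spos t0 ltT ep0.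
- exists (expR (- ((2 - pconj p) / 2 * ln ep)) / ep) => y s _.
  exact: extremal_bounded.
- by move=> r r0; apply: (extremal_holder b l x c (pconj p) Spos t0 ltT ep01 al01).
Qed.

Lemma cvg_extremal l z :
  KT S b c t l x z * cut t (ext l (harmonic k)) z @[k --> \oo] --> `|KT S b c t l x z| `^ pconj p.
Proof.
rewrite /KT /cut; case: ifPn => [/andP[z0 zt]|_]; last first.
  by under eq_fun do rewrite mul0r; rewrite normr0 powR0 ?gt_eqF//; exact: cvg_cst.
have s0 : 0 < t - z.2 by rewrite subr_gt0.
have := @cvg_dualF R _ q12 (Kker S b c l (x - vecn z.1) (t - z.2)).
apply: cvg_trans; apply: near_eq_cvg; near=> k.
(* At a fixed point of the strip, for large k the cutoff equals 1 and the maximum in [extremal] is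
   the lag itself. *)
have h : 2 * harmonic k <= t - z.2.
  rewrite mulrC -ler_pdivlMr//; apply/ltW; near: k.
  apply: (cvgr_lt 0); last by rewrite divr_gt0.
  exact: cvg_harmonic.
have h0 : 0 < harmonic k :> R by rewrite /harmonic /= invr_gt0.
rewrite /extremal cutoff1// mul1r (max_idPl _)//.
by apply: le_trans h; lra.
Unshelve. all: by end_near. Qed.

Lemma C_pl_le l (C' : R) : eucl l = 1 ->
  (forall f, P f -> (`|dirder (U f) x l|%:E <= C'%:E * normpt p f t)%E) ->
  C_pl S c p t l <= C'.
Proof.
move=> l1 HC; rewrite -(Nq_C_pl c Spos t0 hp).
have N0 : 0 < Nq S c t l (pconj p) by apply: Nq_gt0 => //; exact: eucl_inv_gt0.
have h01 k : 0 < (harmonic k : R) <= 1.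
  by rewrite /harmonic /= invr_gt0 ltr0n /= invf_le1 ?ler1n.
apply: (@duality_limit _ _ R (lebnt R n) p (fun k => cut t (ext l (harmonic k)))
  (KT S b c t l x) _ _ p1 muT N0 (measurable_KT S b c t l x)
  (fun k => measurable_cut_extremal t (harmonic k) l)
  (@integral_KT_powR R n S b c t Spos t0 l x (pconj p) q12 be1)).
- by move=> k z; apply: cut_extremal_le; case/andP: (h01 k).
- by move=> z; exact: cvg_extremal.
- move=> k; have Pk := fclass_extremal l1 (h01 k).
  by have := HC _ Pk; rewrite dirder_usol.
Qed.

Lemma C_p_sup (l : 'cV[R]_n) : eucl l = 1 ->
  C_p S c p t = sup [set C_pl S c p t l' | l' in [set l' : 'cV[R]_n | eucl l' = 1]].
Proof.
move=> l1; pose k := (denom S p)^-1 * bracket n c p t.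
(* Positivity is read off from that of [C_pl] at the given unit vector; it lets the factor pass
   through the supremum. *)
have k0 : 0 < k.
  have := C_pl_gt0 l1; rewrite /C_pl -mulrA -/k.
  by rewrite pmulr_rgt0// eucl_inv_gt0.
rewrite /C_p -mulrA -/k /spec_norm -sup_scale//; last exact: has_sup_eucl_mulmx l1.
congr sup; apply/seteqP; split => [_ [_ [v v1 <-] <-]|_ [v v1 <-]].
  by exists v => //; rewrite /C_pl -mulrA.
by exists (eucl (invmx S *m v)); [exists v|rewrite /C_pl -mulrA].
Qed.

Lemma C_pl_le_C_p l : eucl l = 1 -> C_pl S c p t l <= C_p S c p t.
Proof.
move=> l1; rewrite (C_p_sup l1); apply: ub_le_sup; last by exists l.
have [_ [B HB]] := has_sup_eucl_mulmx (invmx S) l1.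
exists (B * ((denom S p)^-1 * bracket n c p t)) => _ [v /= v1 <-].
rewrite /C_pl -mulrA; apply: ler_wpM2r; last by apply: HB; exists v.
apply: mulr_ge0; last exact: powR_ge0.
by rewrite invr_ge0 ltW// denom_gt0.
Qed.

(** The directional inequality is applied in the direction of the gradient, which depends on f; this
    is why a bound uniform in l is used. A zero gradient has no direction and is treated apart. *)
Lemma eucl_grad_le f (l : 'cV[R]_n) : P f -> eucl l = 1 ->
  ((eucl (grad (U f) x))%:E <= (C_p S c p t)%:E * normpt p f t)%E.
Proof.
move=> Pf l1; have N0 : (0 <= normpt p f t)%E by exact: Lnorm_ge0.
have [g0|g0] := leP (eucl (grad (U f) x)) 0.
  apply: (@le_trans _ _ 0%E); first by rewrite lee_fin.
  by apply: mule_ge0 => //; rewrite lee_fin (le_trans _ (C_pl_le_C_p l1))// ltW// C_pl_gt0.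
have [v1 vE] := eucl_unit_scale g0.
set v := _ *: _ in v1 vE.
rewrite -vE -[dotp _ _]/(dirder (U f) x v).
apply: (@le_trans _ _ (`|dirder (U f) x v|%:E)); first by rewrite lee_fin ler_norm.
apply: (le_trans (dirder_le Pf v1)).
by apply: lee_wpmul2r => //; rewrite lee_fin C_pl_le_C_p.
Qed.

(** By Cauchy-Schwarz a constant valid for the gradient is valid for each direction, so it dominates
    every [C_pl], hence their supremum. *)
Lemma C_p_le (C' : R) (l : 'cV[R]_n) : eucl l = 1 ->
  (forall f, P f -> ((eucl (grad (U f) x))%:E <= C'%:E * normpt p f t)%E) ->
  C_p S c p t <= C'.
Proof.
move=> l1 HC; rewrite (C_p_sup l1); apply: ge_sup.
  by exists (C_pl S c p t l); exists l.
move=> _ [v /= v1 <-]; apply: C_pl_le => // f Pf.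
apply: le_trans (HC f Pf); rewrite lee_fin.
exact: normr_dotp_unit.
Qed.

End main.

Lemma C_p_infty (R : realType) (n : nat) (S : 'M[R]_n) (c t : R) :
  C_p S c +oo%E t = spec_norm (invmx S) / Num.sqrt pi *
    Rintegral (@lebesgue_measure R) `]0, t[ (fun tau => expR (c * tau) / Num.sqrt tau).
Proof.
rewrite /C_p /bracket /=; congr (_ * _).
have -> : (1 + 1) / 2 = 1 :> R by lra.
rewrite Gamma1 powR1 invr1 mulr1 mul1r powRr1; last first.
  by apply: Rintegral_ge0 => s _; apply: mulr_ge0; [exact: expR_ge0|rewrite invr_ge0 powR_ge0].
apply: eq_Rintegral => s; rewrite inE /= in_itv /= => /andP[s0 _].
by rewrite mul1r subrr mulr0 add0r mul1r powR12_sqrt// ltW.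
Qed.

Theorem theorem2 (R : realType) (n : nat) (T : R) (A S : 'M[R]_n)
    (b : 'cV[R]_n) (c alpha : R) (p : \bar R) (x : 'cV[R]_n) (t : R)
    (l : 'cV[R]_n) :
  (1 <= n)%N -> 0 < T ->
  sym_posdef A -> sym_posdef S -> S *m S = A ->
  0 < alpha < 1 ->
  ((n + 2)%:R%:E < p)%E ->
  0 < t < T ->
  eucl l = 1 ->
  let P := @fclass R n T alpha p in
  let U := fun f : 'cV[R]_n -> R -> R => (fun y => usol S b c f y t) in
  (* the partial derivatives of u(., t) exist at x *)
  (forall f, P f -> forall i : 'I_n, derivable (U f) x (unitvec R i)) /\
  (* sharp constant for |du/dl (x,t)| <= C ||f||_{p,t} *)
  sharp_const P (fun f => `|dirder (U f) x l|) (fun f => normpt p f t)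
    (C_pl S c p t l) /\
  (* C_p(t) = max_{|l|=1} C_{p,l}(t) *)
  C_p S c p t = sup [set C_pl S c p t l' | l' in [set l' : 'cV[R]_n | eucl l' = 1]] /\
  (* sharp constant for |grad_x u (x,t)| <= C ||f||_{p,t} *)
  sharp_const P (fun f => eucl (grad (U f) x)) (fun f => normpt p f t)
    (C_p S c p t) /\
  (* the case p = infinity *)
  (p = +oo%E ->
   C_p S c p t = spec_norm (invmx S) / Num.sqrt pi *
     Rintegral (@lebesgue_measure R) `]0, t[ (fun tau => expR (c * tau) / Num.sqrt tau)).
Proof.
move=> _ _ _ [_ Spos] _ al01 hp tT l1 P U.
split; first by move=> f Pf i; apply: derivable_usol Pf.
split.
  split=> [f Pf|C' HC]; first by apply: dirder_le Pf l1.
  by apply: C_pl_le HC.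
split; first exact: (C_p_sup c Spos hp tT l1).
split.
  split=> [f Pf|C' HC]; first by apply: eucl_grad_le Pf l1.
  by apply: C_p_le l1 HC.
by move=> ->; exact: C_p_infty.
Qed.
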